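(* Let $G \in \{\mathrm{U}, \mathrm{Sp}, \mathrm{O}, \mathrm{SO(even)}, \mathrm{SO(odd)}\}$ and $\Delta>0$. Let $\mathcal{F}$ range over finite families of automorphic objects with $\#\mathcal{F}\to\infty$, where each family satisfies: for each $f\in\mathcal{F}$ the $L$-function $L(s,f)=\sum_{n\ge1}\lambda_f(n)n^{-s}$ extends to an entire function; there is a completed $L$-function $\Lambda(s,f)=L_\infty(s,f)L(s,f)$ with $\Lambda(s,f)=\varepsilon_f\Lambda(1-s,\bar f)$, $|\varepsilon_f|=1$, where $L(s,\bar f)$ has coefficients $\overline{\lambda_f(n)}$; $L_\infty(s,f)$ has no zeros on $\mathrm{Re}(s)=1/2$; if $f\in\mathcal{F}$ then $\bar f\in\mathcal{F}$; and (GRH) every non-trivial zero $\frac12+i\gamma_f$ of $L(s,f)$ has $\gamma_f\in\mathbb{R}$. Suppose that for every even Schwartz function $\phi:\mathbb{R}\to\mathbb{R}$ with $\mathrm{supp}(\widehat{\phi})\subset(-\Delta,\Delta)$, \[ \lim_{\# \mathcal{F}\to\infty} \frac{1}{\#\mathcal{F}} \sum_{f\in \mathcal{F}} \sum_{\gamma_f} \phi\!\left( \gamma_f \frac{\log c_f}{2\pi}\right) = \int_\mathbb{R} \phi(x)\, W_G(x)\, dx, \] with $c_f$ the analytic conductor and zeros counted with multiplicity. For each $f$ let $\mathcal{Z}(f)$ be a sub-multiset of the zeros of $L(s,f)$ at the central point ($\gamma_f=0$) such that $\lim_{\#\mathcal{F}\to\infty}\frac{1}{\#\mathcal{F}}\sum_{f}\#\mathcal{Z}(f)$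 equals $\frac12$ if $G=\mathrm O$ and $1$ if $G=\mathrm{SO(odd)}$, and $\mathcal{Z}(f)=\emptyset$ if $G\in\{\mathrm U,\mathrm{Sp},\mathrm{SO(even)}\}$. Set $G^\sharp=G$ if $G\in\{\mathrm U,\mathrm{Sp},\mathrm{SO(even)}\}$, $\mathrm O^\sharp=\mathrm U$, $\mathrm{SO(odd)}^\sharp=\mathrm{Sp}$. Let $K=K_{G^\sharp,\pi\Delta}$ and let $\xi_0$ be the smallest positive real zero of $x\mapsto \mathrm{Re}\big((1-ix)K(i,x)\big)$. Then \[ \limsup_{\# \mathcal{F} \to \infty} \ \min_{\substack{ \gamma_f \notin \mathcal{Z}(f) \\ f \in \mathcal{F}}} \left|\frac{\gamma_{f} \,\log c_f}{2\pi}\right| \leq \xi_0. \]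
   Context: Fourier transform $\widehat{F}(y)=\int e^{-2\pi ixy}F(x)dx$. Densities: $W_{\mathrm U}=1$; $W_{\mathrm{Sp}}(x)=1-\frac{\sin 2\pi x}{2\pi x}$; $W_{\mathrm O}(x)=1+\frac12\boldsymbol{\delta}_0(x)$; $W_{\mathrm{SO(even)}}(x)=1+\frac{\sin 2\pi x}{2\pi x}$; $W_{\mathrm{SO(odd)}}(x)=1-\frac{\sin 2\pi x}{2\pi x}+\boldsymbol{\delta}_0(x)$, with $\boldsymbol{\delta}_0$ the Dirac delta at $0$. For $H\in\{\mathrm U,\mathrm{Sp},\mathrm{SO(even)}\}$ and $\Delta>0$, $\mathcal{H}_{H,\pi\Delta}$ is the Hilbert space of entire functions $F$ of exponential type at most $\pi\Delta$ with $\int_{\mathbb{R}}|F|^2W_H<\infty$ and inner product $\int F\overline{G}W_H$; its reproducing kernel $K_{H,\pi\Delta}$ is the unique function on $\mathbb{C}\times\mathbb{C}$ with $K_{H,\pi\Delta}(w,\cdot)$ in the space and $F(w)=\int_{\mathbb{R}}F(x)\overline{K_{H,\pi\Delta}(w,x)}W_H(x)dx$ for all $F$ in the space and all $w\in\mathbb{C}$. *)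

(* Defs.v *)
From Stdlib Require Import Reals List Lra.
From Coquelicot Require Import Coquelicot.
Open Scope R_scope.

Definition cexp (z : C) : C := (exp (Re z) * cos (Im z), exp (Re z) * sin (Im z)).

Definition npow_neg (n : nat) (s : C) : C := cexp (Cmult (RtoC (- ln (INR n))) s).

Definition entire (F : C -> C) : Prop := forall z : C, ex_derive F z.

Definition zero_order (F : C -> C) (rho : C) (m : nat) : Prop :=
  exists g : C -> C, entire g /\ g rho <> RtoC 0 /\
    forall z : C, F z = Cmult (pow_n (Cminus z rho) m) (g z).

(* the line integral over R, as an improper Riemann integral *)
Definition over_R := (Rbar_locally m_infty).
Definition over_R' := (Rbar_locally p_infty).

(* Abstract L-function data of an "automorphic object" f              *)
(* L(s,f) = Lf, Dirichlet coefficients lam, root number eps,          *)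
(* analytic conductor cond, and the archimedean factor                *)
(* L_oo(s,f) = Pinf(s)/Qinf(s) given as a quotient of entire functions *)
(* (a meromorphic function; e.g. Qinf = 1/Gamma-factors).             *)
Record Lobj := mkLobj {
  lam  : nat -> C;
  Lf   : C -> C;
  Pinf : C -> C;
  Qinf : C -> C;
  eps  : C;
  cond : R
}.

(* multiplicity of rho as a zero of the completed L-function
   Lambda(s,f) = L_oo(s,f) L(s,f) = Pinf(s) Lf(s) / Qinf(s)
   (zero of order m >= 0; m = 0 means not a zero) *)
Definition Lam_mult (f : Lobj) (rho : C) (m : nat) : Prop :=
  exists a b : nat,
    zero_order (fun s => Cmult (Pinf f s) (Lf f s)) rho a /\
    zero_order (Qinf f) rho b /\ m = (a - b)%nat.

Definition Lobj_ok (f : Lobj) : Prop :=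
  (forall s : C, 1 < Re s ->
     is_series (fun k => Cmult (lam f (S k)) (npow_neg (S k) s)) (Lf f s)) /\
  entire (Lf f) /\
  entire (Pinf f) /\ entire (Qinf f) /\ (exists s, Qinf f s <> RtoC 0) /\
  Cmod (eps f) = 1 /\
  (* L_oo(s,f) has no zeros on Re s = 1/2 *)
  (forall s : C, Re s = 1/2 -> forall a b : nat,
      zero_order (Pinf f) s a -> zero_order (Qinf f) s b -> (a <= b)%nat) /\
  (* GRH: every non-trivial zero (zero of Lambda) has real part 1/2 *)
  (forall (rho : C) (m : nat), Lam_mult f rho m -> (0 < m)%nat -> Re rho = 1/2) /\
  1 < cond f.

(* g is the dual object \bar f of f: conjugate coefficients and
   Lambda(s,f) = eps_f Lambda(1-s, \bar f) (as meromorphic functions) *)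
Definition is_dual (f g : Lobj) : Prop :=
  (forall n, lam g n = Cconj (lam f n)) /\
  forall s : C,
    Cmult (Cmult (Pinf f s) (Lf f s)) (Qinf g (Cminus (RtoC 1) s)) =
    Cmult (eps f)
      (Cmult (Cmult (Pinf g (Cminus (RtoC 1) s)) (Lf g (Cminus (RtoC 1) s))) (Qinf f s)).

Definition crit (gamma : R) : C := (1/2, gamma).

(* [zero_sum f h l]: sum over the non-trivial zeros 1/2 + i gamma_f of
   L(s,f), counted with multiplicity, of h(gamma_f) equals l
   (the sum taken as limit of the partial sums over |gamma| <= T). *)
Definition zero_sum (f : Lobj) (h : R -> R) (l : R) : Prop :=
  exists mu : R -> nat,
    (forall gamma, Lam_mult f (crit gamma) (mu gamma)) /\
    (forall T : R, exists lst : list R, NoDup lst /\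
        forall gamma, In gamma lst <-> ((0 < mu gamma)%nat /\ Rabs gamma <= T)) /\
    (forall e : R, 0 < e -> exists T0 : R, forall T : R, T0 <= T ->
      forall lst : list R, NoDup lst ->
        (forall gamma, In gamma lst <-> ((0 < mu gamma)%nat /\ Rabs gamma <= T)) ->
        Rabs (fold_right Rplus 0 (map (fun g => INR (mu g) * h g) lst) - l) < e).

Definition avg (N : nat) (a : nat -> R) : R :=
  / INR N * fold_right Rplus 0 (map a (seq 0 N)).

Inductive symtype := SU | SSp | SO | SSOeven | SSOodd.

Definition sinc2pi (x : R) : R := if Req_EM_T x 0 then 1 else sin (2 * PI * x) / (2 * PI * x).

(* absolutely continuous part of W_G and the mass of the Dirac delta at 0 *)
Definition Wac (G : symtype) (x : R) : R :=
  match G with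
  | SU => 1
  | SSp => 1 - sinc2pi x
  | SO => 1
  | SSOeven => 1 + sinc2pi x
  | SSOodd => 1 - sinc2pi x
  end.

Definition Wdelta (G : symtype) : R :=
  match G with
  | SO => 1/2
  | SSOodd => 1
  | _ => 0
  end.

Definition int_W (G : symtype) (phi : R -> R) : R :=
  RInt_gen (fun x => phi x * Wac G x) over_R over_R' + Wdelta G * phi 0.

Definition sharp (G : symtype) : symtype :=
  match G with
  | SO => SU
  | SSOodd => SSp
  | H => H
  end.

Definition central_count (G : symtype) : R :=
  match G with
  | SO => 1/2
  | SSOodd => 1
  | _ => 0
  end.

Definition even_fun (phi : R -> R) : Prop := forall x, phi (- x) = phi x.

Definition schwartz (phi : R -> R) : Prop :=
  (forall (k : nat) (x : R), ex_derive_n phi k x) /\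
  (forall (k m : nat), exists M : R, forall x, Rabs (x ^ m * Derive_n phi k x) <= M).

Definition fourier (phi : R -> R) (y : R) : C :=
  RInt_gen (V := C_R_CompleteNormedModule) (fun x => Cmult (RtoC (phi x)) (cexp (0, - 2 * PI * x * y)))
           over_R over_R'.

Definition fourier_supp_in (phi : R -> R) (D : R) : Prop :=
  forall y : R,
    (forall e : R, 0 < e -> exists y', Rabs (y' - y) < e /\ fourier phi y' <> RtoC 0) ->
    - D < y < D.

(* The de Branges-type space H_{H, pi Delta} and its reproducing kernel *)
(* (used only for H in {U, Sp, SO(even)}, whose densities are functions) *)

Definition exp_type_le (F : C -> C) (tau : R) : Prop :=
  forall e : R, 0 < e -> exists M : R, forall z : C, Cmod (F z) <= M * exp ((tau + e) * Cmod z).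

Definition in_space (H : symtype) (tau : R) (F : C -> C) : Prop :=
  entire F /\ exp_type_le F tau /\
  ex_RInt_gen (fun x : R => (Cmod (F (RtoC x)))^2 * Wac H x) over_R over_R'.

Definition repr_kernel (H : symtype) (tau : R) (K : C -> C -> C) : Prop :=
  forall w : C, in_space H tau (K w) /\
    forall F : C -> C, in_space H tau F ->
      is_RInt_gen (fun x : R => Cmult (Cmult (F (RtoC x)) (Cconj (K w (RtoC x)))) (RtoC (Wac H x)))
                  over_R over_R' (F w).

(* Main.v *)
(* Let [A(x) = Re ((1 - i x) K(i, x))].  By uniqueness of the reproducing kernel [A] is even, so
   [F0 = A / (x^2 - xi0^2)] extends to an even entire function of exponential type [pi Delta], and
   [(1 + i z) F0] lies in the Hilbert space.  Since [1 + i z] vanishes at [z = i], reproducing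
   [(1 + i z) F0] at [i] gives [int (x^2 - xi0^2) F0^2 W = 0], hence [int (x^2 - a^2) F0^2 W < 0]
   for every [a > xi0].  By Phragmén–Lindelöf and Cauchy's estimates (Bernstein's inequality), after
   a slight dilation and multiplication by a rapidly decreasing band-limited function, [F0] becomes
   a Schwartz function [f] whose derivatives grow at most like [s^n] with [s < pi Delta].  Then
   [phi = (x^2 - a^2) f^2] is an admissible test function of the one-level density (repeated
   integration by parts localises its Fourier transform), it is nonnegative for [|x| >= a], and its
   integral against [W] is still negative.  If no zero outside [Z(f)] were below [a], the density
   sums would be at least [phi(0)] times the average of [#Z(f)], contradicting the density theorem. *)
Require Import Defs.
From Stdlib Require Import Reals List Lra Lia Psatz Factorial ClassicalEpsilon FunctionalExtensionality.
From Coquelicot Require Import Coquelicot.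
Open Scope R_scope.

(** The balance identity rests on a pairing: [(1 + i x) conj K(i,x)] is the conjugate of
    [(1 - i x) K(i,x)], so pairing [(1 + i z) F0] with the kernel has real part [int F0 A W], where
    [A = (x^2 - xi0^2) F0]. Since [xi0] is the first zero, [A(xi0/2) <> 0] and [F0] has positive
    mass. [F0] itself is not admissible: its known integrability is that of [(1 + x^2) F0^2], while
    a test function is Schwartz with transform supported strictly inside [(-Delta, Delta)]. One
    number is tracked for this, the geometric rate at which derivatives grow: rates add under
    products and scale under dilations, a polynomial factor costs an arbitrarily small rate, and a
    rate below [2 pi Delta] confines the Fourier support. Square integrability gives no pointwise
    bound at once, so Bernstein's inequality is applied to the primitive of [F0], which is bounded.
    Negativity against [W] for [G^sharp] is the right target: [W_G] is that density plus a delta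
    mass equal to the limiting average of [#Z(f)], so the delta and the removed central zeros
    contribute the same multiple of [phi(0)] and cancel. *)

(** * Bisection and integrals of complex-valued functions *)

(* [ring] does not see through Coquelicot's carrier projections. *)
Ltac as_R_eq := match goal with |- @eq _ ?a ?b => change (@eq R a b) end.

(** A property that always passes to one of the four quarters survives on nested rectangles around a
    point. [goursat] uses it for a boundary integral that is too large, [evt2] for a rectangle whose
    values dominate all others; the sizes [w/2^n] stay explicit for the estimates there. *)
Lemma bisect2 (Bad : R -> R -> R -> R -> Prop) :
  (forall a c w h, 0 <= w -> 0 <= h -> Bad a c w h ->
     Bad a c (w/2) (h/2) \/ Bad (a+w/2) c (w/2) (h/2) \/
     Bad a (c+h/2) (w/2) (h/2) \/ Bad (a+w/2) (c+h/2) (w/2) (h/2)) ->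
  forall a0 c0 w h, 0 <= w -> 0 <= h -> Bad a0 c0 w h ->
  exists x y, a0 <= x <= a0 + w /\ c0 <= y <= c0 + h /\
    forall n, exists a c, Bad a c (w/2^n) (h/2^n) /\
      a <= x <= a + w/2^n /\ c <= y <= c + h/2^n.
Proof.
  intros Hs a0 c0 w h Hw Hh H0.
  assert (Hpos : forall n v, 0 <= v -> 0 <= v/2^n).
  { intros n v Hv. apply Rmult_le_pos; auto. left. apply Rinv_0_lt_compat. apply pow_lt; lra. }
  assert (Hhalf : forall n v, v/2^n/2 = v/2^(S n)).
  { intros n v. simpl. field. apply pow_nonzero; lra. }
  pose (St := fun n (p : R*R) => Bad (fst p) (snd p) (w/2^n) (h/2^n)).
  assert (step : forall n p, St n p -> {q : R*R | St (S n) q /\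
     fst p <= fst q <= fst p + w/2^n/2 /\ snd p <= snd q <= snd p + h/2^n/2}).
  { intros n p Hp. apply constructive_indefinite_description.
    pose proof (Hpos n w Hw). pose proof (Hpos n h Hh).
    destruct (Hs _ _ _ _ (Hpos n w Hw) (Hpos n h Hh) Hp) as [B|[B|[B|B]]];
      rewrite !Hhalf in B.
    - exists p. unfold St. split; auto. lra.
    - exists (fst p + w/2^n/2, snd p). unfold St; simpl fst; simpl snd.
      rewrite !Hhalf. pose proof (Hpos (S n) w Hw). pose proof (Hpos (S n) h Hh). split; auto. lra.
    - exists (fst p, snd p + h/2^n/2). unfold St; simpl fst; simpl snd.
      rewrite !Hhalf. pose proof (Hpos (S n) w Hw). pose proof (Hpos (S n) h Hh). split; auto. lra.
    - exists (fst p + w/2^n/2, snd p + h/2^n/2). unfold St; simpl fst; simpl snd.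
      rewrite !Hhalf. pose proof (Hpos (S n) w Hw). pose proof (Hpos (S n) h Hh). split; auto. lra. }
  assert (H0' : St 0%nat (a0, c0)).
  { unfold St. simpl. replace (w/1) with w by field. replace (h/1) with h by field. exact H0. }
  (* The recursion carries the proof of [St n] along, since [step] chooses a quarter only for a
     rectangle that has the property. *)
  pose (seqp := fix s (n : nat) : {p | St n p} :=
     match n with
     | O => exist _ (a0, c0) H0'
     | S m => let (p, Hp) := s m in
              let (q, Hq) := step m p Hp in exist _ q (proj1 Hq)
     end).
  pose (A := fun n => fst (proj1_sig (seqp n))). pose (Cc := fun n => snd (proj1_sig (seqp n))).
  assert (Hst : forall n, A n <= A (S n) <= A n + w/2^n/2 /\ Cc n <= Cc (S n) <= Cc n + h/2^n/2).
  { intros n. unfold A, Cc. simpl. destruct (seqp n) as [p Hp].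
    destruct (step n p Hp) as [q Hq]. simpl. tauto. }
  assert (lim : forall (u : nat -> R) v, 0 <= v -> (forall n, u n <= u (S n) <= u n + v/2^n/2) ->
      exists x, forall n, u n <= x <= u n + v/2^n).
  { intros u v Hv Hu.
    (* After stage [n] a corner moves by at most the telescoping sum of the half-widths, which keeps
       the limit inside every rectangle. *)
    assert (Hmon : forall n k, u n <= u (n+k)%nat <= u n + v/2^n - v/2^(n+k)).
    { intros n k. induction k.
      - replace (n+0)%nat with n by lia. lra.
      - replace (n + S k)%nat with (S (n+k)) by lia. pose proof (Hu (n+k)%nat) as HH.
        rewrite Hhalf in HH.
        assert (v/2^(n+k) = v/2^(S (n+k)) + v/2^(S(n+k))).
        { simpl. field. apply pow_nonzero; lra. } lra. }
    destruct (completeness (fun y => exists n, y = u n)) as [x [Hx1 Hx2]].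
    - exists (u 0%nat + v). intros y [n ->]. pose proof (Hmon 0%nat n). simpl in H.
      pose proof (Hpos n v Hv). replace (v/1) with v in H by field. lra.
    - exists (u 0%nat), 0%nat; auto.
    - exists x. intros n. split.
      + apply Hx1. exists n; auto.
      + apply Hx2. intros y [m ->]. destruct (Nat.le_ge_cases m n) as [Hl|Hl].
        * pose proof (Hmon m (n-m)%nat). replace (m + (n-m))%nat with n in H by lia.
          pose proof (Hpos n v Hv). lra.
        * pose proof (Hmon n (m-n)%nat). replace (n + (m-n))%nat with m in H by lia.
          pose proof (Hpos m v Hv). lra. }
  destruct (lim A w Hw (fun n => proj1 (Hst n))) as [x Hx].
  destruct (lim Cc h Hh (fun n => proj2 (Hst n))) as [y Hy].
  exists x, y. split; [|split].
  - generalize (Hx 0%nat). unfold A. simpl. replace (w/1) with w by field. auto.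
  - generalize (Hy 0%nat). unfold Cc. simpl. replace (h/1) with h by field. auto.
  - intros n. exists (A n), (Cc n). split; [|split]; auto.
    unfold A, Cc. apply (proj2_sig (seqp n)).
Qed.

Definition ccont (f : R -> C) := forall t, continuous (fun t => Re (f t)) t /\ continuous (fun t => Im (f t)) t.
Definition CInt (f : R -> C) (a b : R) : C := (RInt (fun t => Re (f t)) a b, RInt (fun t => Im (f t)) a b).

Lemma ex_RInt_cont (f : R -> R) a b : (forall t, continuous f t) -> ex_RInt f a b.
Proof. intros H. apply (ex_RInt_continuous (V := R_CompleteNormedModule)). auto. Qed.

Lemma C_eq (z w : C) : Re z = Re w -> Im z = Im w -> z = w.
Proof. destruct z, w; simpl; intros; subst; auto. Qed.

Lemma CInt_ext f g a b : (forall t, f t = g t) -> CInt f a b = CInt g a b.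
Proof. intros H. unfold CInt. f_equal; apply RInt_ext; intros; rewrite H; auto. Qed.

Lemma CInt_plus f g a b : ccont f -> ccont g -> CInt (fun t => f t + g t)%C a b = (CInt f a b + CInt g a b)%C.
Proof.
  intros Hf Hg. apply C_eq; simpl.
  - rewrite <- (RInt_plus (V := R_CompleteNormedModule)); [reflexivity | |]; apply ex_RInt_cont; intros t; first [apply (Hf t)|apply (Hg t)].
  - rewrite <- (RInt_plus (V := R_CompleteNormedModule)); [reflexivity | |]; apply ex_RInt_cont; intros t; first [apply (Hf t)|apply (Hg t)].
Qed.

Lemma CInt_scal (c : C) f a b : ccont f -> CInt (fun t => c * f t)%C a b = (c * CInt f a b)%C.
Proof.
  intros Hf.
  assert (E : forall g, (forall t, continuous g t) -> forall k, k * RInt g a b = RInt (fun t => k * g t) a b).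
  { intros g Hg k. symmetry. apply (RInt_scal (V := R_CompleteNormedModule) g a b k). apply ex_RInt_cont; auto. }
  assert (Hr : forall t, continuous (fun t => Re (f t)) t) by (intros t; apply (Hf t)).
  assert (Hi : forall t, continuous (fun t => Im (f t)) t) by (intros t; apply (Hf t)).
  assert (Hk : forall k (g : R -> R), (forall t, continuous g t) -> forall t, continuous (fun t => k * g t) t).
  { intros k g Hg t. apply (continuous_scal_r (V := R_NormedModule) k g). auto. }
  apply C_eq; simpl.
  - rewrite !E by auto.
    rewrite <- (RInt_minus (V := R_CompleteNormedModule)); [|apply ex_RInt_cont; apply Hk; auto..].
    apply RInt_ext. intros; reflexivity.
  - rewrite !E by auto.
    rewrite <- (RInt_plus (V := R_CompleteNormedModule)); [|apply ex_RInt_cont; apply Hk; auto..].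
    apply RInt_ext. intros; reflexivity.
Qed.

Lemma CInt_Chasles f a b c : ccont f -> (CInt f a b + CInt f b c)%C = CInt f a c.
Proof.
  intros Hf. apply C_eq; simpl.
  - apply (RInt_Chasles (V := R_CompleteNormedModule)); apply ex_RInt_cont; intros t; apply (Hf t).
  - apply (RInt_Chasles (V := R_CompleteNormedModule)); apply ex_RInt_cont; intros t; apply (Hf t).
Qed.

Lemma Cmod_Re_Im z : Cmod z ^ 2 = Re z ^ 2 + Im z ^ 2.
Proof. apply Cmod2_alt. Qed.

Lemma im_le_Cmod z : Rabs (Im z) <= Cmod z.
Proof. eapply Rle_trans; [|apply Rmax_Cmod]. apply Rmax_r. Qed.

Lemma Cmod_le_Re_Im z : Cmod z <= Rabs (Re z) + Rabs (Im z).
Proof.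
  pose proof (Rabs_pos (Re z)). pose proof (Rabs_pos (Im z)).
  apply Rsqr_incr_0_var; [|lra]. unfold Rsqr.
  pose proof (Cmod_Re_Im z). rewrite <- (pow2_abs (Re z)), <- (pow2_abs (Im z)) in H1. nra.
Qed.

Lemma ccont_scal c f : ccont f -> ccont (fun t => c * f t)%C.
Proof.
  intros Hf t. destruct (Hf t) as [H1 H2]. 
  assert (Hk : forall k (g : R -> R), (continuous g t) -> continuous (fun t => k * g t) t).
  { intros k g Hg. apply (continuous_scal_r (V := R_NormedModule) k g). auto. }
  split; simpl.
  - apply (continuous_minus (V := R_NormedModule)); apply Hk; auto.
  - apply (continuous_plus (V := R_NormedModule)); apply Hk; auto.
Qed.

(** Multiplying by the conjugate of the integral makes the integral real and nonnegative, so it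
    suffices to bound the real part of the rotated integrand. *)
Lemma CInt_le f a b M : a <= b -> ccont f -> (forall t, a <= t <= b -> Cmod (f t) <= M) ->
  Cmod (CInt f a b) <= M * (b - a).
Proof.
  intros Hab Hf HM. set (I := CInt f a b).
  destruct (Req_dec (Cmod I) 0) as [E|E].
  - rewrite E. destruct (Req_dec a b) as [->|Hn]; [lra|].
    assert (0 <= M). { eapply Rle_trans; [apply Cmod_ge_0|]. apply (HM a). lra. } nra.
  - pose proof (Cmod_ge_0 I) as H0. assert (Hp : 0 < Cmod I) by lra.
    assert (Hc : (Cconj I * I)%C = RtoC (Cmod I ^ 2)).
    { rewrite Cmod_Re_Im. apply C_eq; simpl; ring. }
    pose proof (CInt_scal (Cconj I) f a b Hf) as HS. fold I in HS. rewrite Hc in HS.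
    assert (HR : RInt (fun t => Re (Cconj I * f t)%C) a b = Cmod I ^ 2).
    { apply (f_equal fst) in HS. simpl in HS. simpl. rewrite HS. reflexivity. }
    assert (HB : RInt (fun t => Re (Cconj I * f t)%C) a b <= RInt (fun _ => Cmod I * M) a b).
    { apply RInt_le; auto.
      - apply ex_RInt_cont. intros t. apply (ccont_scal (Cconj I) f Hf t).
      - apply (ex_RInt_const (V := R_NormedModule)).
      - intros x Hx. eapply Rle_trans; [apply Rle_abs|]. eapply Rle_trans; [apply re_le_Cmod|].
        rewrite Cmod_mult, Cmod_conj. apply Rmult_le_compat_l; [lra|]. apply HM. lra. }
    rewrite HR, RInt_const in HB. unfold scal in HB; simpl in HB; unfold mult in HB; simpl in HB.
    apply Rmult_le_reg_l with (Cmod I); auto. nra.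
Qed.

(** * Goursat's theorem for closed 1-forms *)

(** Total differentiability over the reals, with [p] and [q] the two partial derivatives. A form
    [P dx + Q dy] is closed when the second partial of [P] is the first partial of [Q]; [goursat]
    expresses this by the shared [q]. *)
Definition cdiff (P : R -> R -> C) (x y : R) (p q : C) :=
  forall e, 0 < e -> exists d, 0 < d /\ forall x' y', Rabs (x' - x) < d -> Rabs (y' - y) < d ->
    Cmod (P x' y' - P x y - p * RtoC (x' - x)%R - q * RtoC (y' - y)%R)%C <= e * (Rabs (x' - x) + Rabs (y' - y)).

Lemma continuous_eps (f : R -> R) x :
  (forall e, 0 < e -> exists d, 0 < d /\ forall y, Rabs (y - x) < d -> Rabs (f y - f x) < e) ->
  continuous f x.
Proof.
  intros H. apply continuity_pt_filterlim. intros e He. destruct (H e He) as [d [Hd H']].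
  exists d. split; auto. intros y [_ Hy]. apply H'. exact Hy.
Qed.

Lemma continuous_eps_inv (f : R -> R) x : continuous f x ->
  forall e, 0 < e -> exists d, 0 < d /\ forall y, Rabs (y - x) < d -> Rabs (f y - f x) < e.
Proof.
  intros H e He. destruct (proj1 (filterlim_locally _ _) H (mkposreal e He)) as [d Hd].
  exists d. split; [apply cond_pos|]. intros y Hy. apply Hd. exact Hy.
Qed.

Lemma ccont_eps (f : R -> C) :
  (forall x e, 0 < e -> exists d, 0 < d /\ forall y, Rabs (y - x) < d -> Cmod (f y - f x)%C < e) ->
  ccont f.
Proof.
  intros H x. split; apply continuous_eps; intros e He; destruct (H x e He) as [d [Hd H']];
    exists d; split; auto; intros y Hy; eapply Rle_lt_trans; [|apply (H' y Hy)| |apply (H' y Hy)].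
  - exact (re_le_Cmod (f y - f x)%C).
  - exact (im_le_Cmod (f y - f x)%C).
Qed.

Lemma cdiff_cont P x y p q : cdiff P x y p q ->
  forall e, 0 < e -> exists d, 0 < d /\ forall x' y', Rabs (x' - x) < d -> Rabs (y' - y) < d ->
    Cmod (P x' y' - P x y)%C < e.
Proof.
  intros H e He. destruct (H 1 Rlt_0_1) as [d [Hd H']].
  pose proof (Cmod_ge_0 p). pose proof (Cmod_ge_0 q).
  set (K := 2 + Cmod p + Cmod q). assert (HK : 0 < K) by (unfold K; lra).
  exists (Rmin d (e / K)). split.
  - apply Rmin_pos; auto. apply Rdiv_lt_0_compat; auto.
  - intros x' y' Hx Hy.
    pose proof (Rmin_l d (e/K)). pose proof (Rmin_r d (e/K)).
    specialize (H' x' y' ltac:(lra) ltac:(lra)).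
    replace (P x' y' - P x y)%C with ((P x' y' - P x y - p * RtoC (x' - x)%R - q * RtoC (y' - y)%R) + (p * RtoC (x' - x)%R + q * RtoC (y' - y)%R))%C by ring.
    eapply Rle_lt_trans; [apply Cmod_triangle|].
    assert (Cmod (p * RtoC (x' - x)%R + q * RtoC (y' - y)%R)%C <= Cmod p * Rabs (x'-x) + Cmod q * Rabs (y'-y)).
    { eapply Rle_trans; [apply Cmod_triangle|]. rewrite !Cmod_mult, !Cmod_R. lra. }
    pose proof (Rabs_pos (x'-x)). pose proof (Rabs_pos (y'-y)).
    set (m := e/K) in *. assert (Hm : m * K = e) by (unfold m; field; lra).
    assert (Cmod p * Rabs (x' - x) <= Cmod p * m) by (apply Rmult_le_compat_l; lra).
    assert (Cmod q * Rabs (y' - y) <= Cmod q * m) by (apply Rmult_le_compat_l; lra).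
    unfold K in Hm. nra.
Qed.

Lemma Rabs_self x : Rabs (x - x) = 0.
Proof. replace (x - x) with 0 by ring. apply Rabs_R0. Qed.

Lemma cdiff_ccont_l P : (forall x y, exists p q, cdiff P x y p q) -> forall y, ccont (fun x => P x y).
Proof.
  intros H y. apply ccont_eps. intros x e He. destruct (H x y) as [p [q Hd]].
  destruct (cdiff_cont _ _ _ _ _ Hd e He) as [d [Hp H']]. exists d; split; auto.
  intros x' Hx. apply H'; auto. rewrite Rabs_self; auto.
Qed.

Lemma cdiff_ccont_r P : (forall x y, exists p q, cdiff P x y p q) -> forall x, ccont (P x).
Proof.
  intros H x. apply ccont_eps. intros y e He. destruct (H x y) as [p [q Hd]].
  destruct (cdiff_cont _ _ _ _ _ Hd e He) as [d [Hp H']]. exists d; split; auto.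
  intros x' Hx. apply H'; auto. rewrite Rabs_self; auto.
Qed.

(* The integral of [P dx + Q dy] along the positively oriented boundary of [[a, a+w] x [c, c+h]]. *)
Definition boundary_int (P Q : R -> R -> C) a c w h : C :=
  (CInt (fun x => P x c) a (a+w)%R + CInt (Q (a+w)%R) c (c+h)%R
   - CInt (fun x => P x (c+h)%R) a (a+w)%R - CInt (Q a) c (c+h)%R)%C.

Lemma ccont_plus f g : ccont f -> ccont g -> ccont (fun t => f t + g t)%C.
Proof.
  intros Hf Hg t. destruct (Hf t), (Hg t). split; simpl; apply (continuous_plus (V := R_NormedModule)); auto.
Qed.

Lemma ccont_const c : ccont (fun _ => c).
Proof. intros t. split; apply continuous_const. Qed.

Lemma CInt_const c a b : CInt (fun _ => c) a b = (c * RtoC (b - a))%C.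
Proof.
  destruct c as [c1 c2]. unfold CInt. simpl. rewrite !RInt_const. apply C_eq; simpl; unfold scal; simpl; unfold mult; simpl; ring.
Qed.

Lemma boundary_int_quarter P Q : (forall y, ccont (fun x => P x y)) -> (forall x, ccont (Q x)) ->
  forall a c w h,
  boundary_int P Q a c w h = (boundary_int P Q a c (w/2)%R (h/2)%R + boundary_int P Q (a+w/2)%R c (w/2)%R (h/2)%R
     + boundary_int P Q a (c+h/2)%R (w/2)%R (h/2)%R + boundary_int P Q (a+w/2)%R (c+h/2)%R (w/2)%R (h/2)%R)%C.
Proof.
  intros HP HQ a c w h. unfold boundary_int.
  replace (a + w/2 + w/2) with (a+w)%R by field. replace (c + h/2+h/2) with (c+h)%R by field.
  rewrite <- (CInt_Chasles (fun x => P x c) a (a+w/2)%R (a+w)%R) by auto.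
  rewrite <- (CInt_Chasles (fun x => P x (c+h)%R) a (a+w/2)%R (a+w)%R) by auto.
  rewrite <- (CInt_Chasles (Q (a+w)%R) c (c+h/2)%R (c+h)%R) by auto.
  rewrite <- (CInt_Chasles (Q a) c (c+h/2)%R (c+h)%R) by auto.
  ring.
Qed.

(** Opposite sides are paired: bottom minus top for [P] is [- q h] and right minus left for [Q] is
    [q w], up to errors [e (w + h)], two sides contributing [e/2] each. The main terms integrate to
    [- q h w] and [q w h] and cancel. *)
Lemma boundary_int_local P Q x y p q r e : (forall y, ccont (fun x => P x y)) -> (forall x, ccont (Q x)) ->
  0 < e -> cdiff P x y p q -> cdiff Q x y q r ->
  exists d, 0 < d /\ forall a c w h, 0 <= w < d -> 0 <= h < d -> a <= x <= a + w -> c <= y <= c + h ->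
   Cmod (boundary_int P Q a c w h) <= e * (w + h)^2.
Proof.
  intros CP CQ He HP HQ.
  destruct (HP (e/2) ltac:(lra)) as [d1 [Hd1 H1]].
  destruct (HQ (e/2) ltac:(lra)) as [d2 [Hd2 H2]].
  exists (Rmin d1 d2). split; [apply Rmin_pos; auto|].
  intros a c w h Hw Hh Hx Hy. pose proof (Rmin_l d1 d2). pose proof (Rmin_r d1 d2).
  replace (boundary_int P Q a c w h) with
   (CInt (fun t => (P t c + (-(1)) * P t (c+h)%R) + q * RtoC h)%C a (a+w)%R +
    CInt (fun t => (Q (a+w)%R t + (-(1)) * Q a t) + (- q * RtoC w))%C c (c+h)%R)%C.
  2:{ rewrite !CInt_plus; auto using ccont_plus, ccont_scal, ccont_const.
      rewrite (CInt_scal _ (fun t => P t (c+h)%R)), (CInt_scal _ (Q a)) by (auto; apply CQ). rewrite !CInt_const. unfold boundary_int.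
      replace (a + w - a) with w by ring. replace (c + h - c) with h by ring. ring. }
  eapply Rle_trans; [apply Cmod_triangle|].
  replace (e * (w+h)^2) with (e * (w + h) * (a + w - a) + e * (w+h) * (c + h - c)) by ring.
  apply Rplus_le_compat.
  - apply CInt_le; [lra| |].
    { apply (ccont_plus (fun t => P t c + -(1) * P t (c+h)%R)%C); [|apply ccont_const].
      apply ccont_plus; auto. apply ccont_scal; auto. }
    intros t Ht.
    assert (B1 : Rabs (t - x) <= w) by (apply Rabs_le; lra).
    assert (B2 : Rabs (c - y) <= h) by (apply Rabs_le; lra).
    assert (B3 : Rabs (c + h - y) <= h) by (apply Rabs_le; lra).
    pose proof (H1 t c ltac:(lra) ltac:(lra)) as E1.
    pose proof (H1 t (c+h)%R ltac:(lra) ltac:(lra)) as E2.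
    replace (P t c + - (1) * P t (c + h)%R + q * RtoC h)%C with
     ((P t c - P x y - p * RtoC (t - x)%R - q * RtoC (c - y)%R) + - (P t (c+h)%R - P x y - p * RtoC (t - x)%R - q * RtoC (c+h - y)%R))%C.
    2:{ replace (c + h - y) with ((c - y) + h) by ring. rewrite (RtoC_plus (c-y)). ring. }
    eapply Rle_trans; [apply Cmod_triangle|]. rewrite Cmod_opp. nra.
  - apply CInt_le; [lra| |].
    { apply (ccont_plus (fun t => Q (a+w)%R t + -(1) * Q a t)%C); [|apply ccont_const].
      apply ccont_plus; auto. apply ccont_scal; auto. }
    intros t Ht.
    assert (B1 : Rabs (t - y) <= h) by (apply Rabs_le; lra).
    assert (B2 : Rabs (a - x) <= w) by (apply Rabs_le; lra).
    assert (B3 : Rabs (a + w - x) <= w) by (apply Rabs_le; lra).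
    pose proof (H2 a t ltac:(lra) ltac:(lra)) as E1.
    pose proof (H2 (a+w)%R t ltac:(lra) ltac:(lra)) as E2.
    replace (Q (a+w)%R t + - (1) * Q a t + - q * RtoC w)%C with
     ((Q (a+w)%R t - Q x y - q * RtoC (a+w - x)%R - r * RtoC (t - y)%R) + - (Q a t - Q x y - q * RtoC (a - x)%R - r * RtoC (t - y)%R))%C.
    2:{ replace (a + w - x) with ((a - x) + w) by ring. rewrite (RtoC_plus (a-x)). ring. }
    eapply Rle_trans; [apply Cmod_triangle|]. rewrite Cmod_opp. nra.
Qed.

Lemma pow2_small v d : 0 < d -> exists n, v / 2^n < d.
Proof.
  intros Hd. destruct (Rle_lt_dec v 0).
  - exists 0%nat. simpl. lra.
  - destruct (pow_lt_1_zero (1/2) ltac:(rewrite Rabs_right; lra) (d/v) ltac:(apply Rdiv_lt_0_compat; auto)) as [n Hn].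
    exists n. specialize (Hn n (Nat.le_refl n)).
    assert (0 < (1/2)^n) by (apply pow_lt; lra). rewrite Rabs_right in Hn by lra.
    replace (v/2^n) with (v * (1/2)^n).
    + apply Rmult_lt_compat_l with (r := v) in Hn; auto. replace (v * (d/v)) with d in Hn by (field; lra). auto.
    + unfold Rdiv at 1. rewrite Rmult_1_l, pow_inv. reflexivity.
Qed.

(* Halving the rectangle [n] times costs [4^n], which the second order error of the linearisation
   compensates; no continuity of the partial derivatives is needed. *)
Lemma goursat (P Q : R -> R -> C) a c w h : 0 <= w -> 0 <= h ->
  (forall x y, exists p q r, cdiff P x y p q /\ cdiff Q x y q r) ->
  boundary_int P Q a c w h = RtoC 0.
Proof.
  intros Hw Hh H.
  assert (CP : forall y, ccont (fun x => P x y)).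
  { apply cdiff_ccont_l. intros x y. destruct (H x y) as (p & q & r & H1 & H2). eauto. }
  assert (CQ : forall x, ccont (Q x)).
  { apply cdiff_ccont_r. intros x y. destruct (H x y) as (p & q & r & H1 & H2). eauto. }
  assert (Hall : forall e, 0 < e -> Cmod (boundary_int P Q a c w h) <= e * (w+h)^2).
  { intros e He. apply Rnot_lt_le. intros Hbad.
    destruct (bisect2 (fun a c w h => e * (w+h)^2 < Cmod (boundary_int P Q a c w h))) with (a0 := a) (c0 := c) (w := w) (h := h)
      as (x & y & _ & _ & Hn); auto.
    { clear -CP CQ He. intros a c w h _ _ Hb. rewrite (boundary_int_quarter P Q) in Hb by auto.
      destruct (Rlt_dec (e * (w/2+h/2)^2) (Cmod (boundary_int P Q a c (w / 2) (h / 2)))) as [|N1]; auto.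
      destruct (Rlt_dec (e * (w/2+h/2)^2) (Cmod (boundary_int P Q (a+w/2)%R c (w / 2) (h / 2)))) as [|N2]; auto.
      destruct (Rlt_dec (e * (w/2+h/2)^2) (Cmod (boundary_int P Q a (c+h/2)%R (w / 2) (h / 2)))) as [|N3]; auto.
      destruct (Rlt_dec (e * (w/2+h/2)^2) (Cmod (boundary_int P Q (a+w/2)%R (c+h/2)%R (w / 2) (h / 2)))) as [|N4]; auto.
      exfalso. apply Rnot_lt_le in N1, N2, N3, N4.
      pose proof (Cmod_triangle (boundary_int P Q a c (w/2)%R (h/2)%R + boundary_int P Q (a+w/2)%R c (w/2)%R (h/2)%R
        + boundary_int P Q a (c+h/2)%R (w/2)%R (h/2)%R) (boundary_int P Q (a+w/2)%R (c+h/2)%R (w/2)%R (h/2)%R)) as T1.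
      pose proof (Cmod_triangle (boundary_int P Q a c (w/2)%R (h/2)%R + boundary_int P Q (a+w/2)%R c (w/2)%R (h/2)%R)
        (boundary_int P Q a (c+h/2)%R (w/2)%R (h/2)%R)) as T2.
      pose proof (Cmod_triangle (boundary_int P Q a c (w/2)%R (h/2)%R) (boundary_int P Q (a+w/2)%R c (w/2)%R (h/2)%R)) as T3.
      replace (e * (w+h)^2) with (4 * (e * (w/2+h/2)^2)) in Hb by field. lra. }
    destruct (H x y) as (p & q & r & H1 & H2).
    destruct (boundary_int_local P Q x y p q r e CP CQ He H1 H2) as [d [Hd HL]].
    destruct (pow2_small (w+h) d Hd) as [n Hsm].
    destruct (Hn n) as (a' & c' & Hb & Hx & Hy).
    assert (0 < 2^n) by (apply pow_lt; lra).
    assert (0 <= w/2^n) by (apply Rdiv_le_0_compat; auto).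
    assert (0 <= h/2^n) by (apply Rdiv_le_0_compat; auto).
    assert ((w+h)/2^n = w/2^n+h/2^n) by (field; lra).
    specialize (HL a' c' (w/2^n) (h/2^n) ltac:(lra) ltac:(lra) ltac:(lra) ltac:(lra)). lra. }
  apply Cmod_eq_0. pose proof (Cmod_ge_0 (boundary_int P Q a c w h)). apply Rle_antisym; auto.
  apply Rnot_lt_le. intros Hp.
  set (M := Cmod (boundary_int P Q a c w h)) in *.
  assert (0 <= (w+h)^2) by (apply pow2_ge_0).
  specialize (Hall (M / (2 * ((w+h)^2 + 1))) ltac:(apply Rdiv_lt_0_compat; lra)).
  assert (M / (2 * ((w+h)^2 + 1)) * (w+h)^2 < M); [|lra].
  apply Rmult_lt_reg_r with (2 * ((w+h)^2+1)); [lra|].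
  replace (M / (2 * ((w + h) ^ 2 + 1)) * (w + h) ^ 2 * (2 * ((w + h) ^ 2 + 1))) with (M * (w+h)^2) by (field; lra).
  nra.
Qed.

(** * Complex differentiability *)

Definition cder (F : C -> C) (z l : C) :=
  forall e, 0 < e -> exists d, 0 < d /\ forall w, Cmod (w - z)%C < d ->
    Cmod (F w - F z - l * (w - z))%C <= e * Cmod (w - z)%C.

Lemma is_derive_cder F z l : is_derive (K := C_AbsRing) (V := C_NormedModule) F z l <-> cder F z l.
Proof.
  split.
  - intros [_ H] e He. specialize (H z (fun P h => h) (mkposreal e He)).
    destruct H as [d Hd].
    exists d. split; [apply cond_pos|]. intros w Hw.
    assert (Hb : ball (M := AbsRing_UniformSpace C_AbsRing) z d w) by exact Hw.
    specialize (Hd w Hb). simpl in Hd.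
    unfold minus, plus, opp, scal, norm in Hd. simpl in Hd. unfold mult in Hd; simpl in Hd.
    replace (F w - F z - l * (w - z))%C with (F w + - F z + - ((w + - z) * l))%C by ring.
    exact Hd.
  - intros H. split; [apply is_linear_scal_l|].
    intros y Hy. apply (is_filter_lim_locally_unique (V := AbsRing_NormedModule C_AbsRing)) in Hy. rewrite <- Hy. clear y Hy.
    intros e. destruct (H e (cond_pos e)) as [d [Hd H']].
    exists (mkposreal d Hd). intros w Hw.
    specialize (H' w Hw). 
    unfold minus, plus, opp, scal, norm; simpl. unfold mult; simpl.
    replace (F w + - F z + - ((w + - z) * l))%C with (F w - F z - l * (w - z))%C by ring.
    exact H'.
Qed.

Lemma entire_cder F : entire F <-> forall z, exists l, cder F z l.
Proof.
  split; intros H z; destruct (H z) as [l Hl]; exists l; apply is_derive_cder; auto.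
Qed.

Lemma cder_cont F z l : cder F z l -> forall e, 0 < e -> exists d, 0 < d /\ forall w, Cmod (w - z)%C < d -> Cmod (F w - F z)%C < e.
Proof.
  intros H e He. destruct (H 1 Rlt_0_1) as [d [Hd H']].
  pose proof (Cmod_ge_0 l). set (m := e / (2 + Cmod l)). assert (Hm : m * (2 + Cmod l) = e) by (unfold m; field; lra).
  assert (0 < m) by (apply Rdiv_lt_0_compat; lra).
  exists (Rmin d m). split; [apply Rmin_pos; auto|]. intros w Hw.
  pose proof (Rmin_l d m). pose proof (Rmin_r d m). specialize (H' w ltac:(lra)).
  replace (F w - F z)%C with ((F w - F z - l * (w - z)) + l * (w - z))%C by ring.
  eapply Rle_lt_trans; [apply Cmod_triangle|]. rewrite Cmod_mult.
  pose proof (Cmod_ge_0 (w - z)%C). nra.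
Qed.

Lemma cdiff_comp F G x y l p q : cder F (G x y) l -> cdiff G x y p q ->
  cdiff (fun x y => F (G x y)) x y (l * p)%C (l * q)%C.
Proof.
  intros HF HG e He.
  pose proof (Cmod_ge_0 l). pose proof (Cmod_ge_0 p). pose proof (Cmod_ge_0 q).
  set (Kp := 1 + Cmod p + Cmod q).
  set (e1 := e / (2 * Kp)). assert (He1 : 0 < e1) by (apply Rdiv_lt_0_compat; unfold Kp; lra).
  set (e2 := Rmin 1 (e / (2 * (1 + Cmod l)))).
  assert (He2 : 0 < e2) by (apply Rmin_pos; [lra|apply Rdiv_lt_0_compat; lra]).
  assert (E1 : e1 * Kp = e / 2) by (unfold e1; field; unfold Kp; lra).
  assert (E2 : e2 * (1 + Cmod l) <= e / 2).
  { apply Rle_trans with (e / (2 * (1 + Cmod l)) * (1 + Cmod l)).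
    - apply Rmult_le_compat_r; [lra|apply Rmin_r].
    - right. field. lra. }
  pose proof (Rmin_l 1 (e / (2 * (1 + Cmod l)))) as E3. fold e2 in E3.
  destruct (HF e1 He1) as [d1 [Hd1 H1']].
  destruct (HG e2 He2) as [d2 [Hd2 H2]].
  destruct (cdiff_cont _ _ _ _ _ HG d1 Hd1) as [d3 [Hd3 H3]].
  exists (Rmin d2 d3). split; [apply Rmin_pos; auto|]. intros x' y' Hx Hy.
  pose proof (Rmin_l d2 d3). pose proof (Rmin_r d2 d3).
  specialize (H2 x' y' ltac:(lra) ltac:(lra)). specialize (H1' _ (H3 x' y' ltac:(lra) ltac:(lra))).
  replace (F (G x' y') - F (G x y) - l * p * RtoC (x' - x)%R - l * q * RtoC (y' - y)%R)%C with
    ((F (G x' y') - F (G x y) - l * (G x' y' - G x y)) + l * (G x' y' - G x y - p * RtoC (x' - x)%R - q * RtoC (y' - y)%R))%C by ring.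
  eapply Rle_trans; [apply Cmod_triangle|]. rewrite Cmod_mult.
  set (S := Rabs (x' - x) + Rabs (y' - y)) in *.
  pose proof (Rabs_pos (x' - x)). pose proof (Rabs_pos (y' - y)). assert (HS : 0 <= S) by (unfold S; lra).
  assert (H8 : Cmod (G x' y' - G x y)%C <= Kp * S).
  { replace (G x' y' - G x y)%C with ((G x' y' - G x y - p * RtoC (x' - x)%R - q * RtoC (y' - y)%R) + (p * RtoC (x' - x)%R + q * RtoC (y' - y)%R))%C by ring.
    eapply Rle_trans; [apply Cmod_triangle|]. eapply Rle_trans; [apply Rplus_le_compat_l, Cmod_triangle|].
    rewrite !Cmod_mult, !Cmod_R. unfold Kp.
    assert (Cmod p * Rabs (x' - x) <= Cmod p * S) by (apply Rmult_le_compat_l; unfold S; lra).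
    assert (Cmod q * Rabs (y' - y) <= Cmod q * S) by (apply Rmult_le_compat_l; unfold S; lra). nra. }
  assert (e1 * Cmod (G x' y' - G x y)%C <= e / 2 * S).
  { rewrite <- E1, Rmult_assoc. apply Rmult_le_compat_l; lra. }
  assert (Cmod l * Cmod (G x' y' - G x y - p * RtoC (x' - x)%R - q * RtoC (y' - y)%R)%C <= Cmod l * (e2 * S)) by (apply Rmult_le_compat_l; lra).
  nra.
Qed.

Lemma cdiff_mult F G x y p q r s : cdiff F x y p q -> cdiff G x y r s ->
  cdiff (fun x y => F x y * G x y)%C x y (p * G x y + F x y * r)%C (q * G x y + F x y * s)%C.
Proof.
  intros HF HG e He.
  pose proof (Cmod_ge_0 p). pose proof (Cmod_ge_0 q). pose proof (Cmod_ge_0 (F x y)). pose proof (Cmod_ge_0 (G x y)).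
  set (K1 := 1 + Cmod p + Cmod q). set (K2 := 1 + Cmod (F x y)). set (K3 := 1 + Cmod (G x y)).
  destruct (HF (e / (3 * K3)) ltac:(apply Rdiv_lt_0_compat; unfold K3; lra)) as [d1 [Hd1 H1']].
  destruct (HF 1 Rlt_0_1) as [d2 [Hd2 H2']].
  destruct (HG (e / (3 * K2)) ltac:(apply Rdiv_lt_0_compat; unfold K2; lra)) as [d3 [Hd3 H3]].
  destruct (cdiff_cont _ _ _ _ _ HG (e / (3 * K1)) ltac:(apply Rdiv_lt_0_compat; unfold K1; lra)) as [d4 [Hd4 H4]].
  exists (Rmin (Rmin d1 d2) (Rmin d3 d4)). split; [repeat apply Rmin_pos; auto|]. intros x' y' Hx Hy.
  pose proof (Rmin_l (Rmin d1 d2) (Rmin d3 d4)). pose proof (Rmin_r (Rmin d1 d2) (Rmin d3 d4)).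
  pose proof (Rmin_l d1 d2). pose proof (Rmin_r d1 d2). pose proof (Rmin_l d3 d4). pose proof (Rmin_r d3 d4).
  specialize (H1' x' y' ltac:(lra) ltac:(lra)). specialize (H2' x' y' ltac:(lra) ltac:(lra)).
  specialize (H3 x' y' ltac:(lra) ltac:(lra)). specialize (H4 x' y' ltac:(lra) ltac:(lra)).
  set (S := Rabs (x' - x) + Rabs (y' - y)) in *.
  pose proof (Rabs_pos (x' - x)). pose proof (Rabs_pos (y' - y)). assert (HS : 0 <= S) by (unfold S; lra).
  replace (F x' y' * G x' y' - F x y * G x y - (p * G x y + F x y * r) * RtoC (x' - x)%R - (q * G x y + F x y * s) * RtoC (y' - y)%R)%C with
   ((F x' y' - F x y - p * RtoC (x' - x)%R - q * RtoC (y' - y)%R) * G x y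
    + F x y * (G x' y' - G x y - r * RtoC (x' - x)%R - s * RtoC (y' - y)%R)
    + (F x' y' - F x y) * (G x' y' - G x y))%C by ring.
  assert (HF8 : Cmod (F x' y' - F x y)%C <= K1 * S).
  { replace (F x' y' - F x y)%C with ((F x' y' - F x y - p * RtoC (x' - x)%R - q * RtoC (y' - y)%R) + (p * RtoC (x' - x)%R + q * RtoC (y' - y)%R))%C by ring.
    eapply Rle_trans; [apply Cmod_triangle|]. eapply Rle_trans; [apply Rplus_le_compat_l, Cmod_triangle|].
    rewrite !Cmod_mult, !Cmod_R. unfold K1.
    assert (Cmod p * Rabs (x' - x) <= Cmod p * S) by (apply Rmult_le_compat_l; unfold S; lra).
    assert (Cmod q * Rabs (y' - y) <= Cmod q * S) by (apply Rmult_le_compat_l; unfold S; lra). nra. }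
  eapply Rle_trans; [apply Cmod_triangle|]. eapply Rle_trans; [apply Rplus_le_compat_r, Cmod_triangle|].
  rewrite !Cmod_mult.
  replace (e * S) with (e / (3 * K3) * S * K3 + K2 * (e / (3 * K2) * S) + (K1 * S) * (e / (3 * K1))) by (field; unfold K1, K2, K3; repeat split; lra).
  apply Rplus_le_compat; [apply Rplus_le_compat|]; apply Rmult_le_compat; try apply Cmod_ge_0; auto; try (unfold K2, K3; lra).
Qed.

(** The Cauchy-Riemann equations: the partials of a complex differentiable function are [l] and
    [i l]. The chain and product rules are thus proved once, in two real variables. *)
Lemma cder_iff_cdiff F z l : cder F z l <-> cdiff (fun x y => F (x, y)) (Re z) (Im z) l (Ci * l)%C.
Proof.
  destruct z as [p q]. simpl.
  assert (E : forall x y, (F (x, y) - F (p, q) - l * RtoC (x - p)%R - Ci * l * RtoC (y - q)%R)%C =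
    (F (x, y) - F (p, q) - l * ((x, y) - (p, q)))%C).
  { intros x y. replace ((x, y) - (p, q))%C with (RtoC (x - p)%R + Ci * RtoC (y - q)%R)%C by (apply C_eq; simpl; ring). ring. }
  split; intros H e He.
  - destruct (H e He) as [d [Hd H']]. exists (d/2). split; [lra|]. intros x y Hx Hy. rewrite E.
    pose proof (Cmod_le_Re_Im ((x, y) - (p, q))%C) as B. simpl in B. unfold Rminus in *.
    eapply Rle_trans; [apply H'; lra|]. apply Rmult_le_compat_l; lra.
  - destruct (H (e/2) ltac:(lra)) as [d [Hd H']]. exists d. split; auto. intros [x y] Hw.
    pose proof (re_le_Cmod ((x, y) - (p, q))%C) as B1. pose proof (im_le_Cmod ((x, y) - (p, q))%C) as B2. simpl in B1, B2.
    rewrite <- E. unfold Rminus in *. eapply Rle_trans; [apply H'; lra|].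
    set (M := Cmod ((x, y) - (p, q))%C) in *. nra.
Qed.

Lemma cder_comp F G z l m : cder F (G z) l -> cder G z m -> cder (fun z => F (G z)) z (l * m)%C.
Proof.
  intros HF HG. apply cder_iff_cdiff in HG. apply cder_iff_cdiff.
  replace (Ci * (l * m))%C with (l * (Ci * m))%C by ring. destruct z as [p q].
  apply (cdiff_comp F (fun x y => G (x, y))); auto.
Qed.

Lemma cder_mult F G z l m : cder F z l -> cder G z m -> cder (fun z => F z * G z)%C z (l * G z + F z * m)%C.
Proof.
  intros HF HG. apply cder_iff_cdiff in HF, HG. apply cder_iff_cdiff. destruct z as [p q]. simpl in *.
  replace (Ci * (l * G (p, q) + F (p, q) * m))%C with (Ci * l * G (p, q) + F (p, q) * (Ci * m))%C by ring.
  exact (cdiff_mult _ _ _ _ _ _ _ _ HF HG).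
Qed.

Lemma cder_const c z : cder (fun _ => c) z (RtoC 0).
Proof.
  intros e He. exists 1. split; [lra|]. intros w _.
  replace (c - c - RtoC 0 * (w - z))%C with (RtoC 0) by ring. rewrite Cmod_0.
  pose proof (Cmod_ge_0 (w - z)%C). nra.
Qed.

Lemma cder_id z : cder (fun z => z) z (RtoC 1).
Proof.
  intros e He. exists 1. split; [lra|]. intros w _.
  replace (w - z - RtoC 1 * (w - z))%C with (RtoC 0) by ring. rewrite Cmod_0.
  pose proof (Cmod_ge_0 (w - z)%C). nra.
Qed.

Lemma cder_plus F G z l m : cder F z l -> cder G z m -> cder (fun z => F z + G z)%C z (l + m)%C.
Proof.
  intros HF HG e He. destruct (HF (e/2) ltac:(lra)) as [d1 [Hd1 H1]].
  destruct (HG (e/2) ltac:(lra)) as [d2 [Hd2 H2]].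
  exists (Rmin d1 d2). split; [apply Rmin_pos; auto|]. intros w Hw.
  pose proof (Rmin_l d1 d2). pose proof (Rmin_r d1 d2).
  specialize (H1 w ltac:(lra)). specialize (H2 w ltac:(lra)).
  replace (F w + G w - (F z + G z) - (l + m) * (w - z))%C with
   ((F w - F z - l * (w - z)) + (G w - G z - m * (w - z)))%C by ring.
  eapply Rle_trans; [apply Cmod_triangle|]. lra.
Qed.

Lemma cder_inv z : z <> RtoC 0 -> cder Cinv z (- / (z * z))%C.
Proof.
  intros Hz e He. pose proof (Cmod_gt_0 z) as [Hp _]. specialize (Hp Hz). set (r := Cmod z) in *.
  set (d := Rmin (r/2) (e * (r*r*r) / 2)).
  assert (0 < r*r*r) by (repeat apply Rmult_lt_0_compat; auto).
  assert (0 < d) by (apply Rmin_pos; [lra|]; apply Rdiv_lt_0_compat; [|lra]; apply Rmult_lt_0_compat; auto).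
  exists d. split; auto. intros w Hw.
  pose proof (Rmin_l (r/2) (e * (r*r*r) / 2)). pose proof (Rmin_r (r/2) (e * (r*r*r) / 2)). fold d in H1, H2.
  assert (Hw2 : r / 2 <= Cmod w).
  { pose proof (Cmod_triangle w (z - w)%C) as T. replace (w + (z - w))%C with z in T by ring.
    replace (z - w)%C with (- (w - z))%C in T by ring. rewrite Cmod_opp in T. fold r in T. lra. }
  assert (Hw0 : w <> RtoC 0). { intros E. rewrite E, Cmod_0 in Hw2. lra. }
  replace (/ w - / z - - / (z * z) * (w - z))%C with ((w - z) * ((w - z) * / (z * z * w)))%C by (field; auto).
  rewrite !Cmod_mult, Cmod_inv by (repeat apply Cmult_neq_0; auto). rewrite !Cmod_mult. fold r.
  set (D := Cmod (w - z)%C) in *. assert (0 <= D) by apply Cmod_ge_0.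
  rewrite Rmult_comm. apply Rmult_le_compat_r; auto.
  assert (r*r*r/2 <= r*r*Cmod w) by nra.
  apply Rmult_le_reg_r with (r*r*Cmod w); [lra|].
  replace (D * / (r * r * Cmod w) * (r * r * Cmod w)) with D by (field; split; lra).
  assert (e * (r*r*r/2) <= e * (r*r*Cmod w)) by (apply Rmult_le_compat_l; lra). lra.
Qed.

(** * Entire functions and the complex exponential *)

Lemma entire_plus F G : entire F -> entire G -> entire (fun z => F z + G z)%C.
Proof.
  rewrite !entire_cder. intros HF HG z. destruct (HF z), (HG z). eexists. apply cder_plus; eauto.
Qed.
Lemma entire_mult F G : entire F -> entire G -> entire (fun z => F z * G z)%C.
Proof.
  rewrite !entire_cder. intros HF HG z. destruct (HF z), (HG z). eexists. apply cder_mult; eauto.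
Qed.
Lemma entire_comp F G : entire F -> entire G -> entire (fun z => F (G z))%C.
Proof.
  rewrite !entire_cder. intros HF HG z. destruct (HG z) as [m Hm], (HF (G z)) as [l Hl]. eexists. apply cder_comp; eauto.
Qed.
Lemma entire_const c : entire (fun _ => c).
Proof. apply entire_cder. intros z. eexists. apply cder_const. Qed.
Lemma entire_id : entire (fun z => z).
Proof. apply entire_cder. intros z. eexists. apply cder_id. Qed.

Lemma cexp_plus z w : cexp (z + w)%C = (cexp z * cexp w)%C.
Proof.
  destruct z as [a b], w as [c d]. unfold cexp. simpl. rewrite exp_plus, cos_plus, sin_plus.
  apply C_eq; simpl; ring.
Qed.

Lemma Cmod_cexp z : Cmod (cexp z) = exp (Re z).
Proof.
  destruct z as [a b]. unfold cexp, Cmod; simpl.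
  replace (exp a * cos b * (exp a * cos b * 1) + exp a * sin b * (exp a * sin b * 1)) with
    ((exp a)² * ((sin b)² + (cos b)²)) by (unfold Rsqr; ring).
  rewrite sin2_cos2, Rmult_1_r. apply sqrt_Rsqr. left; apply exp_pos.
Qed.

Lemma cexp_0 : cexp (RtoC 0) = RtoC 1.
Proof. unfold cexp; simpl. rewrite exp_0, cos_0, sin_0. apply C_eq; simpl; ring. Qed.

Lemma deriv_eps f x l : derivable_pt_lim f x l -> forall e, 0 < e ->
  exists d, 0 < d /\ forall h, Rabs h < d -> Rabs (f (x + h) - f x - l * h) <= e * Rabs h.
Proof.
  intros H e He. destruct (H e He) as [d Hd]. exists d. split; [apply cond_pos|].
  intros h Hh. destruct (Req_dec h 0) as [->|Hn].
  - rewrite Rplus_0_r, Rminus_diag, Rmult_0_r, Rminus_0_r, Rabs_R0. lra.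
  - specialize (Hd h Hn Hh).
    replace (f (x+h) - f x - l * h) with (((f (x + h) - f x) / h - l) * h) by (field; auto).
    rewrite Rabs_mult. apply Rmult_le_compat_r; [apply Rabs_pos|lra].
Qed.

Lemma cder_cexp z : cder cexp z (cexp z).
Proof.
  intros e He.
  (* The error is [4 k D] in the real and [5 k D] in the imaginary part; the second order products
     are absorbed because [d <= 1] and [d <= k]. *)
  set (k := e / (9 * exp (Re z))). assert (Hex := exp_pos (Re z)).
  assert (Hk : 0 < k) by (apply Rdiv_lt_0_compat; lra).
  assert (Ek : k * (9 * exp (Re z)) = e) by (unfold k; field; lra).
  destruct (deriv_eps exp 0 1 derivable_pt_lim_exp_0 k Hk) as [d1 [Hd1 H1]].
  destruct (deriv_eps cos 0 0 ltac:(generalize (derivable_pt_lim_cos 0); rewrite sin_0, Ropp_0; auto) k Hk) as [d2 [Hd2 H2]].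
  destruct (deriv_eps sin 0 1 ltac:(generalize (derivable_pt_lim_sin 0); rewrite cos_0; auto) k Hk) as [d3 [Hd3 H3]].
  set (d := Rmin (Rmin d1 d2) (Rmin d3 (Rmin 1 k))).
  assert (Hd : 0 < d) by (repeat apply Rmin_pos; auto; lra).
  assert (Hdl : d <= d1 /\ d <= d2 /\ d <= d3 /\ d <= 1 /\ d <= k).
  { unfold d. pose proof (Rmin_l (Rmin d1 d2) (Rmin d3 (Rmin 1 k))). pose proof (Rmin_r (Rmin d1 d2) (Rmin d3 (Rmin 1 k))).
    pose proof (Rmin_l d1 d2). pose proof (Rmin_r d1 d2). pose proof (Rmin_l d3 (Rmin 1 k)). pose proof (Rmin_r d3 (Rmin 1 k)).
    pose proof (Rmin_l 1 k). pose proof (Rmin_r 1 k). lra. }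
  clearbody d.
  exists d. split; auto. intros w Hw. set (h := (w - z)%C) in *.
  replace w with (z + h)%C by (unfold h; ring). rewrite cexp_plus.
  replace (cexp z * cexp h - cexp z - cexp z * h)%C with (cexp z * (cexp h - RtoC 1 - h))%C by ring.
  rewrite Cmod_mult, Cmod_cexp.
  pose proof (re_le_Cmod h). pose proof (im_le_Cmod h). pose proof (Cmod_le_Re_Im (cexp h - RtoC 1 - h)%C) as HB.
  destruct h as [x y]. simpl Re in *. simpl Im in *.
  set (D := Cmod (x, y)) in *.
  specialize (H1 x ltac:(lra)). specialize (H2 y ltac:(lra)). specialize (H3 y ltac:(lra)).
  rewrite Rplus_0_l in *. rewrite exp_0 in H1. rewrite cos_0 in H2. rewrite sin_0 in H3.
  assert (Bx : Rabs (exp x) <= 3).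
  { rewrite Rabs_right by (left; apply exp_pos). apply Rle_trans with (exp 1); [|apply exp_le_3].
    destruct (Rle_lt_dec 1 x) as [Hx|Hx]; [|left; apply exp_increasing; lra].
    apply Rabs_le_between in H. lra. }
  assert (K1 : k * Rabs x <= k * D) by (apply Rmult_le_compat_l; lra).
  assert (K2 : k * Rabs y <= k * D) by (apply Rmult_le_compat_l; lra).
  assert (HD : 0 <= D) by apply Cmod_ge_0.
  assert (HkD : 0 <= k * D) by nra.
  assert (R1 : Rabs (exp x * cos y + - (1) + - x) <= 4 * (k * D)).
  { replace (exp x * cos y + - (1) + - x) with ((exp x - 1 - 1 * x) + exp x * (cos y - 1 - 0 * y)) by ring.
    eapply Rle_trans; [apply Rabs_triang|]. rewrite Rabs_mult.
    assert (Rabs (exp x) * Rabs (cos y - 1 - 0 * y) <= 3 * (k * D)).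
    { apply Rmult_le_compat; try apply Rabs_pos; lra. } lra. }
  assert (R2 : Rabs (exp x * sin y + - 0 + - y) <= 5 * (k * D)).
  { replace (exp x * sin y + - 0 + - y) with (exp x * (sin y - 0 - 1 * y) + (exp x - 1 - 1 * x) * y + x * y) by ring.
    eapply Rle_trans; [apply Rabs_triang|]. eapply Rle_trans; [apply Rplus_le_compat_r, Rabs_triang|]. rewrite !Rabs_mult.
    assert (Rabs (exp x) * Rabs (sin y - 0 - 1 * y) <= 3 * (k * D)).
    { apply Rmult_le_compat; try apply Rabs_pos; lra. }
    assert (Rabs (exp x - 1 - 1*x) * Rabs y <= (k * D) * 1).
    { apply Rmult_le_compat; try apply Rabs_pos; lra. }
    assert (Rabs x * Rabs y <= k * D).
    { apply Rmult_le_compat; try apply Rabs_pos; lra. } lra. }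
  simpl in HB.
  apply Rle_trans with (exp (Re z) * (9 * (k * D))).
  - apply Rmult_le_compat_l; lra.
  - rewrite <- Ek. right; ring.
Qed.

Lemma entire_cexp : entire cexp.
Proof. apply entire_cder. intros z. eexists. apply cder_cexp. Qed.

Lemma cdiff_ext F G x y p q : (forall x y, F x y = G x y) -> cdiff F x y p q -> cdiff G x y p q.
Proof.
  intros H HF e He. destruct (HF e He) as [d [Hd H']]. exists d. split; auto. intros. rewrite <- !H. auto.
Qed.

Lemma cdiff_linear c a b x y : cdiff (fun u v => c + a * RtoC u + b * RtoC v)%C x y a b.
Proof.
  intros e He. exists 1. split; [lra|]. intros x' y' _ _.
  rewrite !RtoC_minus.
  replace (c + a * RtoC x' + b * RtoC y' - (c + a * RtoC x + b * RtoC y) - a * (RtoC x' - RtoC x) - b * (RtoC y' - RtoC y))%C with (RtoC 0) by ring.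
  rewrite Cmod_0. pose proof (Rabs_pos (x' - x)). pose proof (Rabs_pos (y' - y)). nra.
Qed.

(** * Cauchy's integral formula on circles *)

Lemma cdiff_eq F x y p q p' q' : cdiff F x y p q -> p = p' -> q = q' -> cdiff F x y p' q'.
Proof. intros; subst; auto. Qed.

Definition eit (t : R) : C := cexp (Ci * RtoC t)%C.

Lemma eit_eq t : eit t = (cos t, sin t).
Proof.
  unfold eit, cexp. replace (Re (Ci * RtoC t)%C) with 0 by (simpl; ring).
  replace (Im (Ci * RtoC t)%C) with t by (simpl; ring). rewrite exp_0, !Rmult_1_l. reflexivity.
Qed.
Lemma eit_2PI : eit (2 * PI) = RtoC 1.
Proof. rewrite eit_eq, cos_2PI, sin_2PI. reflexivity. Qed.
Lemma eit_0 : eit 0 = RtoC 1.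
Proof. rewrite eit_eq, cos_0, sin_0. reflexivity. Qed.
Lemma Cmod_eit t : Cmod (eit t) = 1.
Proof.
  unfold eit. rewrite Cmod_cexp. replace (Re (Ci * RtoC t)%C) with 0 by (simpl; ring). apply exp_0.
Qed.

Lemma Cneq_mod (w z0 : C) : Cmod z0 < Cmod w -> (w - z0)%C <> RtoC 0.
Proof. intros H E. assert (w = z0) by (rewrite <- (Cplus_0_l z0), <- E; ring). subst; lra. Qed.

Section Cauchy.
Variables (F : C -> C) (z0 : C) (r : R).
Hypothesis HF : entire F.
Hypothesis Hr : Cmod z0 < r.
Let rpos : 0 < r. Proof. pose proof (Cmod_ge_0 z0). lra. Qed.

Let pt (t : R) : C := (RtoC r * eit t)%C.
Let kf (w : C) : C := (Ci * w * / (w - z0))%C.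
(* [Gam] contracts the circle to [z0]; in the coordinates [(u, t)] the form [F(w) dw / (w - z0)]
   is [F(Gam) du + F(Gam) kf(pt t) dt]. *)
Let Gam (u t : R) : C := (z0 + cexp (RtoC u) * (pt t - z0))%C.

Lemma Cmod_pt t : Cmod (pt t) = r.
Proof. unfold pt. rewrite Cmod_mult, Cmod_R, Cmod_eit, Rabs_right; lra. Qed.

Lemma cdiff_pt x y : cdiff (fun _ v => pt v) x y (RtoC 0) (Ci * pt y)%C.
Proof.
  pose proof (cdiff_linear (RtoC 0) (RtoC 0) Ci x y) as HL.
  eapply cdiff_eq.
  - eapply (cdiff_ext (fun u v => (fun w => RtoC r * cexp w)%C (RtoC 0 + RtoC 0 * RtoC u + Ci * RtoC v)%C)).
    { intros u v. unfold pt, eit. simpl. f_equal. f_equal. ring. }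
    apply (cdiff_comp (fun w => RtoC r * cexp w)%C).
    + apply cder_mult; [apply cder_const|apply cder_cexp].
    + exact HL.
  - cbv beta; ring.
  - unfold pt, eit. simpl. replace (RtoC 0 + RtoC 0 * RtoC x + Ci * RtoC y)%C with (Ci * RtoC y)%C by ring. ring.
Qed.

Lemma cdiff_Gam x y : cdiff Gam x y (cexp (RtoC x) * (pt y - z0))%C (cexp (RtoC x) * (Ci * pt y))%C.
Proof.
  assert (H1 : cdiff (fun u _ => cexp (RtoC u)) x y (cexp (RtoC x)) (RtoC 0)).
  { eapply cdiff_eq.
    - eapply (cdiff_ext (fun u v => cexp (RtoC 0 + RtoC 1 * RtoC u + RtoC 0 * RtoC v)%C)).
      { intros u v. f_equal. ring. }
      apply (cdiff_comp cexp); [apply cder_cexp|apply cdiff_linear].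
    - replace (RtoC 0 + RtoC 1 * RtoC x + RtoC 0 * RtoC y)%C with (RtoC x) by ring. ring.
    - ring. }
  assert (H2 : cdiff (fun _ v => pt v - z0)%C x y (RtoC 0) (Ci * pt y)%C).
  { eapply cdiff_eq.
    - apply (cdiff_comp (fun w => w + - z0)%C (fun _ v => pt v)).
      + apply cder_plus; [apply cder_id|apply cder_const].
      + apply cdiff_pt.
    - cbv beta; ring.
    - ring. }
  pose proof (cdiff_mult _ _ _ _ _ _ _ _ H1 H2) as H3.
  eapply cdiff_eq.
  - eapply (cdiff_ext (fun u v => (fun w => w + z0)%C ((cexp (RtoC u) * (pt v - z0))%C))).
    { intros u v. unfold Gam. ring. }
    apply (cdiff_comp (fun w => w + z0)%C); [|exact H3].
    apply cder_plus; [apply cder_id|apply cder_const].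
  - cbv beta; ring.
  - cbv beta; ring.
Qed.

Lemma kf_cder w : Cmod z0 < Cmod w -> exists l, cder kf w l.
Proof.
  intros Hw. eexists. unfold kf. apply cder_mult.
  - apply cder_mult; [apply cder_const|apply cder_id].
  - apply (cder_comp Cinv (fun w => w - z0)%C).
    + apply cder_inv. apply Cneq_mod; auto.
    + apply (cder_plus (fun w => w) (fun _ => - z0)%C); [apply cder_id|apply cder_const].
Qed.

Lemma kernel_bound t : Cmod (kf (pt t)) <= r / (r - Cmod z0).
Proof.
  unfold kf. pose proof (Cneq_mod (pt t) z0) as Hn. rewrite Cmod_pt in Hn. specialize (Hn Hr).
  rewrite !Cmod_mult, Cmod_inv by auto. rewrite Cmod_Ci, Cmod_pt, Rmult_1_l.
  apply Rmult_le_compat_l; [lra|]. apply Rinv_le_contravar; [lra|].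
  pose proof (Cmod_triangle (pt t - z0)%C z0) as T. replace (pt t - z0 + z0)%C with (pt t) in T by ring.
  rewrite Cmod_pt in T. lra.
Qed.

(** Closedness of the pulled back form: the first partial of [Gam] is [e^u (pt - z0)], and
    multiplication by [kf] turns it into [e^u i pt], which is the second partial. *)
Lemma circle_form x y : exists p q s,
  cdiff (fun u v => F (Gam u v)) x y p q /\ cdiff (fun u v => F (Gam u v) * kf (pt v))%C x y q s.
Proof.
  destruct (proj1 (entire_cder F) HF (Gam x y)) as [l Hl].
  destruct (kf_cder (pt y)) as [m Hm]; [rewrite Cmod_pt; auto|].
  pose proof (cdiff_comp _ _ _ _ _ _ _ Hl (cdiff_Gam x y)) as H1.
  pose proof (cdiff_comp kf (fun _ v => pt v) x y _ _ _ Hm (cdiff_pt x y)) as H2.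
  pose proof (cdiff_mult _ _ _ _ _ _ _ _ H1 H2) as H3.
  eexists _, _, _. split; [exact H1|]. eapply cdiff_eq; [exact H3| |reflexivity].
  unfold kf. pose proof (Cneq_mod (pt y) z0) as Hn. rewrite Cmod_pt in Hn. field. auto.
Qed.

Lemma ccont_circle u : ccont (fun t => F (Gam u t) * kf (pt t))%C.
Proof.
  apply (cdiff_ccont_r (fun u v => F (Gam u v) * kf (pt v))%C).
  intros x y. destruct (circle_form x y) as (p & q & s & _ & H). eauto.
Qed.

Lemma ccont_kf : ccont (fun t => kf (pt t)).
Proof.
  apply (cdiff_ccont_r (fun _ v => kf (pt v)) ); [|exact 0].
  intros x y. destruct (kf_cder (pt y)) as [m Hm]; [rewrite Cmod_pt; auto|].
  eexists _, _. apply (cdiff_comp kf (fun _ v => pt v) x y _ _ _ Hm (cdiff_pt x y)).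
Qed.

(** By periodicity the sides [t = 0] and [t = 2 pi] of the parameter rectangle trace the same curve
    and cancel, so the circle and its contraction by [exp (-L)] give the same integral. *)
Lemma circle_shrink L : 0 <= L ->
  CInt (fun t => F (Gam (-L) t) * kf (pt t))%C 0 (2*PI) = CInt (fun t => F (pt t) * kf (pt t))%C 0 (2*PI).
Proof.
  intros HL. pose proof PI_RGT_0 as Hpi.
  pose proof (goursat (fun u v => F (Gam u v)) (fun u v => F (Gam u v) * kf (pt v))%C (-L) 0 L (2*PI) HL ltac:(lra) circle_form) as HG.
  unfold boundary_int in HG. replace (- L + L) with 0 in HG by ring. rewrite Rplus_0_l in HG.
  assert (Hp : pt (2*PI) = pt 0) by (unfold pt; rewrite eit_2PI, eit_0; auto).
  rewrite (CInt_ext (fun x => F (Gam x (2*PI))) (fun x => F (Gam x 0))) in HG by (intros t; unfold Gam; rewrite Hp; auto).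
  rewrite (CInt_ext (fun t => F (pt t) * kf (pt t))%C (fun t => F (Gam 0 t) * kf (pt t))%C).
  2:{ intros t. unfold Gam. rewrite cexp_0. replace (z0 + RtoC 1 * (pt t - z0))%C with (pt t) by ring. auto. }
  set (X := CInt (fun x => F (Gam x 0)) (-L) 0) in *.
  set (Y := CInt (fun v => F (Gam 0 v) * kf (pt v))%C 0 (2*PI)) in *.
  set (Z := CInt (fun v => F (Gam (-L) v) * kf (pt v))%C 0 (2*PI)) in *.
  replace Z with (Y - (X + Y - X - Z))%C by ring. rewrite HG. ring.
Qed.

(** Contracting the circle to [z0] replaces [F] by its value there. The integral of the kernel,
    which is [2 pi i], is left as it stands and evaluated in [taylor_circle]. *)
Lemma cauchy_kernel :
  CInt (fun t => F (pt t) * kf (pt t))%C 0 (2*PI) = (F z0 * CInt (fun t => kf (pt t)) 0 (2*PI))%C.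
Proof.
  pose proof PI_RGT_0 as Hpi. pose proof (Cmod_ge_0 z0) as Hz.
  rewrite <- CInt_scal by apply ccont_kf.
  set (I1 := CInt (fun t => F (pt t) * kf (pt t))%C 0 (2*PI)).
  set (I2 := CInt (fun t => F z0 * kf (pt t))%C 0 (2*PI)).
  assert (Hs : forall e, 0 < e -> Cmod (I1 - I2)%C <= e).
  { intros e He.
    set (Kb := r / (r - Cmod z0)). assert (HK : 0 < Kb) by (apply Rdiv_lt_0_compat; lra).
    set (e1 := e / (Kb * (2*PI))). assert (He1 : 0 < e1) by (apply Rdiv_lt_0_compat; auto; apply Rmult_lt_0_compat; lra).
    destruct (proj1 (entire_cder F) HF z0) as [l Hl].
    destruct (cder_cont _ _ _ Hl e1 He1) as [d [Hd H']].
    (* The contracted circle lies within [exp (-L) (2 r)] of [z0], which this choice makes smaller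
       than [d]; the absolute value keeps [L] nonnegative. *)
    set (L := Rabs (ln (d / (4 * r)))).
    assert (HL : exp (- L) * (2 * r) < d).
    { assert (0 < d / (4*r)) by (apply Rdiv_lt_0_compat; lra).
      assert (exp (-L) <= d / (4*r)).
      { rewrite <- (exp_ln (d/(4*r))) by auto. 
        assert (- L <= ln (d/(4*r))). { unfold L. pose proof (Rle_abs (- ln (d/(4*r)))). rewrite Rabs_Ropp in H0. lra. }
        destruct H0 as [H0| ->]; [left; apply exp_increasing; auto|lra]. }
      apply Rle_lt_trans with (d / (4*r) * (2*r)); [apply Rmult_le_compat_r; lra|].
      replace (d / (4*r) * (2*r)) with (d/2) by (field; lra). lra. }
    unfold I1. rewrite <- (circle_shrink L) by apply Rabs_pos.
    replace (CInt (fun t => F (Gam (-L) t) * kf (pt t))%C 0 (2*PI) - I2)%C with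
      (CInt (fun t => F (Gam (-L) t) * kf (pt t) + (-(1)) * (F z0 * kf (pt t)))%C 0 (2*PI)).
    2:{ rewrite CInt_plus, (CInt_scal (-(1))%C); [fold I2; ring|..].
        - apply ccont_scal, ccont_kf.
        - apply ccont_circle.
        - apply ccont_scal, ccont_scal, ccont_kf. }
    replace e with ((e1 * Kb) * (2 * PI - 0)) by (unfold e1; field; split; lra).
    apply CInt_le; [lra| |].
    { apply ccont_plus; [apply ccont_circle|apply ccont_scal, ccont_scal, ccont_kf]. }
    intros t _. replace (F (Gam (- L) t) * kf (pt t) + - (1) * (F z0 * kf (pt t)))%C with ((F (Gam (-L) t) - F z0) * kf (pt t))%C by ring.
    rewrite Cmod_mult. apply Rmult_le_compat; try apply Cmod_ge_0; [|apply kernel_bound].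
    left. apply H'. unfold Gam. replace (z0 + cexp (RtoC (-L)) * (pt t - z0) - z0)%C with (cexp (RtoC (-L)) * (pt t + - z0))%C by ring.
    rewrite Cmod_mult, Cmod_cexp. simpl Re. eapply Rle_lt_trans; [|apply HL].
    apply Rmult_le_compat_l; [left; apply exp_pos|]. eapply Rle_trans; [apply Cmod_triangle|]. rewrite Cmod_opp, Cmod_pt. lra. }
  assert (E : (I1 - I2)%C = RtoC 0).
  { apply Cmod_eq_0. apply Rle_antisym; [|apply Cmod_ge_0]. apply le_epsilon. intros e He. specialize (Hs e He). lra. }
  replace I1 with ((I1 - I2) + I2)%C by ring. rewrite E. ring.
Qed.

End Cauchy.

(** * Taylor coefficients as circle integrals *)

Fixpoint csum (f : nat -> C) (n : nat) : C :=
  match n with O => RtoC 0 | S m => (csum f m + f m)%C end.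

Lemma ccont_bounded f a b : a <= b -> ccont f -> exists M, 0 <= M /\ forall t, a <= t <= b -> Cmod (f t) <= M.
Proof.
  intros Hab Hf.
  destruct (continuity_ab_maj (fun t => Rabs (Re (f t)) + Rabs (Im (f t))) a b Hab) as [m [Hm _]].
  - intros c _. apply continuity_pt_plus; apply (continuity_pt_comp _ Rabs); try apply Rcontinuity_abs;
    apply continuity_pt_filterlim; apply (Hf c).
  - exists (Rabs (Re (f m)) + Rabs (Im (f m))). split.
    + pose proof (Rabs_pos (Re (f m))). pose proof (Rabs_pos (Im (f m))). lra.
    + intros t Ht. eapply Rle_trans; [apply Cmod_le_Re_Im|]. apply Hm; auto.
Qed.

Lemma ccont_mult f g : ccont f -> ccont g -> ccont (fun t => f t * g t)%C.
Proof.
  intros Hf Hg t. destruct (Hf t) as [F1 F2], (Hg t) as [G1 G2]. split; simpl.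
  - apply (continuous_minus (V := R_NormedModule)); apply (continuous_mult (K := R_AbsRing)); auto.
  - apply (continuous_plus (V := R_NormedModule)); apply (continuous_mult (K := R_AbsRing)); auto.
Qed.

Lemma ccont_pow f n : ccont f -> ccont (fun t => f t ^ n)%C.
Proof. intros Hf. induction n; simpl; [apply ccont_const|apply ccont_mult; auto]. Qed.

Lemma ccont_ext f g : (forall t, f t = g t) -> ccont f -> ccont g.
Proof.
  intros H Hf t. destruct (Hf t) as [H1 H2]. split.
  - apply (continuous_ext (fun t => Re (f t))); auto. intros; rewrite H; auto.
  - apply (continuous_ext (fun t => Im (f t))); auto. intros; rewrite H; auto.
Qed.

Lemma ccont_eit : ccont eit.
Proof.
  apply (ccont_ext (fun t => (cos t, sin t))). { intros; rewrite eit_eq; auto. }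
  intros t. split; simpl; apply continuity_pt_filterlim; [apply continuity_cos|apply continuity_sin].
Qed.

Lemma entire_ccont F f : entire F -> ccont f -> ccont (fun t => F (f t)).
Proof.
  intros HF Hf. apply ccont_eps. intros x e He.
  destruct (proj1 (entire_cder F) HF (f x)) as [l Hl]. destruct (cder_cont _ _ _ Hl e He) as [d [Hd H]].
  destruct (Hf x) as [H1 H2].
  destruct (continuous_eps_inv _ _ H1 (d/2) ltac:(lra)) as [d1 [Hd1 E1]].
  destruct (continuous_eps_inv _ _ H2 (d/2) ltac:(lra)) as [d2 [Hd2 E2]].
  exists (Rmin d1 d2). split; [apply Rmin_pos; auto|]. intros y Hy. pose proof (Rmin_l d1 d2). pose proof (Rmin_r d1 d2).
  apply H. eapply Rle_lt_trans; [apply Cmod_le_Re_Im|].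
  replace d with (d/2+d/2) by field. apply Rplus_lt_compat; [apply (E1 y)|apply (E2 y)]; lra.
Qed.

(** [ipt r t] is the inverse of the boundary point [w = r e^(it)], so [cauchy_coef F r n] is the
    usual integral of [F(w) w^(-n-1) dw] divided by [2 pi i]. *)
Definition ipt (r t : R) : C := (RtoC (/ r) * eit (- t))%C.
Definition cauchy_coef (F : C -> C) (r : R) (n : nat) : C :=
  (RtoC (/ (2 * PI)) * CInt (fun t => F (RtoC r * eit t) * ipt r t ^ n) 0 (2*PI))%C.

Lemma eit_opp t : (eit (- t) * eit t)%C = RtoC 1.
Proof.
  unfold eit. rewrite <- cexp_plus. rewrite RtoC_opp. replace (Ci * - RtoC t + Ci * RtoC t)%C with (RtoC 0) by ring. apply cexp_0.
Qed.

Lemma ccont_ipt r : ccont (ipt r).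
Proof.
  unfold ipt. apply ccont_scal.
  apply (ccont_ext (fun t => (cos t, - sin t))). { intros; rewrite eit_eq, cos_neg, sin_neg; auto. }
  intros t. split; simpl; apply continuity_pt_filterlim; [apply continuity_cos|apply continuity_pt_opp, continuity_sin].
Qed.

Lemma ccont_pt r : ccont (fun t => RtoC r * eit t)%C.
Proof. apply ccont_scal, ccont_eit. Qed.

Lemma Cmod_ipt r t : 0 < r -> Cmod (ipt r t) = / r.
Proof.
  intros Hr. unfold ipt. rewrite Cmod_mult, Cmod_R, Cmod_eit, Rabs_right; [ring|]. left; apply Rinv_0_lt_compat; auto.
Qed.

Lemma Cmod_pow z n : Cmod (z ^ n)%C = Cmod z ^ n.
Proof. induction n; simpl; [apply Cmod_1|rewrite Cmod_mult, IHn; auto]. Qed.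

Lemma cauchy_coef_le F r n M : 0 < r -> entire F -> (forall t, Cmod (F (RtoC r * eit t)%C) <= M) ->
  Cmod (cauchy_coef F r n) <= M / r ^ n.
Proof.
  intros Hr HF HM. pose proof PI_RGT_0. unfold cauchy_coef. rewrite Cmod_mult, Cmod_R, Rabs_right.
  2:{ left. apply Rinv_0_lt_compat. lra. }
  apply Rle_trans with (/ (2*PI) * (M / r^n * (2*PI - 0))).
  - apply Rmult_le_compat_l. { left. apply Rinv_0_lt_compat. lra. }
    apply CInt_le; [lra| |].
    + apply ccont_mult; [apply (entire_ccont F); auto; apply ccont_pt|apply ccont_pow, ccont_ipt].
    + intros t _. rewrite Cmod_mult, Cmod_pow, Cmod_ipt, pow_inv by auto.
      apply Rmult_le_compat_r; auto. left. apply Rinv_0_lt_compat, pow_lt; auto.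
  - right. field. split; [apply pow_nonzero; lra|lra].
Qed.

Section Taylor.
Variables (z0 : C) (r : R).
Hypothesis Hr : Cmod z0 < r.
Let kk (t : R) : C := (let w := (RtoC r * eit t) in Ci * w * / (w - z0))%C.
Let rpos : 0 < r. Proof. pose proof (Cmod_ge_0 z0). lra. Qed.

(** One step of the geometric series of [w / (w - z0)] in powers of [z0 / w]. Iterating it finitely
    often yields the Taylor polynomial with an explicit remainder, so sum and integral are never
    exchanged. *)
Lemma kk_step t : kk t = (Ci + (z0 * ipt r t) * kk t)%C.
Proof.
  unfold kk, ipt. cbv zeta. assert (Hp : Cmod (RtoC r * eit t)%C = r) by exact (Cmod_pt z0 r Hr t).
  pose proof (Cneq_mod (RtoC r * eit t)%C z0 ltac:(rewrite Hp; auto)) as Hn.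
  assert (Hw : (RtoC r * eit t)%C <> RtoC 0). { intros E. rewrite E, Cmod_0 in Hp. lra. }
  assert (Hi : (RtoC (/ r) * eit (- t))%C = (/ (RtoC r * eit t))%C).
  { rewrite <- (Cmult_1_r (RtoC (/ r) * eit (- t))%C), <- (Cinv_r (RtoC r * eit t)%C) by auto.
    rewrite RtoC_inv by lra.
    replace (/ RtoC r * eit (- t) * (RtoC r * eit t * / (RtoC r * eit t)))%C with ((RtoC r * / RtoC r) * ((eit (- t) * eit t) * / (RtoC r * eit t)))%C by ring.
    rewrite eit_opp, Cinv_r by (intros E; apply RtoC_inj in E; lra). ring. }
  rewrite Hi. clear Hi Hp. set (w := (RtoC r * eit t)%C) in *. clearbody w. field. split; auto.
Qed.

Lemma kernel_expand F N : entire F ->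
  CInt (fun t => F (RtoC r * eit t) * kk t)%C 0 (2*PI) =
  (Ci * RtoC (2 * PI) * csum (fun n => cauchy_coef F r n * z0 ^ n) N + CInt (fun t => F (RtoC r * eit t) * (z0 * ipt r t) ^ N * kk t) 0 (2*PI))%C.
Proof.
  intros HF. pose proof PI_RGT_0.
  assert (cpseries : ccont (fun t => F (RtoC r * eit t))%C) by (apply (entire_ccont F); auto; apply ccont_pt).
  assert (CI : ccont (fun t => z0 * ipt r t)%C) by (apply ccont_scal, ccont_ipt).
  assert (CK : ccont kk) by apply (ccont_kf z0 r Hr).
  induction N.
  - simpl. rewrite Cmult_0_r, Cplus_0_l. apply CInt_ext. intros; ring.
  - rewrite IHN. simpl csum.
    rewrite (CInt_ext (fun t => F (RtoC r * eit t) * (z0 * ipt r t) ^ N * kk t)%C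
       (fun t => (Ci * z0 ^ N) * (F (RtoC r * eit t) * ipt r t ^ N) + F (RtoC r * eit t) * (z0 * ipt r t) ^ (S N) * kk t)%C).
    2:{ intros t. rewrite (kk_step t) at 1. rewrite !Cpow_S, !Cpow_mult_l. ring. }
    rewrite CInt_plus.
    + rewrite CInt_scal by (apply ccont_mult; auto; apply ccont_pow, ccont_ipt).
      set (X := CInt (fun t => F (RtoC r * eit t) * ipt r t ^ N)%C 0 (2*PI)).
      assert (HT : cauchy_coef F r N = (RtoC (/ (2*PI)) * X)%C) by reflexivity. rewrite HT.
      assert (E : (RtoC (2*PI) * RtoC (/ (2*PI)))%C = RtoC 1). { rewrite <- RtoC_mult. f_equal. field. lra. }
      rewrite <- (Cmult_1_l (Ci * z0 ^ N * X)%C), <- E. ring.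
    + apply ccont_scal, ccont_mult; auto. apply ccont_pow, ccont_ipt.
    + apply ccont_mult; auto. apply ccont_mult; auto. apply (ccont_pow (fun t => z0 * ipt r t)%C (S N)). auto.
Qed.

Lemma kernel_rest F N M : entire F -> (forall t, Cmod (F (RtoC r * eit t)%C) <= M) ->
  Cmod (CInt (fun t => F (RtoC r * eit t) * (z0 * ipt r t) ^ N * kk t)%C 0 (2*PI)) <=
  M * (r / (r - Cmod z0)) * (Cmod z0 / r) ^ N * (2 * PI).
Proof.
  intros HF HM. pose proof PI_RGT_0.
  replace (M * (r / (r - Cmod z0)) * (Cmod z0 / r) ^ N * (2 * PI)) with (M * (r / (r - Cmod z0)) * (Cmod z0 / r) ^ N * (2 * PI - 0)) by ring.
  apply CInt_le; [lra| |].
  - apply ccont_mult; [apply ccont_mult|apply (ccont_kf z0 r Hr)].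
    + apply (entire_ccont F); auto; apply ccont_pt.
    + apply (ccont_pow (fun t => z0 * ipt r t)%C), ccont_scal, ccont_ipt.
  - intros t _. rewrite !Cmod_mult, Cmod_pow, Cmod_mult, Cmod_ipt by auto.
    assert (Cmod (kk t) <= r / (r - Cmod z0)) by exact (kernel_bound z0 r Hr t). pose proof (HM t). pose proof (Cmod_ge_0 (F (RtoC r * eit t)%C)).
    assert (0 <= (Cmod z0 * / r)^N). { apply pow_le. apply Rmult_le_pos; [apply Cmod_ge_0|]. left; apply Rinv_0_lt_compat; auto. }
    apply Rle_trans with (M * (Cmod z0 * / r)^N * (r / (r - Cmod z0))).
    + apply Rmult_le_compat; auto.
      * apply Rmult_le_pos; auto.
      * apply Cmod_ge_0.
      * apply Rmult_le_compat_r; auto.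
    + right. unfold Rdiv. ring.
Qed.
End Taylor.

Lemma CInt_eit_neg n : CInt (fun t => eit (- t) ^ S n)%C 0 (2*PI) = RtoC 0.
Proof.
  set (k := INR (S n)). assert (Hk : 0 < k) by (apply lt_0_INR; lia).
  assert (E : forall t m, (eit (- t) ^ m)%C = (cos (INR m * t), - sin (INR m * t))).
  { intros t m. induction m.
    - simpl. rewrite Rmult_0_l, cos_0, sin_0, Ropp_0. reflexivity.
    - rewrite Cpow_S, IHm, eit_eq, S_INR. replace ((INR m + 1) * t) with (INR m * t + t) by ring.
      rewrite cos_plus, sin_plus, cos_neg, sin_neg. apply C_eq; simpl; ring. }
  rewrite (CInt_ext _ (fun t => (cos (k * t), - sin (k * t)))) by (intros; apply E).
  assert (P1 : sin (k * (2 * PI)) = 0).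
  { replace (k * (2*PI)) with (0 + 2 * INR (S n) * PI) by (unfold k; ring). rewrite sin_period. apply sin_0. }
  assert (P2 : cos (k * (2 * PI)) = 1).
  { replace (k * (2*PI)) with (0 + 2 * INR (S n) * PI) by (unfold k; ring). rewrite cos_period. apply cos_0. }
  unfold CInt. simpl. apply C_eq; simpl.
  - apply is_RInt_unique. 
    replace 0 with (minus (sin (k * (2*PI)) / k) (sin (k * 0) / k)) at 2.
    2:{ rewrite P1, Rmult_0_r, sin_0. unfold minus, plus, opp; simpl. field. lra. }
    apply (is_RInt_derive (fun t => sin (k * t) / k) (fun t => cos (k * t))).
    + intros x _. auto_derive; auto. field. lra.
    + intros x _. apply continuity_pt_filterlim. apply (continuity_pt_comp (fun t => k * t) cos); [|apply continuity_cos].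
      apply continuity_pt_mult; [apply continuity_pt_const; intros ? ?; auto|apply derivable_continuous_pt, derivable_pt_id].
  - apply is_RInt_unique. 
    replace 0 with (minus (cos (k * (2*PI)) / k) (cos (k * 0) / k)) at 2.
    2:{ rewrite P2, Rmult_0_r, cos_0. unfold minus, plus, opp; simpl. field. lra. }
    apply (is_RInt_derive (fun t => cos (k * t) / k) (fun t => - sin (k * t))).
    + intros x _. auto_derive; auto. field. lra.
    + intros x _. apply continuity_pt_filterlim. apply continuity_pt_opp. apply (continuity_pt_comp (fun t => k * t) sin); [|apply continuity_sin].
      apply continuity_pt_mult; [apply continuity_pt_const; intros ? ?; auto|apply derivable_continuous_pt, derivable_pt_id].
Qed.

Lemma geom_to_0 q K e : 0 <= q < 1 -> 0 < e -> exists N, forall n, (N <= n)%nat -> K * q ^ n < e.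
Proof.
  intros Hq He. destruct (pow_lt_1_zero q ltac:(rewrite Rabs_right; lra) (e / (Rabs K + 1))) as [N HN].
  { apply Rdiv_lt_0_compat; auto. pose proof (Rabs_pos K); lra. }
  exists N. intros n Hn. specialize (HN n Hn). pose proof (pow_le q n (proj1 Hq)). rewrite Rabs_right in HN by lra.
  pose proof (Rabs_pos K). pose proof (Rle_abs K).
  apply Rle_lt_trans with (Rabs K * q ^ n); [apply Rmult_le_compat_r; auto|].
  apply Rle_lt_trans with ((Rabs K + 1) * q ^n); [apply Rmult_le_compat_r; auto; lra|].
  apply Rmult_lt_compat_l with (r := Rabs K + 1) in HN; [|lra].
  replace ((Rabs K + 1) * (e / (Rabs K + 1))) with e in HN by (field; lra). auto.
Qed.

Lemma C_eq_eps (z w : C) : (forall e, 0 < e -> Cmod (z - w)%C <= e) -> z = w.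
Proof.
  intros H. assert (E : (z - w)%C = RtoC 0).
  { apply Cmod_eq_0. apply Rle_antisym; [|apply Cmod_ge_0]. apply le_epsilon. intros e He. specialize (H e He). lra. }
  replace z with ((z - w) + w)%C by ring. rewrite E. ring.
Qed.

(** Cauchy's formula and the expanded kernel are two values of the same integral; dividing by
    [2 pi i] leaves the Taylor remainder. *)
Lemma taylor_circle F r z0 M N : entire F -> Cmod z0 < r -> (forall t, Cmod (F (RtoC r * eit t)%C) <= M) ->
  Cmod (F z0 - csum (fun n => cauchy_coef F r n * z0 ^ n) N)%C <= M * (r / (r - Cmod z0)) * (Cmod z0 / r) ^ N.
Proof.
  intros HF Hr HM. pose proof PI_RGT_0 as Hpi. pose proof (Cmod_ge_0 z0) as Hz.
  assert (rpos : 0 < r) by lra.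
  set (kk := (fun t => (let w := (RtoC r * eit t) in Ci * w * / (w - z0)))%C).
  (* The kernel integral is found from the same expansion with [F = 1]: by orthogonality all
     coefficients beyond the first vanish, and the remainder tends to 0. *)
  assert (HJ : CInt kk 0 (2*PI) = (Ci * RtoC (2*PI))%C).
  { apply C_eq_eps. intros e He.
    assert (H1 : entire (fun _ => RtoC 1)) by apply entire_const.
    assert (Hc : forall n, csum (fun n => cauchy_coef (fun _ => RtoC 1) r n * z0 ^ n)%C (S n) = RtoC 1).
    { induction n.
      - simpl. unfold cauchy_coef. rewrite (CInt_ext _ (fun _ => RtoC 1)) by (intros; simpl; ring).
        rewrite CInt_const, Rminus_0_r, <- !RtoC_mult.
                replace (/ (2*PI) * (1 * (2*PI)) * 1) with 1 by (field; lra). ring.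
      - change (csum (fun n => cauchy_coef (fun _ => RtoC 1) r n * z0 ^ n)%C (S (S n))) with
          (csum (fun n => cauchy_coef (fun _ => RtoC 1) r n * z0 ^ n) (S n) + cauchy_coef (fun _ => RtoC 1) r (S n) * z0 ^ (S n))%C.
        rewrite IHn. unfold cauchy_coef. rewrite (CInt_ext _ (fun t => RtoC (/ r) ^ S n * eit (- t) ^ S n)%C).
        2:{ intros t. unfold ipt. rewrite Cpow_mult_l. ring. }
        rewrite CInt_scal, CInt_eit_neg.
        + ring.
        + apply (ccont_ext (fun t => RtoC r ^ S n * ipt r t ^ S n)%C).
          * intros t. unfold ipt. rewrite Cpow_mult_l, Cmult_assoc, <- Cpow_mult_l, <- RtoC_mult.
            replace (r * / r) with 1 by (field; lra). rewrite Cpow_1_l. ring.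
          * apply ccont_scal, ccont_pow, ccont_ipt. }
    destruct (geom_to_0 (Cmod z0 / r) (1 * (r / (r - Cmod z0)) * (2*PI)) e) as [n Hn]; auto.
    { split; [apply Rdiv_le_0_compat; lra|]. apply Rmult_lt_reg_r with r; auto. unfold Rdiv; rewrite Rmult_assoc, Rinv_l; lra. }
    specialize (Hn (S n) ltac:(lia)).
    set (Y := CInt (fun t => RtoC 1 * (z0 * ipt r t) ^ (S n) * kk t)%C 0 (2*PI)).
    assert (HE : CInt (fun t => RtoC 1 * kk t)%C 0 (2*PI) = (Ci * RtoC (2 * PI) * RtoC 1 + Y)%C).
    { replace (Ci * RtoC (2 * PI) * RtoC 1)%C with (Ci * RtoC (2 * PI) * csum (fun n => cauchy_coef (fun _ => RtoC 1) r n * z0 ^ n) (S n))%C by (rewrite Hc; auto).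
      exact (kernel_expand z0 r Hr (fun _ => RtoC 1) (S n) H1). }
    assert (HR : Cmod Y <= 1 * (r / (r - Cmod z0)) * (Cmod z0 / r) ^ (S n) * (2 * PI)).
    { apply (kernel_rest z0 r Hr (fun _ => RtoC 1) (S n) 1 H1). intros; rewrite Cmod_1; lra. }
    rewrite (CInt_ext _ kk) in HE by (intros t; ring).
    rewrite HE. replace (Ci * RtoC (2*PI) * RtoC 1 + Y - Ci * RtoC (2*PI))%C with Y by ring.
    eapply Rle_trans; [apply HR|]. lra. }
  pose proof (cauchy_kernel F z0 r HF Hr) as HC.
  pose proof (kernel_expand z0 r Hr F N HF) as HE.
  pose proof (kernel_rest z0 r Hr F N M HF HM) as HR.
  set (Rst := CInt (fun t => F (RtoC r * eit t) * (z0 * ipt r t) ^ N * kk t)%C 0 (2*PI)).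
  change (CInt (fun t => F (RtoC r * eit t) * kk t)%C 0 (2*PI) = (F z0 * CInt kk 0 (2*PI))%C) in HC.
  change (CInt (fun t => F (RtoC r * eit t) * kk t)%C 0 (2*PI) = (Ci * RtoC (2 * PI) * csum (fun n => cauchy_coef F r n * z0 ^ n) N + Rst)%C) in HE.
  change (Cmod Rst <= M * (r / (r - Cmod z0)) * (Cmod z0 / r) ^ N * (2 * PI)) in HR.
  rewrite HC, HJ in HE.
  set (S := csum (fun n => cauchy_coef F r n * z0 ^ n)%C N) in *.
  assert (E : (Ci * RtoC (2*PI) * (F z0 - S))%C = Rst).
  { replace Rst with ((Ci * RtoC (2*PI) * S + Rst) - Ci * RtoC (2*PI) * S)%C by ring. rewrite <- HE. ring. }
  apply Rmult_le_reg_r with (2*PI); [lra|].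
  rewrite <- E, !Cmod_mult, Cmod_Ci, Cmod_R, Rabs_right in HR by lra. lra.
Qed.

(** * Taylor expansion of entire functions *)

Definition is_cpseries (a : nat -> C) (z l : C) : Prop :=
  is_series (fun n => Re (a n * z ^ n)%C) (Re l) /\ is_series (fun n => Im (a n * z ^ n)%C) (Im l).

Lemma csum_re f N : Re (csum f (S N)) = sum_n (fun n => Re (f n)) N.
Proof.
  induction N.
  - rewrite sum_O. change (csum f 1) with (RtoC 0 + f 0%nat)%C. rewrite re_plus, re_RtoC. apply Rplus_0_l.
  - rewrite sum_Sn. change (csum f (S (S N))) with (csum f (S N) + f (S N))%C. rewrite re_plus, IHN. reflexivity.
Qed.

Lemma csum_im f N : Im (csum f (S N)) = sum_n (fun n => Im (f n)) N.
Proof.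
  induction N.
  - rewrite sum_O. change (csum f 1) with (RtoC 0 + f 0%nat)%C. rewrite im_plus, im_RtoC. apply Rplus_0_l.
  - rewrite sum_Sn. change (csum f (S (S N))) with (csum f (S N) + f (S N))%C. rewrite im_plus, IHN. reflexivity.
Qed.

Lemma is_series_eps (u : nat -> R) l :
  (forall e, 0 < e -> exists N, forall n, (N <= n)%nat -> Rabs (sum_n u n - l) < e) -> is_series u l.
Proof.
  intros H. apply (filterlim_locally (F := eventually) (sum_n u)). intros e. destruct (H e (cond_pos e)) as [N HN].
  exists N. intros n Hn. apply HN. auto.
Qed.

Lemma is_cpseries_of_bound a z l K q : 0 <= q < 1 ->
  (forall N, Cmod (l - csum (fun n => a n * z ^ n) N)%C <= K * q ^ N) -> is_cpseries a z l.
Proof.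
  intros Hq H.
  split; apply is_series_eps; intros e He; destruct (geom_to_0 q K e Hq He) as [N HN]; exists N; intros n Hn;
    [rewrite <- csum_re|rewrite <- csum_im]; rewrite Rabs_minus_sym.
  - eapply Rle_lt_trans; [|apply (HN (S n)); lia]. eapply Rle_trans; [|apply (H (S n))].
    exact (re_le_Cmod (l - csum (fun n => a n * z ^ n) (S n))%C).
  - eapply Rle_lt_trans; [|apply (HN (S n)); lia]. eapply Rle_trans; [|apply (H (S n))].
    exact (im_le_Cmod (l - csum (fun n => a n * z ^ n) (S n))%C).
Qed.

Lemma Re_mul_powR (c : C) x n : Re (c * RtoC x ^ n)%C = Re c * x ^ n.
Proof. rewrite <- RtoC_pow. apply re_scal_r. Qed.
Lemma Im_mul_powR (c : C) x n : Im (c * RtoC x ^ n)%C = Im c * x ^ n.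
Proof. rewrite <- RtoC_pow. apply im_scal_r. Qed.

Lemma is_series_to_pseries (a : nat -> R) x l : is_series (fun n => a n * x ^ n) l <-> is_pseries a x l.
Proof.
  assert (E : forall n, scal (pow_n (K := R_Ring) x n) (a n) = a n * x ^ n).
  { intros n. rewrite pow_n_pow. unfold scal; simpl; unfold mult; simpl. ring. }
  unfold is_pseries. split; intros H; eapply is_series_ext; try apply H; intros n; [symmetry|]; apply E.
Qed.

Lemma is_cpseries_real a (x : R) l : is_cpseries a (RtoC x) l ->
  is_pseries (fun n => Re (a n)) x (Re l) /\ is_pseries (fun n => Im (a n)) x (Im l).
Proof.
  intros [H1 H2]. split; apply is_series_to_pseries; eapply is_series_ext; try apply H1; try apply H2; intros n; simpl.
  - apply Re_mul_powR.
  - apply Im_mul_powR.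
Qed.

Lemma ex_pseries_radius (a : nat -> R) x l : is_pseries a x l -> Rbar_le (Rabs x) (CV_radius a).
Proof.
  intros H. apply Rbar_not_lt_le. intros Hlt. apply (CV_disk_outside _ _ Hlt).
  apply is_series_to_pseries in H. apply ex_series_lim_0. exists l. auto.
Qed.

Lemma pseries_unique (a b : nat -> R) rho : 0 < rho ->
  (forall x, Rabs x < rho -> exists l, is_pseries a x l /\ is_pseries b x l) -> forall n, a n = b n.
Proof.
  intros Hr H n. 
  assert (R1 : Rabs (rho/2) = rho/2) by (rewrite Rabs_right; lra).
  destruct (H (rho/2)) as [l [Ha Hb]]; [lra|].
  apply ex_pseries_radius in Ha, Hb. rewrite R1 in Ha, Hb.
  apply PSeries_ext_recip.
  - eapply Rbar_lt_le_trans; [|apply Ha]. simpl. lra.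
  - eapply Rbar_lt_le_trans; [|apply Hb]. simpl. lra.
  - exists (mkposreal rho Hr). intros x Hx. 
    assert (Rabs x < rho). { unfold ball in Hx; simpl in Hx. unfold AbsRing_ball, abs, minus, plus, opp in Hx; simpl in Hx.
      rewrite Ropp_0, Rplus_0_r in Hx. auto. }
    destruct (H x H0) as [m [Hma Hmb]]. rewrite (is_pseries_unique _ _ _ Hma), (is_pseries_unique _ _ _ Hmb). auto.
Qed.

Lemma is_cpseries_unique a b rho : 0 < rho ->
  (forall x : R, Rabs x < rho -> exists l, is_cpseries a (RtoC x) l /\ is_cpseries b (RtoC x) l) -> forall n, a n = b n.
Proof.
  intros Hr H n. apply C_eq.
  - apply (pseries_unique (fun n => Re (a n)) (fun n => Re (b n)) rho Hr). intros x Hx. destruct (H x Hx) as [l [Ha Hb]].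
    exists (Re l). split; [apply (is_cpseries_real a x l Ha)|apply (is_cpseries_real b x l Hb)].
  - apply (pseries_unique (fun n => Im (a n)) (fun n => Im (b n)) rho Hr). intros x Hx. destruct (H x Hx) as [l [Ha Hb]].
    exists (Im l). split; [apply (is_cpseries_real a x l Ha)|apply (is_cpseries_real b x l Hb)].
Qed.

Lemma ratio_lt_1 x r : 0 <= x < r -> 0 <= x / r < 1.
Proof.
  intros H. split; [apply Rdiv_le_0_compat; lra|]. apply Rmult_lt_reg_r with r; [lra|].
  unfold Rdiv; rewrite Rmult_assoc, Rinv_l; lra.
Qed.

Lemma eit_period_bound F r : entire F -> 0 < r -> exists M, forall t, Cmod (F (RtoC r * eit t)%C) <= M.
Proof.
  intros HF Hr. pose proof PI_RGT_0.
  destruct (ccont_bounded (fun t => F (RtoC r * eit t)%C) (-4) 4 ltac:(lra)) as [M [_ HM]].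
  { apply (entire_ccont F); auto. apply ccont_pt. }
  exists M. intros t.
  (* Every point of the circle has an argument [acos] or [- acos], so angles in [[-4, 4]] suffice,
     as [PI <= 4]. *)
  assert (Hs : exists s, -4 <= s <= 4 /\ eit s = eit t).
  { assert (Hsc : (cos t)² + (sin t)² = 1) by (rewrite Rplus_comm; apply sin2_cos2).
    pose proof (COS_bound t) as HB. pose proof (acos_bound (cos t)). pose proof PI_4.
    destruct (Rle_lt_dec 0 (sin t)) as [Hp|Hn].
    - exists (acos (cos t)). split; [lra|]. rewrite !eit_eq, cos_acos, sin_acos by auto. f_equal.
      replace (1 - (cos t)²) with ((sin t)²) by lra. apply sqrt_Rsqr; auto.
    - exists (- acos (cos t)). split; [lra|]. rewrite !eit_eq, cos_neg, sin_neg, cos_acos, sin_acos by auto. f_equal.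
      replace (1 - (cos t)²) with ((sin t)²) by lra. rewrite sqrt_Rsqr_abs, Rabs_left; lra. }
  destruct Hs as [s [Hs1 Hs2]]. rewrite <- Hs2. apply HM; auto.
Qed.

Lemma cauchy_coef_cis F r z : entire F -> Cmod z < r -> is_cpseries (cauchy_coef F r) z (F z).
Proof.
  intros HF Hz. pose proof (Cmod_ge_0 z). destruct (eit_period_bound F r HF ltac:(lra)) as [M HM].
  apply (is_cpseries_of_bound _ _ _ (M * (r / (r - Cmod z))) (Cmod z / r)).
  - apply ratio_lt_1; lra.
  - intros N. apply taylor_circle; auto.
Qed.

(** Both sequences expand [F] on the smaller disc. With this, Cauchy's estimates for all radii bear
    on one and the same sequence. *)
Lemma cauchy_coef_indep F r s n : entire F -> 0 < r -> 0 < s -> cauchy_coef F r n = cauchy_coef F s n.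
Proof.
  intros HF Hr Hs. apply (is_cpseries_unique _ _ (Rmin r s)); [apply Rmin_pos; auto|].
  intros x Hx. exists (F (RtoC x)). pose proof (Rmin_l r s). pose proof (Rmin_r r s).
  split; apply cauchy_coef_cis; auto; rewrite Cmod_R; lra.
Qed.

Lemma entire_taylor F : entire F -> exists a : nat -> C,
  (forall z, is_cpseries a z (F z)) /\
  (forall r M, 0 < r -> (forall z, Cmod z = r -> Cmod (F z) <= M) -> forall n, Cmod (a n) <= M / r ^ n) /\
  (forall z r M, Cmod z < r -> (forall w, Cmod w = r -> Cmod (F w) <= M) -> forall N,
     Cmod (F z - csum (fun n => a n * z ^ n) N)%C <= M * (r / (r - Cmod z)) * (Cmod z / r) ^ N).
Proof.
  intros HF. exists (cauchy_coef F 1).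
  assert (Hm : forall r t, 0 < r -> Cmod (RtoC r * eit t)%C = r).
  { intros r t Hr. rewrite Cmod_mult, Cmod_R, Cmod_eit, Rabs_right; lra. }
  split; [|split].
  - intros z. pose proof (Cmod_ge_0 z). pose proof (cauchy_coef_cis F (Cmod z + 1) z HF ltac:(lra)) as [H1 H2].
    split; eapply is_series_ext; try apply H1; try apply H2; intros n; cbv beta; rewrite (cauchy_coef_indep F (Cmod z + 1) 1 n HF); auto; lra.
  - intros r M Hr HM n. rewrite (cauchy_coef_indep F 1 r n HF ltac:(lra) Hr). apply cauchy_coef_le; auto.
  - intros z r M Hz HM N. pose proof (Cmod_ge_0 z).
    replace (csum (fun n => cauchy_coef F 1 n * z ^ n)%C N) with (csum (fun n => cauchy_coef F r n * z ^ n)%C N).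
    + apply taylor_circle; auto. intros t. apply HM, Hm. lra.
    + induction N; simpl; auto. rewrite IHN, (cauchy_coef_indep F r 1 N HF); auto; lra.
Qed.

(** * Maximum principle on rectangles *)

Definition cont2 (u : R -> R -> R) := forall x y e, 0 < e -> exists d, 0 < d /\
  forall x' y', Rabs (x' - x) < d -> Rabs (y' - y) < d -> Rabs (u x' y' - u x y) < e.

(** Here the bisected property is that every value on the whole rectangle is matched or exceeded
    inside the small one. If all four quarters failed, the largest of their four counterexamples
    would refute the parent. At the limit point continuity turns domination into a maximum. *)
Lemma evt2 u a c w h : 0 <= w -> 0 <= h -> cont2 u ->
  exists x y, a <= x <= a + w /\ c <= y <= c + h /\
    forall x' y', a <= x' <= a + w -> c <= y' <= c + h -> u x' y' <= u x y.
Proof.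
  intros Hw Hh Hu.
  pose (S := fun a' c' w' h' => forall x y, a <= x <= a + w -> c <= y <= c + h -> exists x' y',
     a' <= x' <= a' + w' /\ c' <= y' <= c' + h' /\ u x y <= u x' y').
  destruct (bisect2 S) with (a0 := a) (c0 := c) (w := w) (h := h) as (x & y & Hx & Hy & Hn); auto.
  - intros a' c' w' h' Hw' Hh' HS. apply NNPP. intros N.
    apply not_or_and in N. destruct N as [N1 N]. apply not_or_and in N. destruct N as [N2 N].
    apply not_or_and in N. destruct N as [N3 N4].
    assert (W : forall a1 c1 w1 h1, ~ S a1 c1 w1 h1 -> exists x y, a <= x <= a + w /\ c <= y <= c + h /\
       forall x' y', a1 <= x' <= a1 + w1 -> c1 <= y' <= c1 + h1 -> u x' y' < u x y).
    { intros a1 c1 w1 h1 HN. apply not_all_ex_not in HN. destruct HN as [x HN]. apply not_all_ex_not in HN. destruct HN as [y HN].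
      exists x, y. split; [apply NNPP; intros E; apply HN; intros; tauto|].
      split; [apply NNPP; intros E; apply HN; intros; tauto|].
      intros x' y' H1 H2. apply Rnot_le_lt. intros E. apply HN. intros _ _. exists x', y'. auto. }
    destruct (W _ _ _ _ N1) as (x1 & y1 & A1 & B1 & C1). destruct (W _ _ _ _ N2) as (x2 & y2 & A2 & B2 & C2).
    destruct (W _ _ _ _ N3) as (x3 & y3 & A3 & B3 & C3). destruct (W _ _ _ _ N4) as (x4 & y4 & A4 & B4 & C4).
    assert (Hmax : exists x y, a <= x <= a + w /\ c <= y <= c + h /\ u x1 y1 <= u x y /\ u x2 y2 <= u x y /\ u x3 y3 <= u x y /\ u x4 y4 <= u x y).
    { destruct (Rle_lt_dec (u x1 y1) (u x2 y2)), (Rle_lt_dec (u x3 y3) (u x4 y4)).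
      - destruct (Rle_lt_dec (u x2 y2) (u x4 y4)); [exists x4, y4|exists x2, y2]; repeat split; try tauto; lra.
      - destruct (Rle_lt_dec (u x2 y2) (u x3 y3)); [exists x3, y3|exists x2, y2]; repeat split; try tauto; lra.
      - destruct (Rle_lt_dec (u x1 y1) (u x4 y4)); [exists x4, y4|exists x1, y1]; repeat split; try tauto; lra.
      - destruct (Rle_lt_dec (u x1 y1) (u x3 y3)); [exists x3, y3|exists x1, y1]; repeat split; try tauto; lra. }
    destruct Hmax as (x & y & Hx & Hy & M1 & M2 & M3 & M4).
    destruct (HS x y Hx Hy) as (x' & y' & Hx' & Hy' & Hle).
    destruct (Rle_lt_dec x' (a' + w'/2)), (Rle_lt_dec y' (c' + h'/2)).
    + specialize (C1 x' y' ltac:(lra) ltac:(lra)). lra.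
    + specialize (C3 x' y' ltac:(lra) ltac:(lra)). lra.
    + specialize (C2 x' y' ltac:(lra) ltac:(lra)). lra.
    + specialize (C4 x' y' ltac:(lra) ltac:(lra)). lra.
  - intros x y Hx Hy. exists x, y. repeat split; lra.
  - exists x, y. split; auto. split; auto. intros x' y' Hx' Hy'. apply le_epsilon. intros e He.
    destruct (Hu x y e He) as [d [Hd H]]. destruct (pow2_small (w+h) d Hd) as [n Hsm].
    destruct (Hn n) as (a' & c' & HS & H1 & H2).
    destruct (HS x' y' Hx' Hy') as (x2 & y2 & B1 & B2 & Hle).
    assert (0 < 2^n) by (apply pow_lt; lra).
    assert (0 <= w/2^n) by (apply Rdiv_le_0_compat; auto).
    assert (0 <= h/2^n) by (apply Rdiv_le_0_compat; auto).
    assert ((w+h)/2^n = w/2^n+h/2^n) by (field; lra).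
    specialize (H x2 y2 ltac:(apply Rabs_def1; lra) ltac:(apply Rabs_def1; lra)). apply Rabs_def2 in H. lra.
Qed.

Lemma entire_cont2 g : entire g -> cont2 (fun x y => Cmod (g (x, y))).
Proof.
  intros Hg x y e He. destruct (proj1 (entire_cder g) Hg (x, y)) as [l Hl].
  destruct (cder_cont _ _ _ Hl e He) as [d [Hd H]]. exists (d/2). split; [lra|]. intros x' y' Hx Hy.
  eapply Rle_lt_trans; [|apply (H (x', y'))].
  - apply Rabs_le. pose proof (Cmod_triangle (g (x',y') - g (x,y))%C (g (x,y))).
    pose proof (Cmod_triangle (- (g (x',y') - g (x,y)))%C (g (x',y'))). rewrite Cmod_opp in H1.
    replace (g (x',y') - g (x,y) + g (x,y))%C with (g (x',y')) in H0 by ring.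
    replace (- (g (x',y') - g (x,y)) + g (x',y'))%C with (g (x,y)) in H1 by ring. lra.
  - eapply Rle_lt_trans; [apply Cmod_le_Re_Im|]. replace d with (d/2+d/2) by field. apply Rplus_lt_compat; auto.
Qed.

Lemma entire_bounded g R0 : entire g -> 0 <= R0 -> exists M, 0 <= M /\ forall z, Cmod z <= R0 -> Cmod (g z) <= M.
Proof.
  intros Hg HR. destruct (evt2 (fun x y => Cmod (g (x,y))) (-R0) (-R0) (2*R0) (2*R0)) as (x & y & _ & _ & H); try lra.
  { apply entire_cont2; auto. }
  exists (Cmod (g (x,y))). split; [apply Cmod_ge_0|]. intros [p q] Hz.
  pose proof (re_le_Cmod (p,q)). pose proof (im_le_Cmod (p,q)). simpl in *.
  apply H; split.
  - apply Rabs_le_between in H0. lra.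
  - apply Rabs_le_between in H0. lra.
  - apply Rabs_le_between in H1. lra.
  - apply Rabs_le_between in H1. lra.
Qed.

Lemma Cmod_sq_sub (g p : C) : Cmod p ^ 2 - 2 * Cmod p * Cmod (g - p)%C <= Cmod g ^ 2.
Proof.
  pose proof (Cmod_triangle g (- (g - p))%C) as T. replace (g + - (g - p))%C with p in T by ring. rewrite Cmod_opp in T.
  pose proof (Cmod_ge_0 g). pose proof (Cmod_ge_0 p). pose proof (Cmod_ge_0 (g - p)%C).
  destruct (Rle_lt_dec (Cmod (g - p)%C) (Cmod p)); nra.
Qed.

(* Summing over the four points [z0 + i^k h] removes the cross terms of the quadratic Taylor polynomial. *)
Lemma four_point g z0 : entire g -> exists K, 0 < K /\ forall h, 0 <= h <= 1/2 ->
  4 * Cmod (g z0) ^ 2 - K * h ^ 3 <=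
  Cmod (g (z0 + RtoC h)%C) ^ 2 + Cmod (g (z0 - RtoC h)%C) ^ 2 + Cmod (g (z0 + Ci * RtoC h)%C) ^ 2 + Cmod (g (z0 - Ci * RtoC h)%C) ^ 2.
Proof.
  intros Hg.
  assert (Hg' : entire (fun k => g (z0 + k)%C)).
  { apply (entire_comp g (fun k => z0 + k)%C); auto. apply entire_plus; [apply entire_const|apply entire_id]. }
  destruct (entire_taylor _ Hg') as (a & Ha & _ & Hb).
  destruct (entire_bounded _ 1 Hg' ltac:(lra)) as [M [HM0 HM]].
  set (p := fun k : C => (a 0%nat + a 1%nat * k + a 2%nat * k ^ 2)%C).
  set (Kp := Cmod (a 0%nat) + Cmod (a 1%nat) + Cmod (a 2%nat)).
  pose proof (Cmod_ge_0 (a 0%nat)). pose proof (Cmod_ge_0 (a 1%nat)). pose proof (Cmod_ge_0 (a 2%nat)).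
  assert (Hrem : forall k, Cmod k <= 1/2 -> Cmod (g (z0 + k) - p k)%C <= 2 * M * Cmod k ^ 3).
  { intros k Hk. pose proof (Cmod_ge_0 k). specialize (Hb k 1 M ltac:(lra) ltac:(intros; apply HM; lra) 3%nat). simpl csum in Hb.
    replace (g (z0 + k) - p k)%C with (g (z0 + k) - (RtoC 0 + a 0%nat * 1 + a 1%nat * (k * 1) + a 2%nat * (k * (k * 1))))%C by (unfold p; simpl; ring).
    eapply Rle_trans; [apply Hb|]. replace (Cmod k / 1) with (Cmod k) by field.
    apply Rmult_le_compat_r; [apply pow_le; auto|]. rewrite (Rmult_comm 2). apply Rmult_le_compat_l; auto.
    apply Rmult_le_reg_r with (1 - Cmod k); [lra|]. unfold Rdiv. rewrite Rmult_assoc, Rinv_l; lra. }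
  assert (Hp : forall k, Cmod k <= 1/2 -> Cmod (p k) <= Kp).
  { intros k Hk. unfold p, Kp. eapply Rle_trans; [apply Cmod_triangle|]. eapply Rle_trans; [apply Rplus_le_compat_r, Cmod_triangle|].
    rewrite !Cmod_mult, Cmod_pow. pose proof (Cmod_ge_0 k).
    assert (Cmod k ^ 2 <= 1) by nra.
    assert (Cmod (a 1%nat) * Cmod k <= Cmod (a 1%nat) * 1) by (apply Rmult_le_compat_l; lra).
    assert (Cmod (a 2%nat) * Cmod k ^ 2 <= Cmod (a 2%nat) * 1) by (apply Rmult_le_compat_l; lra). lra. }
  assert (E0 : a 0%nat = g z0).
  { pose proof (Hb (RtoC 0) 1 M ltac:(rewrite Cmod_0; lra) ltac:(intros; apply HM; lra) 1%nat) as H2. simpl csum in H2.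
    rewrite Cmod_0 in H2. replace (M * (1 / (1 - 0)) * (0 / 1)^1) with 0 in H2 by (simpl; field).
    replace (z0 + RtoC 0)%C with z0 in H2 by ring.
    assert (H3 : (g z0 - (RtoC 0 + a 0%nat * 1))%C = RtoC 0) by (apply Cmod_eq_0; apply Rle_antisym; [auto|apply Cmod_ge_0]).
    replace (g z0) with ((g z0 - (RtoC 0 + a 0%nat * 1)) + a 0%nat)%C by ring. rewrite H3. ring. }
  assert (HKp : 0 <= Kp) by (unfold Kp; lra).
  (* Each of the four points loses [4 Kp M h^3] against the quadratic polynomial [p]; the added 1
     makes the constant positive. *)
  exists (16 * Kp * M + 1). split; [nra|].
  intros h Hh.
  assert (Hk : forall k, Cmod k = h -> Cmod (p k)^2 - 4 * Kp * M * h^3 <= Cmod (g (z0 + k)%C)^2).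
  { intros k Hk. eapply Rle_trans; [|apply (Cmod_sq_sub _ (p k))].
    pose proof (Hrem k ltac:(lra)) as H2. pose proof (Hp k ltac:(lra)) as H3. rewrite Hk in H2.
    pose proof (Cmod_ge_0 (p k)). pose proof (Cmod_ge_0 (g (z0 + k) - p k)%C).
    assert (Cmod (p k) * Cmod (g (z0 + k) - p k)%C <= Kp * (2 * M * h^3)) by (apply Rmult_le_compat; auto). nra. }
  assert (Mh : Cmod (RtoC h) = h) by (rewrite Cmod_R, Rabs_right; lra).
  pose proof (Hk (RtoC h) Mh) as Q1.
  pose proof (Hk (- RtoC h)%C ltac:(rewrite Cmod_opp; auto)) as Q2.
  pose proof (Hk (Ci * RtoC h)%C ltac:(rewrite Cmod_mult, Cmod_Ci, Mh; ring)) as Q3.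
  pose proof (Hk (- (Ci * RtoC h))%C ltac:(rewrite Cmod_opp, Cmod_mult, Cmod_Ci, Mh; ring)) as Q4.
  assert (Id : Cmod (p (RtoC h))^2 + Cmod (p (- RtoC h)%C)^2 + Cmod (p (Ci * RtoC h)%C)^2 + Cmod (p (- (Ci * RtoC h))%C)^2 =
     4 * Cmod (a 0%nat)^2 + 4 * h^2 * Cmod (a 1%nat)^2 + 4 * h^4 * Cmod (a 2%nat)^2).
  { rewrite !Cmod_Re_Im. unfold p. destruct (a 0%nat) as [a1 a2], (a 1%nat) as [b1 b2], (a 2%nat) as [c1 c2]. simpl. ring. }
  rewrite E0 in Id. unfold Cminus.
  assert (0 <= 4 * h^2 * Cmod (a 1%nat)^2). { apply Rmult_le_pos; [|apply pow2_ge_0]. pose proof (pow2_ge_0 h). lra. }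
  assert (0 <= 4 * h^4 * Cmod (a 2%nat)^2). { apply Rmult_le_pos; [|apply pow2_ge_0]. pose proof (pow_le h 4 ltac:(lra)). lra. }
  assert (0 <= h^3) by (apply pow_le; lra). nra.
Qed.

(* [|g|^2 + e (x - a)^2] is strictly subharmonic, hence has no interior maximum. *)
Lemma max_rect g a b c d B : entire g -> a <= b -> c <= d -> 0 <= B ->
  (forall x y, a <= x <= b -> c <= y <= d -> x = a \/ x = b \/ y = c \/ y = d -> Cmod (g (x,y)) <= B) ->
  forall x y, a <= x <= b -> c <= y <= d -> Cmod (g (x,y)) <= B.
Proof.
  intros Hg Hab Hcd HB Hbd x1 y1 Hx1 Hy1. apply Rnot_lt_le. intros Hbad.
  assert (Hbad2 : B^2 < Cmod (g (x1,y1))^2) by nra.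
  set (L := (b - a)^2 + 1). assert (HL : 0 < L) by (unfold L; pose proof (pow2_ge_0 (b-a)); lra).
  (* The perturbation [e (x - a)^2] stays below half of the gap at [(x1, y1)], so the maximum of [u]
     cannot lie on the boundary. *)
  set (e := (Cmod (g (x1,y1))^2 - B^2) / (2 * L)).
  assert (He : 0 < e) by (apply Rdiv_lt_0_compat; lra).
  assert (EL : e * L = (Cmod (g (x1,y1))^2 - B^2) / 2) by (unfold e; field; lra).
  set (u := fun x y => Cmod (g (x,y))^2 + e * (x - a)^2).
  assert (Hu : cont2 u).
  { intros x y ee Hee. set (M := Cmod (g (x,y))). assert (HM : 0 <= M) by apply Cmod_ge_0.
    set (e1 := Rmin 1 (ee / (2 * (2 * M + 1)))). assert (He1 : 0 < e1) by (apply Rmin_pos; [lra|apply Rdiv_lt_0_compat; lra]).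
    destruct (entire_cont2 g Hg x y e1 He1) as [d1 [Hd1 H1]]. fold M in H1.
    set (X := Rabs (x - a)). assert (HX : 0 <= X) by apply Rabs_pos.
    set (d2 := Rmin 1 (ee / (2 * e * (2 * X + 1)))).
    assert (Hpp : 0 < 2 * e * (2 * X + 1)) by (apply Rmult_lt_0_compat; lra).
    assert (Hd2 : 0 < d2) by (apply Rmin_pos; [lra|apply Rdiv_lt_0_compat; lra]).
    exists (Rmin d1 d2). split; [apply Rmin_pos; auto|]. intros x' y' Hx Hy. pose proof (Rmin_l d1 d2). pose proof (Rmin_r d1 d2).
    specialize (H1 x' y' ltac:(lra) ltac:(lra)). set (M' := Cmod (g (x',y'))) in *.
    unfold u. fold M M'.
    replace (M'^2 + e * (x' - a)^2 - (M^2 + e * (x - a)^2)) with ((M' - M) * (2 * M + (M' - M)) + e * ((x' - x) * (2 * (x - a) + (x' - x)))) by ring.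
    eapply Rle_lt_trans; [apply Rabs_triang|]. rewrite !Rabs_mult, (Rabs_right e) by lra.
    assert (A1 : Rabs (2 * M + (M' - M)) <= 2 * M + 1).
    { eapply Rle_trans; [apply Rabs_triang|]. rewrite (Rabs_right (2*M)) by lra. pose proof (Rmin_l 1 (ee / (2 * (2 * M + 1)))). fold e1 in H2. lra. }
    assert (A2 : Rabs (2 * (x - a) + (x' - x)) <= 2 * X + 1).
    { eapply Rle_trans; [apply Rabs_triang|]. rewrite Rabs_mult, (Rabs_right 2) by lra. fold X. pose proof (Rmin_l 1 (ee / (2 * e * (2 * X + 1)))). fold d2 in H2. lra. }
    assert (B1 : Rabs (M' - M) * Rabs (2 * M + (M' - M)) < ee / 2).
    { apply Rle_lt_trans with (Rabs (M' - M) * (2 * M + 1)); [apply Rmult_le_compat_l; [apply Rabs_pos|auto]|].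
      apply Rlt_le_trans with (e1 * (2*M+1)); [apply Rmult_lt_compat_r; lra|].
      apply Rle_trans with (ee / (2 * (2 * M + 1)) * (2 * M+1)); [apply Rmult_le_compat_r; [lra|apply Rmin_r]|]. right; field; lra. }
    assert (B2 : e * (Rabs (x' - x) * Rabs (2 * (x - a) + (x' - x))) <= ee / 2).
    { apply Rle_trans with (e * (d2 * (2 * X + 1))).
      - apply Rmult_le_compat_l; [lra|]. apply Rmult_le_compat; try apply Rabs_pos; lra.
      - apply Rle_trans with (e * (ee / (2 * e * (2 * X + 1)) * (2 * X + 1))).
        + apply Rmult_le_compat_l; [lra|]. apply Rmult_le_compat_r; [lra|apply Rmin_r].
        + right; field; split; lra. }
    lra. }
  destruct (evt2 u a c (b-a) (d-c)) as (x0 & y0 & Hx0 & Hy0 & Hmax); try lra; auto.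
  replace (a + (b-a)) with b in * by ring. replace (c + (d-c)) with d in * by ring.
  pose proof (Hmax x1 y1 Hx1 Hy1) as Hm1.
  assert (Hsq : forall x, a <= x <= b -> 0 <= e * (x-a)^2 <= e * L).
  { intros x Hx. split; [apply Rmult_le_pos; [lra|apply pow2_ge_0]|]. apply Rmult_le_compat_l; [lra|]. unfold L.
    assert ((x-a)^2 <= (b-a)^2) by (apply pow_incr; lra). lra. }
  assert (Hint : a < x0 < b /\ c < y0 < d).
  { apply NNPP. intros N.
    assert (Hb0 : x0 = a \/ x0 = b \/ y0 = c \/ y0 = d) by lra.
    pose proof (Hbd x0 y0 Hx0 Hy0 Hb0) as H1. pose proof (Cmod_ge_0 (g (x0,y0))).
    pose proof (Hsq x0 Hx0). pose proof (Hsq x1 Hx1). unfold u in Hm1. nra. }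
  destruct (four_point g (x0,y0) Hg) as [K [HK H4]].
  (* Besides staying inside the rectangle, [h <= e / K] makes the cubic error at most [e h^2], below
     the gain [2 e h^2] of the perturbation. *)
  set (h := Rmin (Rmin (1/2) (e / K)) (Rmin (Rmin (x0 - a) (b - x0)) (Rmin (y0 - c) (d - y0)))).
  assert (Hh : 0 < h). { repeat apply Rmin_pos; try lra. apply Rdiv_lt_0_compat; auto. }
  assert (Hhl : h <= 1/2 /\ h <= e/K /\ h <= x0-a /\ h <= b-x0 /\ h <= y0 - c /\ h <= d - y0).
  { pose proof (Rmin_l (Rmin (1/2) (e / K)) (Rmin (Rmin (x0 - a) (b - x0)) (Rmin (y0 - c) (d - y0)))).
    pose proof (Rmin_r (Rmin (1/2) (e / K)) (Rmin (Rmin (x0 - a) (b - x0)) (Rmin (y0 - c) (d - y0)))). fold h in H, H0.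
    pose proof (Rmin_l (1/2) (e/K)). pose proof (Rmin_r (1/2) (e/K)).
    pose proof (Rmin_l (Rmin (x0 - a) (b - x0)) (Rmin (y0 - c) (d - y0))). pose proof (Rmin_r (Rmin (x0 - a) (b - x0)) (Rmin (y0 - c) (d - y0))).
    pose proof (Rmin_l (x0-a) (b-x0)). pose proof (Rmin_r (x0-a) (b-x0)). pose proof (Rmin_l (y0-c) (d-y0)). pose proof (Rmin_r (y0-c) (d-y0)). lra. }
  destruct Hhl as (L1 & L2 & L3 & L4 & L5 & L6).
  specialize (H4 h ltac:(lra)).
  replace ((x0,y0) + RtoC h)%C with (x0 + h, y0) in H4 by (apply C_eq; simpl; ring).
  replace ((x0,y0) - RtoC h)%C with (x0 - h, y0) in H4 by (apply C_eq; simpl; ring).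
  replace ((x0,y0) + Ci * RtoC h)%C with (x0, y0 + h) in H4 by (apply C_eq; simpl; ring).
  replace ((x0,y0) - Ci * RtoC h)%C with (x0, y0 - h) in H4 by (apply C_eq; simpl; ring).
  pose proof (Hmax (x0+h) y0 ltac:(lra) ltac:(lra)) as M1. pose proof (Hmax (x0-h) y0 ltac:(lra) ltac:(lra)) as M2.
  pose proof (Hmax x0 (y0+h) ltac:(lra) ltac:(lra)) as M3. pose proof (Hmax x0 (y0-h) ltac:(lra) ltac:(lra)) as M4.
  unfold u in M1, M2, M3, M4.
  assert (E1 : 2 * e * h^2 <= K * h^3).
  { replace (2 * e * h^2) with (e * (x0 + h - a)^2 + e * (x0 - h - a)^2 - 2 * (e * (x0 - a)^2)) by ring. lra. }
  assert (E2 : K * h <= e).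
  { apply Rmult_le_compat_l with (r := K) in L2; [|lra]. replace (K * (e/K)) with e in L2 by (field; lra). auto. }
  assert (0 < h^2) by (apply pow_lt; auto). assert (K * h^3 <= e * h^2). { replace (K*h^3) with (K*h*h^2) by ring. apply Rmult_le_compat_r; lra. }
  nra.
Qed.

(** * Phragmén–Lindelöf *)

Lemma exp_le a b : a <= b -> exp a <= exp b.
Proof. intros [H| ->]; [left; apply exp_increasing; auto|lra]. Qed.

Lemma polar_quadrant z : 0 <= Re z -> 0 <= Im z -> 1 <= Cmod z ->
  exists xi t, 0 <= xi /\ 0 <= t <= PI/2 /\ z = cexp (xi, t).
Proof.
  intros Hx Hy Hm. set (r := Cmod z) in *. pose proof (Cmod_Re_Im z) as Hs. fold r in Hs.
  assert (Hc : 0 <= Re z / r <= 1).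
  { split; [apply Rdiv_le_0_compat; lra|]. apply Rmult_le_reg_r with r; [lra|]. unfold Rdiv. rewrite Rmult_assoc, Rinv_l by lra. nra. }
  exists (ln r), (acos (Re z / r)). split; [|split].
  - rewrite <- ln_1. destruct Hm as [Hm| <-]; [left; apply ln_increasing; lra|lra].
  - split; [apply acos_bound|]. pose proof PI_RGT_0. pose proof (acos_bound (Re z/r)).
    apply Rnot_lt_le. intros Hlt.
    assert (cos (acos (Re z/r)) < 0) by (apply cos_lt_0; lra). rewrite cos_acos in H1 by lra. lra.
  - unfold cexp. simpl. rewrite exp_ln by lra. rewrite cos_acos, sin_acos by lra. apply C_eq; simpl.
    + change (fst z) with (Re z). field. lra.
    + replace (1 - (Re z / r)²) with ((Im z / r)²).
      * rewrite sqrt_Rsqr; [field; lra|apply Rdiv_le_0_compat; lra].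
      * unfold Rsqr. apply Rmult_eq_reg_r with (r^2); [|nra]. replace ((1 - Re z / r * (Re z / r)) * r^2) with (r^2 - Re z ^ 2) by (field; lra).
        replace (Im z / r * (Im z / r) * r ^ 2) with (Im z ^ 2) by (field; lra). lra.
Qed.

Lemma cos_ge_38 s : Rabs s <= 3 * PI / 8 -> cos (3 * PI/8) <= cos s.
Proof.
  intros H. pose proof PI_RGT_0. assert (E : cos s = cos (Rabs s)).
  { unfold Rabs. destruct (Rcase_abs s); auto. rewrite cos_neg; auto. }
  rewrite E. pose proof (Rabs_pos s). apply cos_decr_1; lra.
Qed.

(* With [z = exp ze] the usual barrier [exp (- de z^(3/2))] becomes entire in [ze], so no branch of the
   power is needed and [max_rect] applies. *)
Lemma PL_quadrant F sg M C0 : entire F -> 0 < sg -> 0 <= M -> 0 <= C0 ->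
  (forall z, Cmod (F z) <= M * exp (sg * Cmod z)) -> (forall x, 0 <= x -> Cmod (F (RtoC x)) <= C0) ->
  forall z, 0 <= Re z -> 0 <= Im z -> Cmod (F z) <= (C0 + M * exp sg) * exp (sg * Im z).
Proof.
  intros HF Hsg HM HC0 Hg Hb z Hx Hy. pose proof PI_RGT_0 as Hpi.
  assert (HMe : 0 <= M * exp sg) by (apply Rmult_le_pos; auto; left; apply exp_pos).
  assert (E1 : 1 <= exp (sg * Im z)). { rewrite <- exp_0. apply exp_le. nra. }
  destruct (Rle_lt_dec (Cmod z) 1) as [Hz|Hz].
  { eapply Rle_trans; [apply Hg|]. apply Rle_trans with (M * exp sg); [|nra].
    apply Rmult_le_compat_l; auto. apply exp_le. nra. }
  destruct (polar_quadrant z Hx Hy ltac:(lra)) as (xi & t & Hxi & Ht & ->).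
  set (Cm := C0 + M * exp sg). set (w := cexp (xi, t)) in *.
  assert (HCm : 0 <= Cm) by (unfold Cm; lra).
  set (c0 := cos (3 * PI/8)). assert (Hc0 : 0 < c0) by (apply cos_gt_0; lra).
  assert (key : forall de, 0 < de -> Cmod (F w) * exp (- sg * Im w) <= Cm * exp (de * exp (3/2 * xi))).
  { intros de Hde.
    (* With [w = exp ze], the factor [exp (i sg w)] has modulus [exp (- sg Im w)]. The barrier is
       rotated by [PI/4], so that its angle stays within [3 PI / 8] of 0 and its cosine is at least
       [c0]. *)
    set (g := fun ze : C => (F (cexp ze) * cexp (Ci * RtoC sg * cexp ze) * cexp (RtoC (- de) * cexp (RtoC (3/2) * (ze - Ci * RtoC (PI/4)))))%C).
    assert (Eg : entire g).
    { unfold g. apply entire_mult; [apply entire_mult|].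
      - apply (entire_comp F cexp); auto. apply entire_cexp.
      - apply (entire_comp cexp (fun ze => Ci * RtoC sg * cexp ze)%C); [apply entire_cexp|]. apply entire_mult; [apply entire_const|apply entire_cexp].
      - apply (entire_comp cexp (fun ze => RtoC (- de) * cexp (RtoC (3/2) * (ze - Ci * RtoC (PI/4))))%C); [apply entire_cexp|].
        apply entire_mult; [apply entire_const|].
        apply (entire_comp cexp (fun ze => RtoC (3/2) * (ze - Ci * RtoC (PI/4)))%C); [apply entire_cexp|].
        apply entire_mult; [apply entire_const|]. apply entire_plus; [apply entire_id|apply entire_const]. }
    assert (Mg : forall x y, Cmod (g (x,y)) = Cmod (F (cexp (x,y))) * exp (- sg * (exp x * sin y)) * exp (- de * (exp (3/2 * x) * cos (3/2 * (y - PI/4))))).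
    { intros x y. unfold g. rewrite !Cmod_mult, !(Cmod_cexp (_ * _)%C). f_equal; [f_equal|].
      - f_equal. unfold cexp. simpl. ring.
      - f_equal. rewrite re_scal_l. f_equal.
        replace (RtoC (3/2) * ((x, y) - Ci * RtoC (PI / 4)))%C with ((3/2 * x, 3/2 * (y - PI/4)) : C) by (apply C_eq; simpl; field).
        reflexivity. }
    assert (Hcos : forall y, 0 <= y <= PI/2 -> c0 <= cos (3/2 * (y - PI/4))).
    { intros y Hyy. apply cos_ge_38. apply Rabs_le. lra. }
    assert (Hthird : forall x y, 0 <= y <= PI/2 -> exp (- de * (exp (3/2 * x) * cos (3/2 * (y - PI/4)))) <= exp (- (de * c0 * exp (3/2 * x)))).
    { intros x y Hyy. apply exp_le. specialize (Hcos y Hyy). pose proof (exp_pos (3/2*x)).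
      assert (de * exp (3/2*x) * c0 <= de * exp (3/2*x) * cos (3/2 * (y - PI/4))) by (apply Rmult_le_compat_l; auto; left; apply Rmult_lt_0_compat; auto). lra. }
    assert (Hthird1 : forall x y, 0 <= y <= PI/2 -> exp (- de * (exp (3/2 * x) * cos (3/2 * (y - PI/4)))) <= 1).
    { intros x y Hyy. eapply Rle_trans; [apply Hthird; auto|]. rewrite <- exp_0. apply exp_le.
      assert (0 < de * c0 * exp (3/2*x)) by (repeat apply Rmult_lt_0_compat; auto; apply exp_pos). lra. }
    assert (Hsec : forall x y, 0 <= y <= PI/2 -> exp (- sg * (exp x * sin y)) <= 1).
    { intros x y Hyy. rewrite <- exp_0. apply exp_le. assert (0 <= sin y) by (apply sin_ge_0; lra).
      assert (0 <= sg * (exp x * sin y)) by (apply Rmult_le_pos; [lra|apply Rmult_le_pos; auto; left; apply exp_pos]). lra. }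
    (* Far enough for [exp (3/2 L)] in the barrier to beat the growth [exp L] of the exponent; the
       absolute value keeps [xi] inside the rectangle. *)
    set (L := xi + 2 * Rabs (ln (sg / (de * c0)))).
    assert (HLb : sg * exp L <= de * c0 * exp (3/2 * L)).
    { replace (3/2 * L) with (L + L / 2) by field. rewrite exp_plus.
      assert (Hq : 0 < sg / (de * c0)) by (apply Rdiv_lt_0_compat; auto; apply Rmult_lt_0_compat; auto).
      assert (sg / (de * c0) <= exp (L/2)).
      { rewrite <- (exp_ln (sg / (de*c0))) by auto. apply exp_le. unfold L. pose proof (Rle_abs (ln (sg / (de*c0)))). lra. }
      assert (Hdc : 0 < de * c0) by (apply Rmult_lt_0_compat; auto).
      assert (sg <= de * c0 * exp (L/2)).
      { apply Rmult_le_compat_l with (r := de * c0) in H; [|lra]. replace (de * c0 * (sg / (de*c0))) with sg in H by (field; lra). auto. }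
      pose proof (exp_pos L). nra. }
    assert (HLxi : xi <= L) by (unfold L; pose proof (Rabs_pos (ln (sg / (de*c0)))); lra).
    assert (Hbig : Cmod (g (xi, t)) <= Cm).
    { apply (max_rect g 0 L 0 (PI/2)); auto; try lra.
      intros x y Hxx Hyy Hbd. rewrite Mg.
      pose proof (Hsec x y Hyy) as S2. pose proof (Hthird1 x y Hyy) as S3.
      pose proof (exp_pos (- sg * (exp x * sin y))). pose proof (exp_pos (- de * (exp (3 / 2 * x) * cos (3 / 2 * (y - PI / 4))))).
      pose proof (Cmod_ge_0 (F (cexp (x,y)))).
      assert (Mw : Cmod (cexp (x,y)) = exp x) by (rewrite Cmod_cexp; auto).
      (* The four sides are the unit circle, a large circle where the barrier wins, the real axis
         where [F] is bounded by [C0], and the imaginary axis where [exp (i sg w)] cancels the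
         growth exactly. *)
      destruct Hbd as [-> | [-> | [-> | ->]]].
      - specialize (Hg (cexp (0, y))). rewrite Mw, exp_0, Rmult_1_r in Hg.
        apply Rle_trans with (M * exp sg * 1 * 1); [|unfold Cm; lra].
        apply Rmult_le_compat; try lra; [apply Rmult_le_pos; lra|]. apply Rmult_le_compat; lra.
      - specialize (Hg (cexp (L, y))). rewrite Mw in Hg.
        apply Rle_trans with (M * exp (sg * exp L) * 1 * exp (- (de * c0 * exp (3/2 * L)))).
        + apply Rmult_le_compat; try lra; [apply Rmult_le_pos; lra| |apply Hthird; lra]. apply Rmult_le_compat; lra.
        + rewrite Rmult_1_r, Rmult_assoc, <- exp_plus.
          apply Rle_trans with (M * exp sg); [|unfold Cm; lra]. apply Rmult_le_compat_l; auto. apply exp_le. lra.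
      - replace (cexp (x, 0)) with (RtoC (exp x)) in * by (unfold cexp; simpl; rewrite cos_0, sin_0; apply C_eq; simpl; ring).
        specialize (Hb (exp x) ltac:(left; apply exp_pos)).
        apply Rle_trans with (C0 * 1 * 1); [|unfold Cm; lra].
        apply Rmult_le_compat; try lra; [apply Rmult_le_pos; lra|]. apply Rmult_le_compat; lra.
      - specialize (Hg (cexp (x, PI/2))). rewrite Mw in Hg. rewrite sin_PI2 in *.
        apply Rle_trans with (M * 1); [|assert (1 <= exp sg) by (rewrite <- exp_0; apply exp_le; lra); unfold Cm; nra].
        apply Rmult_le_compat; try lra; [apply Rmult_le_pos; lra|].
        apply Rle_trans with (M * exp (sg * exp x) * exp (- sg * (exp x * 1))); [apply Rmult_le_compat_r; lra|].
        rewrite Rmult_assoc, <- exp_plus. replace (sg * exp x + - sg * (exp x * 1)) with 0 by ring. rewrite exp_0. lra. }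
    rewrite Mg in Hbig. change (cexp (xi,t)) with w in Hbig. change (exp xi * sin t) with (Im w) in Hbig.
    apply Rle_trans with (Cm * exp (de * (exp (3/2 * xi) * cos (3/2 * (t - PI/4))))).
    - set (Y := de * (exp (3/2 * xi) * cos (3/2 * (t - PI/4)))) in *.
      replace (- de * (exp (3/2 * xi) * cos (3/2 * (t - PI/4)))) with (- Y) in Hbig by (unfold Y; ring).
      apply Rmult_le_compat_r with (r := exp Y) in Hbig; [|left; apply exp_pos].
      rewrite Rmult_assoc, <- exp_plus, Rplus_opp_l, exp_0, Rmult_1_r in Hbig. exact Hbig.
    - apply Rmult_le_compat_l; auto. apply exp_le. apply Rmult_le_compat_l; [lra|].
      pose proof (exp_pos (3/2*xi)). pose proof (COS_bound (3/2 * (t - PI/4))). nra. }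
  apply Rmult_le_reg_r with (exp (- sg * Im w)); [apply exp_pos|].
  rewrite Rmult_assoc, <- exp_plus. replace (sg * Im w + - sg * Im w) with 0 by ring. rewrite exp_0, Rmult_1_r.
  apply le_epsilon. intros e He.
  set (A := exp (3/2*xi)) in *. assert (HA : 0 < A) by apply exp_pos.
  (* Taking [de = q / A] makes the barrier cost the factor [1 + e / (Cm + 1)], hence at most [e]. *)
  set (q := ln (1 + e / (Cm + 1))).
  assert (He2 : 0 < e / (Cm+1)) by (apply Rdiv_lt_0_compat; lra).
  assert (Hq : 0 < q) by (unfold q; rewrite <- ln_1; apply ln_increasing; lra).
  specialize (key (q / A) ltac:(apply Rdiv_lt_0_compat; auto)).
  replace (q / A * A) with q in key by (field; lra). unfold q in key. rewrite exp_ln in key by lra.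
  eapply Rle_trans; [apply key|].
  assert (Cm * (e / (Cm+1)) <= e).
  { apply Rmult_le_reg_r with (Cm+1); [lra|]. replace (Cm * (e / (Cm + 1)) * (Cm + 1)) with (Cm * e) by (field; lra). nra. }
  lra.
Qed.

(** Conjugation carries the first quadrant to the right half plane, and [w -> - w] carries that to
    the left one; all hypotheses are stable under both. *)
Lemma phragmen_lindelof F sg M C0 : entire F -> 0 < sg -> 0 <= M -> 0 <= C0 ->
  (forall z, Cmod (F z) <= M * exp (sg * Cmod z)) -> (forall x, Cmod (F (RtoC x)) <= C0) ->
  (forall z, Cmod (F (Cconj z)) = Cmod (F z)) ->
  forall z, Cmod (F z) <= (C0 + M * exp sg) * exp (sg * Rabs (Im z)).
Proof.
  intros HF Hsg HM HC0 Hg Hb Hc.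
  assert (Q : forall G, entire G -> (forall z, Cmod (G z) <= M * exp (sg * Cmod z)) -> (forall x, Cmod (G (RtoC x)) <= C0) ->
    (forall z, Cmod (G (Cconj z)) = Cmod (G z)) -> forall z, 0 <= Re z -> Cmod (G z) <= (C0 + M * exp sg) * exp (sg * Rabs (Im z))).
  { intros G EG Gg Gb Gc z Hz. destruct (Rle_lt_dec 0 (Im z)) as [Hi|Hi].
    - rewrite Rabs_right by lra. apply PL_quadrant; auto.
    - rewrite Rabs_left by lra. rewrite <- Gc. rewrite <- im_conj. apply PL_quadrant; auto.
      rewrite im_conj. lra. }
  intros z. destruct (Rle_lt_dec 0 (Re z)) as [Hz|Hz]; [apply Q; auto|].
  replace (F z) with ((fun w => F (- w)%C) (- z)%C) by (simpl; f_equal; ring).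
  replace (Rabs (Im z)) with (Rabs (Im (- z)%C)) by (rewrite im_opp, Rabs_Ropp; auto).
  apply (Q (fun w => F (- w)%C)).
  - apply (entire_comp F (fun w => - w)%C); auto.
    apply entire_cder. intros w. exists (- RtoC 1)%C. intros e He. exists 1. split; [lra|]. intros v _.
    replace (- v - - w - - RtoC 1 * (v - w))%C with (RtoC 0) by ring. rewrite Cmod_0. pose proof (Cmod_ge_0 (v - w)%C). nra.
  - intros w. rewrite <- (Cmod_opp w). auto.
  - intros x. rewrite <- RtoC_opp. auto.
  - intros w. rewrite <- Copp_conj. auto.
  - rewrite re_opp. lra.
Qed.

(** * Power series of exponential type *)

(* The Taylor coefficients of an entire function of exponential type less than [s] satisfy this. *)
Definition coef_type (s : R) (a : nat -> C) := exists K, 0 <= K /\ forall n, Cmod (a n) * INR (fact n) <= K * s ^ n.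

Definition cpseries (a : nat -> C) (z : C) : C :=
  (Series (fun n => Re (a n * z ^ n)%C), Series (fun n => Im (a n * z ^ n)%C)).

Lemma fact_pos n : 0 < INR (fact n).
Proof. apply lt_0_INR, lt_O_fact. Qed.

Lemma exp_is_series x : is_series (fun n => x ^ n / INR (fact n)) (exp x).
Proof.
  eapply is_series_ext; [|apply is_series_to_pseries, is_exp_Reals]. intros n. simpl. unfold Rdiv. ring.
Qed.

Lemma is_series_Rscal (c : R) u l : is_series u l -> is_series (fun n => c * u n) (c * l).
Proof. intros H. exact (is_series_scal (V := R_NormedModule) c u l H). Qed.

Lemma is_series_Rplus u v l m : is_series u l -> is_series v m -> is_series (fun n => u n + v n) (l + m).
Proof. intros H1 H2. exact (is_series_plus (V := R_NormedModule) u v l m H1 H2). Qed.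

Lemma is_series_Rminus u v l m : is_series u l -> is_series v m -> is_series (fun n => u n - v n) (l - m).
Proof. intros H1 H2. exact (is_series_minus (V := R_NormedModule) u v l m H1 H2). Qed.

Lemma is_series_shift0 (u : nat -> R) l : u 0%nat = 0 -> is_series (fun n => u (S n)) l -> is_series u l.
Proof.
  intros H0 H. apply is_series_decr_1.
  cut (is_series (fun k => u (S k)) (l + - u 0%nat)); [intros X; exact X|].
  rewrite H0, Ropp_0, Rplus_0_r. exact H.
Qed.

Lemma coef_type_term a s K n r : 0 <= r -> (forall n, Cmod (a n) * INR (fact n) <= K * s ^ n) ->
  Cmod (a n) * r ^ n <= K * ((s * r) ^ n / INR (fact n)).
Proof.
  intros Hr H. pose proof (fact_pos n). apply Rmult_le_reg_r with (INR (fact n)); auto.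
  replace (K * ((s * r) ^ n / INR (fact n)) * INR (fact n)) with ((K * s ^ n) * r ^ n) by (rewrite Rpow_mult_distr; field; lra).
  replace (Cmod (a n) * r ^ n * INR (fact n)) with (Cmod (a n) * INR (fact n) * r ^ n) by ring.
  apply Rmult_le_compat_r; auto. apply pow_le; auto.
Qed.

Lemma series_dom (u v : nat -> R) l : (forall n, Rabs (u n) <= v n) -> is_series v l -> ex_series u /\ Rabs (Series u) <= l.
Proof.
  intros H Hv.
  assert (E : ex_series (fun n => Rabs (u n))).
  { apply (ex_series_le (V := R_CompleteNormedModule) _ v); [|exists l; auto]. intros n. unfold norm; simpl. unfold abs; simpl. rewrite Rabs_Rabsolu. auto. }
  split.
  - apply ex_series_Rabs; auto.
  - eapply Rle_trans; [apply Series_Rabs; auto|]. rewrite <- (is_series_unique _ _ Hv). apply Series_le; [|exists l; auto].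
    intros n. split; [apply Rabs_pos|auto].
Qed.

Lemma cseries_dom (f : nat -> C) v l : (forall n, Cmod (f n) <= v n) -> is_series v l ->
  ex_series (fun n => Re (f n)) /\ ex_series (fun n => Im (f n)) /\
  Cmod (Series (fun n => Re (f n)), Series (fun n => Im (f n))) <= 2 * l.
Proof.
  intros H Hv.
  destruct (series_dom (fun n => Re (f n)) v l) as [E1 B1]; auto.
  { intros n. eapply Rle_trans; [apply re_le_Cmod|auto]. }
  destruct (series_dom (fun n => Im (f n)) v l) as [E2 B2]; auto.
  { intros n. eapply Rle_trans; [apply im_le_Cmod|auto]. }
  split; auto. split; auto. eapply Rle_trans; [apply Cmod_le_Re_Im|]. simpl. lra.
Qed.

Lemma coef_type_series a s K z : (forall n, Cmod (a n) * INR (fact n) <= K * s ^ n) ->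
  is_cpseries a z (cpseries a z) /\ Cmod (cpseries a z) <= 2 * K * exp (s * Cmod z).
Proof.
  intros H.
  assert (HS : is_series (fun n => K * ((s * Cmod z) ^ n / INR (fact n))) (K * exp (s * Cmod z))).
  { apply is_series_Rscal. apply exp_is_series. }
  assert (HD : forall n, Cmod (a n * z ^ n)%C <= K * ((s * Cmod z) ^ n / INR (fact n))).
  { intros n. rewrite Cmod_mult, Cmod_pow. apply coef_type_term; auto. apply Cmod_ge_0. }
  destruct (cseries_dom _ _ _ HD HS) as (E1 & E2 & B).
  split; [split; apply Series_correct; auto|]. unfold cpseries. lra.
Qed.

Lemma pow_err (z w : C) rho n : 1 <= rho -> Cmod z <= rho -> Cmod w <= rho ->
  Cmod (w ^ n - z ^ n - RtoC (INR n) * z ^ (pred n) * (w - z))%C <= INR n ^ 2 * rho ^ n * Cmod (w - z)%C ^ 2.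
Proof.
  intros Hr Hz Hw. induction n.
  - simpl. replace (1 - 1 - RtoC 0 * 1 * (w - z))%C with (RtoC 0) by ring. rewrite Cmod_0. lra.
  - set (h := (w - z)%C) in *.
    replace (w ^ S n - z ^ S n - RtoC (INR (S n)) * z ^ pred (S n) * h)%C with
      (w * (w ^ n - z ^ n - RtoC (INR n) * z ^ pred n * h) + RtoC (INR n) * z ^ pred n * (h * h))%C.
    2:{ rewrite S_INR, RtoC_plus, !Cpow_S. unfold h. simpl pred. destruct n; [simpl; ring|]. simpl pred. rewrite !Cpow_S. ring. }
    eapply Rle_trans; [apply Cmod_triangle|]. rewrite !Cmod_mult, Cmod_R, Cmod_pow, (Rabs_right (INR n)) by (apply Rle_ge, pos_INR).
    assert (P1 : Cmod z ^ pred n <= rho ^ S n).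
    { apply Rle_trans with (rho ^ pred n); [apply pow_incr; split; auto; apply Cmod_ge_0|]. apply Rle_pow; auto. lia. }
    pose proof (pos_INR n). pose proof (Cmod_ge_0 h). pose proof (Cmod_ge_0 w).
    assert (P2 : Cmod w * Cmod (w ^ n - z ^ n - RtoC (INR n) * z ^ pred n * h)%C <= rho * (INR n ^ 2 * rho ^ n * Cmod h ^ 2)).
    { apply Rmult_le_compat; auto. apply Cmod_ge_0. }
    assert (P3 : INR n * Cmod z ^ pred n * (Cmod h * Cmod h) <= INR n * rho ^ S n * (Cmod h * Cmod h)).
    { apply Rmult_le_compat_r; [nra|]. apply Rmult_le_compat_l; auto. }
    rewrite S_INR. assert (0 <= rho ^ S n) by (apply pow_le; lra). change (rho ^ S n) with (rho * rho ^ n) in *.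
    assert (0 <= rho * rho ^ n * Cmod h ^ 2) by (apply Rmult_le_pos; auto; apply pow2_ge_0). nra.
Qed.

Lemma n_le_pow2 n : INR n <= 2 ^ n.
Proof.
  induction n; [simpl; lra|]. rewrite S_INR. simpl. pose proof (pow_R1_Rle 2 n ltac:(lra)). lra.
Qed.

Definition dcoef (a : nat -> C) (n : nat) : C := (RtoC (INR (S n)) * a (S n))%C.

Lemma coef_type_dcoef a s : 0 < s -> coef_type s a -> coef_type s (dcoef a).
Proof.
  intros Hs [K [HK H]]. exists (K * s). split; [nra|]. intros n. unfold dcoef.
  rewrite Cmod_mult, Cmod_R, Rabs_right by (apply Rle_ge, pos_INR). specialize (H (S n)). rewrite fact_simpl, mult_INR in H. simpl pow in H. lra.
Qed.

(** Linearising each power costs [n^2 rho^n |w - z|^2], and these costs are summable against the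
    coefficients, so the error of termwise differentiation is quadratic in [w - z]. *)
Lemma cpseries_cder a s z : 0 < s -> coef_type s a -> cder (cpseries a) z (cpseries (dcoef a) z).
Proof.
  intros Hs Ha. destruct (coef_type_dcoef a s Hs Ha) as [K' [HK' H']]. destruct Ha as [K [HK H]].
  set (rho := Cmod z + 1). pose proof (Cmod_ge_0 z).
  (* The 4 comes from [n^2 <= 4^n], which turns the sum of the costs into an exponential series at
     [4 rho]. *)
  set (B := K * exp (4 * s * rho)).
  assert (HB : 0 <= B) by (apply Rmult_le_pos; auto; left; apply exp_pos).
  assert (HS : is_series (fun n => Cmod (a n) * INR n ^ 2 * rho ^ n) (Series (fun n => Cmod (a n) * INR n ^ 2 * rho ^ n)) /\ Series (fun n => Cmod (a n) * INR n ^ 2 * rho ^ n) <= B).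
  { destruct (series_dom (fun n => Cmod (a n) * INR n ^ 2 * rho ^ n) (fun n => K * ((4 * s * rho) ^ n / INR (fact n))) B) as [E1 B1].
    - intros n. assert (0 <= rho) by (unfold rho; lra).
      rewrite Rabs_right by (apply Rle_ge; repeat apply Rmult_le_pos; try apply Cmod_ge_0; try apply pos_INR; try apply pow_le; auto; lra).
      replace (4 * s * rho) with (s * (4 * rho)) by ring.
      eapply Rle_trans; [|apply (coef_type_term a s K n (4*rho)); auto; lra].
      rewrite Rmult_assoc. apply Rmult_le_compat_l; [apply Cmod_ge_0|]. rewrite Rpow_mult_distr.
      apply Rmult_le_compat_r; [apply pow_le; auto|]. replace 4 with (2^2) by ring. rewrite <- pow_mult, Nat.mul_comm, pow_mult.
      apply pow_incr. split; [apply pos_INR|apply n_le_pow2].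
    - unfold B. apply is_series_Rscal. apply exp_is_series.
    - split; [apply Series_correct; auto|]. eapply Rle_trans; [apply Rle_abs|]; auto. }
  destruct HS as [HS HSB]. set (Sg := Series (fun n => Cmod (a n) * INR n ^ 2 * rho ^ n)) in *.
  assert (main : forall w, Cmod (w - z)%C < 1 -> Cmod (cpseries a w - cpseries a z - cpseries (dcoef a) z * (w - z))%C <= 2 * B * Cmod (w - z)%C ^ 2).
  { intros w Hw. set (h := (w - z)%C) in *.
    assert (Hwr : Cmod w <= rho). { replace w with (h + z)%C by (unfold h; ring). eapply Rle_trans; [apply Cmod_triangle|]. unfold rho; lra. }
    destruct (coef_type_series a s K w H) as [[Rw Iw] _]. destruct (coef_type_series a s K z H) as [[Rz Iz] _].
    destruct (coef_type_series (dcoef a) s K' z H') as [[Rd Id] _].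
    set (f := fun n => (a n * (w ^ n - z ^ n - RtoC (INR n) * z ^ pred n * h))%C).
    assert (Rd' : is_series (fun n => Re (a n * (RtoC (INR n) * z ^ pred n))%C) (Re (cpseries (dcoef a) z))).
    { apply is_series_shift0; [simpl; ring|].
      eapply is_series_ext; [|apply Rd]. intros n. apply (f_equal Re). unfold dcoef. simpl pred. ring. }
    assert (Id' : is_series (fun n => Im (a n * (RtoC (INR n) * z ^ pred n))%C) (Im (cpseries (dcoef a) z))).
    { apply is_series_shift0; [simpl; ring|].
      eapply is_series_ext; [|apply Id]. intros n. apply (f_equal Im). unfold dcoef. simpl pred. ring. }
    assert (Sr : is_series (fun n => Re (f n)) (Re (cpseries a w - cpseries a z - cpseries (dcoef a) z * h)%C)).
    { replace (Re (cpseries a w - cpseries a z - cpseries (dcoef a) z * h)%C) with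
       ((Re (cpseries a w) - Re (cpseries a z)) - (Re h * Re (cpseries (dcoef a) z) - Im h * Im (cpseries (dcoef a) z))) by (simpl; ring).
      eapply is_series_ext; [|apply is_series_Rminus; [apply is_series_Rminus; [apply Rw|apply Rz]|
        apply is_series_Rminus; [apply (is_series_Rscal (Re h)); apply Rd'|apply (is_series_Rscal (Im h)); apply Id']]].
      intros n. unfold f. set (q := (RtoC (INR n) * z ^ pred n)%C). rewrite !re_mult, !im_mult. unfold Cminus.
      rewrite !re_plus, !im_plus, !re_opp, !im_opp, !re_mult, !im_mult.
      as_R_eq. ring. }
    assert (Si : is_series (fun n => Im (f n)) (Im (cpseries a w - cpseries a z - cpseries (dcoef a) z * h)%C)).
    { replace (Im (cpseries a w - cpseries a z - cpseries (dcoef a) z * h)%C) with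
       ((Im (cpseries a w) - Im (cpseries a z)) - (Im h * Re (cpseries (dcoef a) z) + Re h * Im (cpseries (dcoef a) z))) by (simpl; ring).
      eapply is_series_ext; [|apply is_series_Rminus; [apply is_series_Rminus; [apply Iw|apply Iz]|
        apply is_series_Rplus; [apply (is_series_Rscal (Im h)); apply Rd'|apply (is_series_Rscal (Re h)); apply Id']]].
      intros n. unfold f. set (q := (RtoC (INR n) * z ^ pred n)%C). rewrite !re_mult, !im_mult. unfold Cminus.
      rewrite !re_plus, !im_plus, !re_opp, !im_opp, !re_mult, !im_mult.
      as_R_eq. ring. }
    assert (HSh : is_series (fun n => Cmod h ^ 2 * (Cmod (a n) * INR n ^ 2 * rho ^ n)) (Cmod h ^ 2 * Sg)) by (apply is_series_Rscal; auto).
    assert (HD : forall n, Cmod (f n) <= Cmod h ^ 2 * (Cmod (a n) * INR n ^ 2 * rho ^ n)).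
    { intros n. unfold f. rewrite Cmod_mult. 
      pose proof (pow_err z w rho n ltac:(unfold rho; lra) ltac:(unfold rho; lra) Hwr) as PE. fold h in PE.
      apply Rmult_le_compat_l with (r := Cmod (a n)) in PE; [|apply Cmod_ge_0]. lra. }
    destruct (cseries_dom _ _ _ HD HSh) as (_ & _ & Bd).
    rewrite (is_series_unique _ _ Sr), (is_series_unique _ _ Si) in Bd.
    rewrite <- surjective_pairing in Bd.
    eapply Rle_trans; [apply Bd|]. pose proof (pow2_ge_0 (Cmod h)). nra. }
  intros e He. exists (Rmin 1 (e / (2 * B + 1))). split; [apply Rmin_pos; [lra|apply Rdiv_lt_0_compat; lra]|].
  intros w Hw. pose proof (Rmin_l 1 (e / (2 * B + 1))). pose proof (Rmin_r 1 (e / (2*B+1))).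
  eapply Rle_trans; [apply main; lra|]. pose proof (Cmod_ge_0 (w - z)%C).
  assert ((2 * B + 1) * Cmod (w - z)%C <= e).
  { apply Rmult_le_reg_r with (/ (2*B+1)); [apply Rinv_0_lt_compat; lra|].
    replace ((2 * B + 1) * Cmod (w - z)%C * / (2 * B + 1)) with (Cmod (w - z)%C) by (field; lra). unfold Rdiv in *. lra. }
  nra.
Qed.

Lemma cpseries_entire a s : 0 < s -> coef_type s a -> entire (cpseries a).
Proof. intros Hs Ha. apply entire_cder. intros z. eexists. eapply cpseries_cder; eauto. Qed.

Lemma cpseries_exp_type a tau : 0 < tau -> (forall e, 0 < e -> coef_type (tau + e) a) -> exp_type_le (cpseries a) tau.
Proof.
  intros Ht H e He. destruct (H e He) as [K [HK HH]]. exists (2 * K). intros z. apply (coef_type_series a _ K); auto.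
Qed.

(** * Bernstein's inequality *)

Lemma exp_pow x n : exp x ^ n = exp (INR n * x).
Proof.
  induction n.
  - simpl. rewrite Rmult_0_l, exp_0. auto.
  - rewrite S_INR. simpl. rewrite IHn, <- exp_plus. f_equal. ring.
Qed.

(** An elementary half of Stirling's formula. The induction step is [exp 1 <= ((k+1)/k)^(k+1)], a
    consequence of [1 - y <= exp (-y)] at [y = 1/(k+1)]. *)
Lemma fact_stirling n : INR (fact (S n)) * exp (INR (S n)) <= 3 * INR (S n) * INR (S n) ^ (S n).
Proof.
  induction n.
  - simpl. rewrite !Rmult_1_r, Rmult_1_l. apply exp_le_3.
  - set (k := INR (S n)) in *. assert (Hk : 0 < k) by (apply lt_0_INR; lia).
    assert (Ek : INR (S (S n)) = k + 1) by (unfold k; rewrite (S_INR (S n)); auto).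
    rewrite fact_simpl, mult_INR, Ek, exp_plus.
    assert (He : exp 1 * k ^ (S (S n)) <= (k+1) ^ (S (S n))).
    { assert (exp 1 <= ((k+1)/k) ^ (S (S n))).
      { replace 1 with (INR (S (S n)) * (1 / (k+1))) at 1 by (rewrite Ek; field; lra). rewrite <- exp_pow.
        apply pow_incr. split; [left; apply exp_pos|].
        pose proof (exp_ineq1_le (- (1 / (k+1)))) as H1. rewrite exp_Ropp in H1.
        replace (1 + - (1/(k+1))) with (k / (k+1)) in H1 by (field; lra).
        pose proof (exp_pos (1/(k+1))) as H2.
        apply Rmult_le_reg_r with (/ exp (1/(k+1)) * (k/(k+1)) ); [apply Rmult_lt_0_compat; [apply Rinv_0_lt_compat; auto|apply Rdiv_lt_0_compat; lra]|].
        replace (exp (1 / (k + 1)) * (/ exp (1 / (k + 1)) * (k / (k + 1)))) with (k/(k+1)) by (field; split; lra).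
        replace ((k + 1) / k * (/ exp (1 / (k + 1)) * (k / (k + 1)))) with (/ exp (1/(k+1))) by (field; split; [lra|split; lra]). auto. }
      apply Rmult_le_compat_r with (r := k ^ S (S n)) in H; [|apply pow_le; lra].
      rewrite <- Rpow_mult_distr in H. replace ((k+1)/k*k) with (k+1) in H by (field; lra). auto. }
    apply Rle_trans with ((k+1) * (exp 1 * (3 * k * k ^ S n))).
    + replace ((k + 1) * INR (fact (S n)) * (exp k * exp 1)) with ((k+1) * (exp 1 * (INR (fact (S n)) * exp k))) by ring.
      apply Rmult_le_compat_l; [lra|]. apply Rmult_le_compat_l; [left; apply exp_pos|]. auto.
    + replace ((k + 1) * (exp 1 * (3 * k * k ^ S n))) with (3 * (k+1) * (exp 1 * k ^ S (S n))) by (simpl; ring).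
      apply Rmult_le_compat_l; [lra|]. auto.
Qed.

(** Cauchy's estimate at the optimal radius [n / sg], where [exp (sg r) / r^n] is smallest, or at
    [1 / sg] when [n = 0]. Stirling leaves a loss of order [n], which [lin_geom] absorbs into a
    slightly larger type. *)
Lemma cauchy_fact A M sg n : 0 < sg -> 0 <= M -> (forall r, 0 < r -> A <= M * exp (sg * r) / r ^ n) ->
  A * INR (fact n) <= 3 * M * (INR n + 1) * sg ^ n.
Proof.
  intros Hs HM H. destruct n.
  - simpl. rewrite !Rmult_1_r, Rplus_0_l, Rmult_1_r.
    specialize (H (1/(sg)) ltac:(apply Rdiv_lt_0_compat; lra)). simpl in H. replace (sg * (1/sg)) with 1 in H by (field; lra).
    pose proof exp_le_3. pose proof (exp_pos 1). unfold Rdiv in H. rewrite Rinv_1, Rmult_1_r in H. nra.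
  - set (k := INR (S n)) in *. assert (Hk : 0 < k) by (apply lt_0_INR; lia).
    specialize (H (k / sg) ltac:(apply Rdiv_lt_0_compat; lra)). replace (sg * (k/sg)) with k in H by (field; lra).
    pose proof (fact_pos (S n)). pose proof (fact_stirling n) as HF. fold k in HF.
    assert (0 < (k/sg)^(S n)) by (apply pow_lt, Rdiv_lt_0_compat; lra).
    assert (0 < k ^ S n) by (apply pow_lt; auto). assert (0 < sg ^ S n) by (apply pow_lt; auto).
    apply Rle_trans with (M * exp k / (k / sg) ^ S n * INR (fact (S n))); [apply Rmult_le_compat_r; lra|].
    replace (M * exp k / (k / sg) ^ S n * INR (fact (S n))) with (M * sg ^ S n / k ^ S n * (INR (fact (S n)) * exp k)).
    2:{ unfold Rdiv at 3. rewrite Rpow_mult_distr, pow_inv. field. split; lra. }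
    apply Rle_trans with (M * sg ^ S n / k ^ S n * (3 * k * k ^ S n)).
    + apply Rmult_le_compat_l; auto. apply Rdiv_le_0_compat; auto. nra.
    + replace (M * sg ^ S n / k ^ S n * (3 * k * k ^ S n)) with (3 * M * k * sg ^ S n) by (field; lra).
      apply Rmult_le_compat_r; [lra|]. nra.
Qed.

(** Bernoulli's inequality for the ratio [s'/s = 1 + x]. *)
Lemma lin_geom s s' : 0 < s < s' -> exists K, 0 < K /\ forall n, (INR n + 1) * s ^ n <= K * s' ^ n.
Proof.
  intros Hs. set (x := s'/s - 1). assert (Hx : 0 < x).
  { unfold x. apply Rplus_lt_reg_r with 1. apply Rmult_lt_reg_r with s; [lra|]. replace ((s'/s - 1 + 1) * s) with s' by (field; lra). lra. }
  exists (1 + 1/x). split; [assert (0 < 1/x) by (apply Rdiv_lt_0_compat; lra); lra|].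
  intros n. pose proof (poly n x Hx) as HP. replace (1 + x) with (s'/s) in HP by (unfold x; ring).
  assert (0 < s^n) by (apply pow_lt; lra). pose proof (pos_INR n).
  replace (s' ^ n) with ((s'/s)^n * s^n) by (rewrite <- Rpow_mult_distr; f_equal; field; lra).
  rewrite <- Rmult_assoc. apply Rmult_le_compat_r; [lra|].
  assert (0 < 1/x) by (apply Rdiv_lt_0_compat; lra).
  apply Rle_trans with ((1 + 1/x) * (1 + INR n * x)); [|apply Rmult_le_compat_l; lra].
  replace ((1 + 1 / x) * (1 + INR n * x)) with (1 + 1/x + INR n * x + INR n) by (field; lra). nra.
Qed.

Lemma exp_type_coef F tau : 0 < tau -> entire F -> exp_type_le F tau ->
  exists a, (forall z, is_cpseries a z (F z)) /\ forall e, 0 < e -> coef_type (tau + e) a.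
Proof.
  intros Ht HF HE. destruct (entire_taylor F HF) as (a & Ha & Hb & _). exists a. split; auto.
  intros e He. destruct (HE (e/2) ltac:(lra)) as [M HM].
  assert (HM0 : 0 <= M).
  { specialize (HM (RtoC 0)). rewrite Cmod_0, Rmult_0_r, exp_0, Rmult_1_r in HM. pose proof (Cmod_ge_0 (F (RtoC 0))). lra. }
  destruct (lin_geom (tau + e/2) (tau + e) ltac:(lra)) as [K [HK HL]].
  exists (3 * M * K). split; [nra|]. intros n.
  eapply Rle_trans; [apply (cauchy_fact _ M (tau + e/2)); auto; [lra|]|].
  - intros r Hr. apply Hb; auto. intros z Hz. rewrite <- Hz. apply HM.
  - rewrite Rmult_assoc. specialize (HL n). replace (3 * M * K * (tau + e)^n) with (3 * M * (K * (tau+e)^n)) by ring.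
    apply Rmult_le_compat_l; [lra|]. auto.
Qed.

(** * Real power series of exponential type *)

Definition rcoef_type (s : R) (a : nat -> R) := exists K, 0 <= K /\ forall n, Rabs (a n) * INR (fact n) <= K * s ^ n.

Lemma rcoef_type_coef_type s a : rcoef_type s a -> coef_type s (fun n => RtoC (a n)).
Proof. intros [K [HK H]]. exists K. split; auto. intros n. rewrite Cmod_R. auto. Qed.

Lemma rcoef_type_radius s a : rcoef_type s a -> forall x, Rbar_lt (Rabs x) (CV_radius a).
Proof.
  intros Ha x. destruct (rcoef_type_coef_type _ _ Ha) as [K [HK H]].
  destruct (coef_type_series _ s K (RtoC (Rabs x + 1)) H) as [Hc _]. apply is_cpseries_real in Hc. destruct Hc as [Hc _]. simpl in Hc.
  apply ex_pseries_radius in Hc. eapply Rbar_lt_le_trans; [|apply Hc]. simpl.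
  pose proof (Rle_abs (Rabs x + 1)). lra.
Qed.

Lemma rcoef_type_ex s a x : rcoef_type s a -> ex_pseries a x.
Proof. intros Ha. apply CV_radius_inside. eapply rcoef_type_radius; eauto. Qed.

Lemma cpseries_real s a x : rcoef_type s a -> cpseries (fun n => RtoC (a n)) (RtoC x) = RtoC (PSeries a x).
Proof.
  intros Ha. destruct (rcoef_type_coef_type _ _ Ha) as [K [HK H]].
  destruct (coef_type_series _ s K (RtoC x) H) as [Hc _]. apply is_cpseries_real in Hc. destruct Hc as [H1 H2].
  apply C_eq.
  - symmetry. exact (is_pseries_unique _ _ _ H1).
  - rewrite <- (is_pseries_unique _ _ _ H2). exact (PSeries_const_0 x).
Qed.

Lemma cpseries_conj a z : cpseries (fun n => RtoC (a n)) (Cconj z) = Cconj (cpseries (fun n => RtoC (a n)) z).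
Proof.
  unfold cpseries. apply C_eq; simpl.
  - apply Series_ext. intros n. rewrite <- Cpow_conj. simpl. ring.
  - rewrite <- Series_opp. apply Series_ext. intros n. rewrite <- Cpow_conj. simpl. ring.
Qed.

Lemma rcoef_type_is_derive s a x : rcoef_type s a -> is_derive (PSeries a) x (PSeries (PS_derive a) x).
Proof. intros Ha. apply is_derive_PSeries. eapply rcoef_type_radius; eauto. Qed.

Lemma rcoef_type_continuous s a x : rcoef_type s a -> continuous (PSeries a) x.
Proof. intros Ha. apply continuity_pt_filterlim, PSeries_continuity. eapply rcoef_type_radius; eauto. Qed.

Lemma fact_le_add n k : INR (fact n) * INR (fact k) <= INR (fact (n + k)).
Proof.
  rewrite <- mult_INR. apply le_INR. induction k.
  - rewrite Nat.add_0_r. simpl. lia.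
  - rewrite Nat.add_succ_r, !fact_simpl.
    apply Nat.le_trans with (S k * (fact n * fact k))%nat; [lia|]. apply Nat.mul_le_mono; lia.
Qed.

(* Synthetic division: the quotient has coefficients [b_n = sum_k a_(n+1+k) c^k]. *)
Lemma rcoef_type_divide s a c : 0 < s -> rcoef_type s a -> PSeries a c = 0 ->
  exists b, (forall s', 0 < s' -> rcoef_type s' a -> rcoef_type s' b) /\ forall x, PSeries a x = (x - c) * PSeries b x.
Proof.
  intros Hs Ha H0.
  assert (Hsh : forall s', 0 < s' -> rcoef_type s' a -> forall n, rcoef_type s' (PS_decr_n a n)).
  { intros s' Hs' [K [HK H]] n. exists (K * s'^n). split; [apply Rmult_le_pos; auto; apply pow_le; lra|].
    intros k. unfold PS_decr_n. rewrite Rmult_assoc, <- pow_add. eapply Rle_trans; [|apply H].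
    apply Rmult_le_compat_l; [apply Rabs_pos|]. apply le_INR. apply fact_le. lia. }
  exists (fun n => PSeries (PS_decr_n a (S n)) c).
  (* Since [n! k! <= (n+1+k)!], the bound for the tail sum separates into a power of [s'] over [n!]
     and an exponential series in [s' |c|]. The same quotient works for every [s'], so the
     exponential type is not degraded. *)
  assert (Hb : forall s', 0 < s' -> rcoef_type s' a -> rcoef_type s' (fun n => PSeries (PS_decr_n a (S n)) c)).
  { intros s' Hs' [K [HK H]]. exists (K * s' * exp (s' * Rabs c)). split.
    { repeat apply Rmult_le_pos; auto; try lra. left; apply exp_pos. }
    intros n. unfold PSeries.
    destruct (series_dom (fun k => PS_decr_n a (S n) k * c ^ k) (fun k => K * s' ^ (S n) / INR (fact n) * ((s' * Rabs c) ^ k / INR (fact k))) (K * s' ^ (S n) / INR (fact n) * exp (s' * Rabs c))) as [_ B1].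
    - intros k. unfold PS_decr_n. rewrite Rabs_mult, <- RPow_abs.
      pose proof (fact_pos n). pose proof (fact_pos k). pose proof (fact_pos (S n + k)).
      specialize (H (S n + k)%nat). pose proof (fact_le_add n k). assert (INR (fact (n + k)) <= INR (fact (S n + k))) by (apply le_INR, fact_le; lia).
      rewrite Rpow_mult_distr.
      replace (K * s' ^ S n / INR (fact n) * (s' ^ k * Rabs c ^ k / INR (fact k))) with ((K * s' ^ (S n + k) / (INR (fact n) * INR (fact k))) * Rabs c ^ k) by (rewrite pow_add; field; split; lra).
      apply Rmult_le_compat_r; [apply pow_le, Rabs_pos|].
      assert (0 < INR (fact n) * INR (fact k)) by (apply Rmult_lt_0_compat; auto).
      apply Rmult_le_reg_r with (INR (fact n) * INR (fact k)); auto.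
      replace (K * s' ^ (S n + k) / (INR (fact n) * INR (fact k)) * (INR (fact n) * INR (fact k))) with (K * s' ^ (S n + k)) by (field; split; lra).
      eapply Rle_trans; [|apply H]. apply Rmult_le_compat_l; [apply Rabs_pos|]. lra.
    - apply is_series_Rscal, exp_is_series.
    - pose proof (fact_pos n). apply Rmult_le_compat_r with (r := INR (fact n)) in B1; [|lra].
      eapply Rle_trans; [apply B1|]. right. simpl. field. lra. }
  split; auto.
  assert (Hrec : forall n, PSeries (PS_decr_n a n) c = a n + c * PSeries (PS_decr_n a (S n)) c).
  { intros n. rewrite (PSeries_decr_1 (PS_decr_n a n)) by (apply (rcoef_type_ex s); auto).
    unfold PS_decr_n at 1. rewrite Nat.add_0_r. f_equal. f_equal. apply PSeries_ext. intros k. unfold PS_decr_1, PS_decr_n. f_equal. lia. }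
  set (b := fun n => PSeries (PS_decr_n a (S n)) c) in *.
  intros x. rewrite (PSeries_ext a (PS_plus (PS_incr_1 b) (PS_scal (- c) b))).
  - rewrite PSeries_plus, PSeries_incr_1, PSeries_scal; [ring| |].
    + apply ex_pseries_incr_1. apply (rcoef_type_ex s); auto.
    + apply ex_pseries_scal; [apply Rmult_comm|]. apply (rcoef_type_ex s); auto.
  - intros n. unfold PS_plus, PS_scal. unfold plus, scal; simpl; unfold mult; simpl.
    destruct n; simpl.
    + unfold zero; simpl. pose proof (Hrec 0%nat) as H1. replace (PSeries (PS_decr_n a 0) c) with 0 in H1 by (rewrite <- H0; apply PSeries_ext; intros; reflexivity).
      unfold b. lra.
    + unfold b. rewrite (Hrec (S n)). ring.
Qed.

(* Phragmén–Lindelöf bounds the function on horizontal strips; Cauchy's estimates on discs centred at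
   real points then bound all derivatives on the real line. *)
Lemma bernstein p tau C0 : 0 < tau -> (forall e, 0 < e -> rcoef_type (tau + e) p) -> 0 <= C0 -> (forall x, Rabs (PSeries p x) <= C0) ->
  forall sg, tau < sg -> exists K, 0 <= K /\ forall n x, Rabs (Derive_n (PSeries p) n x) <= K * sg ^ n.
Proof.
  intros Ht Hp HC0 Hbd sg Hsg.
  (* The midpoint leaves room on both sides: the coefficients have type [s1 > tau], and the linear
     factor in Cauchy's estimate still fits below [sg]. *)
  set (s1 := (tau + sg)/2).
  assert (Hp1 : rcoef_type s1 p). { replace s1 with (tau + (sg - tau)/2) by (unfold s1; field). apply Hp. lra. }
  set (cp := fun n => RtoC (p n)). pose proof (rcoef_type_coef_type _ _ Hp1) as Hcp. fold cp in Hcp.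
  assert (EF : entire (cpseries cp)) by (apply (cpseries_entire cp s1); [unfold s1; lra|auto]).
  destruct Hcp as [K [HK HKb]].
  assert (PL : forall z, Cmod (cpseries cp z) <= (C0 + 2 * K * exp s1) * exp (s1 * Rabs (Im z))).
  { apply phragmen_lindelof; auto; try (unfold s1; lra).
    - intros z. apply (coef_type_series cp s1 K z HKb).
    - intros x. unfold cp. rewrite (cpseries_real s1) by auto. rewrite Cmod_R. auto.
    - intros z. unfold cp. rewrite cpseries_conj, Cmod_conj. auto. }
  set (M := C0 + 2 * K * exp s1) in *.
  assert (HM : 0 <= M). { unfold M. pose proof (exp_pos s1). nra. }
  destruct (lin_geom s1 sg ltac:(unfold s1; lra)) as [K2 [HK2 HL]].
  exists (3 * M * K2). split; [apply Rmult_le_pos; lra|]. intros n x.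
  assert (EG : entire (fun w => cpseries cp (RtoC x + w)%C)).
  { apply (entire_comp (cpseries cp) (fun w => RtoC x + w)%C); auto. apply entire_plus; [apply entire_const|apply entire_id]. }
  destruct (entire_taylor _ EG) as (a & Ha & Hb & _).
  assert (Han : Cmod (a n) * INR (fact n) <= 3 * M * (INR n + 1) * s1 ^ n).
  { apply cauchy_fact; auto; [unfold s1; lra|]. intros r Hr. apply Hb; auto. intros z Hz.
    eapply Rle_trans; [apply PL|]. apply Rmult_le_compat_l; auto. apply exp_le. apply Rmult_le_compat_l; [unfold s1; lra|].
    rewrite im_plus, im_RtoC, Rplus_0_l, <- Hz. apply im_le_Cmod. }
  assert (Hps : forall h, is_pseries (fun k => Re (a k)) h (PSeries p (h + x))).
  { intros h. specialize (Ha (RtoC h)). apply is_cpseries_real in Ha. destruct Ha as [Ha _]. rewrite <- RtoC_plus in Ha.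
    unfold cp in Ha. rewrite (cpseries_real s1) in Ha by auto. rewrite Rplus_comm. exact Ha. }
  assert (Hrad : Rbar_lt 0 (CV_radius (fun k => Re (a k)))).
  { pose proof (ex_pseries_radius _ _ _ (Hps 1)) as H1. eapply Rbar_lt_le_trans; [|apply H1]. simpl. rewrite Rabs_R1. lra. }
  pose proof (Derive_n_comp_trans (PSeries p) n 0 x) as HD. rewrite Rplus_0_l in HD. rewrite <- HD.
  rewrite (Derive_n_ext _ (PSeries (fun k => Re (a k)))) by (intros h; symmetry; apply is_pseries_unique, Hps).
  rewrite Derive_n_coef by auto. rewrite Rabs_mult, (Rabs_right (INR (fact n))) by (left; apply fact_pos).
  apply Rle_trans with (Cmod (a n) * INR (fact n)).
  - apply Rmult_le_compat_r; [left; apply fact_pos|apply re_le_Cmod].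
  - eapply Rle_trans; [apply Han|]. rewrite Rmult_assoc. specialize (HL n). replace (3 * M * K2 * sg^n) with (3 * M * (K2 * sg^n)) by ring.
    apply Rmult_le_compat_l; [lra|auto].
Qed.

(** * Functions with geometrically bounded derivatives *)

(* The first [n] derivatives satisfy [|f^(k)| <= K s^k w]; in this recursive form the Leibniz rule
   is a two-term induction. *)
Fixpoint deriv_bound (n : nat) (w : R -> R) (s : R) (f : R -> R) (K : R) : Prop :=
  (forall x, Rabs (f x) <= K * w x) /\
  match n with
  | O => True
  | S m => exists f', (forall x, is_derive f x (f' x)) /\ deriv_bound m w s f' (K * s)
  end.

Lemma deriv_bound_0 n w s f K : deriv_bound n w s f K -> forall x, Rabs (f x) <= K * w x.
Proof. destruct n; intros [H _]; exact H. Qed.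

Lemma deriv_bound_pred n w s f K : deriv_bound (S n) w s f K -> deriv_bound n w s f K.
Proof.
  revert f K. induction n; intros f K [H [f' [Hf Hb]]]; split; auto.
  exists f'. split; auto.
Qed.

Lemma deriv_bound_plus n w s f g K L : deriv_bound n w s f K -> deriv_bound n w s g L -> deriv_bound n w s (fun x => f x + g x) (K + L).
Proof.
  revert f g K L. induction n; intros f g K L Hf Hg.
  - split; auto. intros x. eapply Rle_trans; [apply Rabs_triang|]. pose proof (deriv_bound_0 _ _ _ _ _ Hf x). pose proof (deriv_bound_0 _ _ _ _ _ Hg x). lra.
  - split.
    + intros x. eapply Rle_trans; [apply Rabs_triang|]. pose proof (deriv_bound_0 _ _ _ _ _ Hf x). pose proof (deriv_bound_0 _ _ _ _ _ Hg x). lra.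
    + destruct Hf as [_ [f' [Df Bf]]], Hg as [_ [g' [Dg Bg]]]. exists (fun x => f' x + g' x). split.
      * intros x. apply (is_derive_plus (V := R_NormedModule)); auto.
      * rewrite Rmult_plus_distr_r. apply IHn; auto.
Qed.

Lemma deriv_bound_mult n w1 w2 s1 s2 f g K L : deriv_bound n w1 s1 f K -> deriv_bound n w2 s2 g L ->
  deriv_bound n (fun x => w1 x * w2 x) (s1 + s2) (fun x => f x * g x) (K * L).
Proof.
  revert f g K L. induction n; intros f g K L Hf Hg.
  - split; auto. intros x. rewrite Rabs_mult. pose proof (deriv_bound_0 _ _ _ _ _ Hf x). pose proof (deriv_bound_0 _ _ _ _ _ Hg x).
    replace (K * L * (w1 x * w2 x)) with ((K * w1 x) * (L * w2 x)) by ring. apply Rmult_le_compat; auto; apply Rabs_pos.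
  - split.
    + intros x. rewrite Rabs_mult. pose proof (deriv_bound_0 _ _ _ _ _ Hf x). pose proof (deriv_bound_0 _ _ _ _ _ Hg x).
      replace (K * L * (w1 x * w2 x)) with ((K * w1 x) * (L * w2 x)) by ring. apply Rmult_le_compat; auto; apply Rabs_pos.
    + pose proof (deriv_bound_pred _ _ _ _ _ Hf) as Pf. pose proof (deriv_bound_pred _ _ _ _ _ Hg) as Pg.
      destruct Hf as [_ [f' [Df Bf]]], Hg as [_ [g' [Dg Bg]]]. exists (fun x => f' x * g x + f x * g' x). split.
      * intros x. apply (is_derive_mult (K := R_AbsRing) f g); auto. intros; apply Rmult_comm.
      * replace (K * L * (s1 + s2)) with (K * s1 * L + K * (L * s2)) by ring. apply deriv_bound_plus; apply IHn; auto.
Qed.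

Lemma deriv_bound_weaken n w w' s s' f K K' : 0 <= K -> 0 <= s <= s' -> (forall x, K * w x <= K' * w' x) ->
  deriv_bound n w s f K -> deriv_bound n w' s' f K'.
Proof.
  intros HK Hs. revert f K K' HK. induction n; intros f K K' HK Hw Hf.
  - split; auto. intros x. eapply Rle_trans; [apply (deriv_bound_0 _ _ _ _ _ Hf)|]. auto.
  - split.
    + intros x. eapply Rle_trans; [apply (deriv_bound_0 _ _ _ _ _ Hf)|]. auto.
    + pose proof (deriv_bound_0 _ _ _ _ _ Hf) as H0.
      destruct Hf as [_ [f' [Df Bf]]]. exists f'. split; auto. apply (IHn f' (K * s)); auto.
      * apply Rmult_le_pos; lra.
      * intros x. specialize (Hw x). pose proof (Rle_trans _ _ _ (Rabs_pos _) (H0 x)).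
        replace (K * s * w x) with ((K * w x) * s) by ring. replace (K' * s' * w' x) with ((K' * w' x) * s') by ring.
        apply Rmult_le_compat; lra.
Qed.

Lemma deriv_bound_scal n w s f K c : deriv_bound n w s f K -> deriv_bound n w s (fun x => c * f x) (Rabs c * K).
Proof.
  revert f K. induction n; intros f K Hf.
  - split; auto. intros x. rewrite Rabs_mult, Rmult_assoc. apply Rmult_le_compat_l; [apply Rabs_pos|]. apply (deriv_bound_0 _ _ _ _ _ Hf).
  - split.
    + intros x. rewrite Rabs_mult, Rmult_assoc. apply Rmult_le_compat_l; [apply Rabs_pos|]. apply (deriv_bound_0 _ _ _ _ _ Hf).
    + destruct Hf as [_ [f' [Df Bf]]]. exists (fun x => c * f' x). split.
      * intros x. apply (is_derive_scal f); auto.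
      * rewrite Rmult_assoc. apply IHn. auto.
Qed.

Lemma deriv_bound_scale n w s f K l : 0 <= l -> deriv_bound n w s f K -> deriv_bound n (fun x => w (l * x)) (l * s) (fun x => f (l * x)) K.
Proof.
  intros Hl. revert f K. induction n; intros f K Hf.
  - split; auto. intros x. apply (deriv_bound_0 _ _ _ _ _ Hf).
  - split.
    + intros x. apply (deriv_bound_0 _ _ _ _ _ Hf).
    + destruct Hf as [_ [f' [Df Bf]]]. exists (fun x => l * f' (l * x)). split.
      * intros x. apply (is_derive_comp (V := R_NormedModule) f (fun x => l * x)); auto. auto_derive; auto. ring.
      * replace (K * (l * s)) with (Rabs l * (K * s)) by (rewrite Rabs_right; [ring|lra]).
        apply (deriv_bound_scal n _ _ (fun x => f' (l * x))). apply IHn. auto.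
Qed.

Lemma deriv_bound_derive_seq n w s f K : deriv_bound n w s f K -> forall k, (k <= n)%nat ->
  deriv_bound (n - k) w s (Derive_n f k) (K * s ^ k) /\ forall x, (k < n)%nat -> ex_derive (Derive_n f k) x.
Proof.
  intros H. induction k; intros Hk.
  - simpl. rewrite Nat.sub_0_r, Rmult_1_r. split; auto. intros x Hx. destruct n; [lia|]. destruct H as [_ [f' [Df _]]]. exists (f' x). auto.
  - destruct (IHk ltac:(lia)) as [Hb _]. replace (n - k)%nat with (S (n - S k)) in Hb by lia.
    destruct Hb as [_ [g [Dg Bg]]].
    assert (E : Derive_n f (S k) = g). { apply functional_extensionality. intros x. simpl. apply is_derive_unique. auto. }
    rewrite E. replace (K * s ^ S k) with (K * s ^ k * s) by (simpl; ring). split; auto.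
    intros x Hx. replace (n - S k)%nat with (S (n - S (S k))) in Bg by lia. destruct Bg as [_ [g' [Dg' _]]]. exists (g' x). auto.
Qed.

Lemma deriv_bound_Derive_n w s f K : (forall n, deriv_bound n w s f K) ->
  (forall k x, ex_derive_n f k x) /\ (forall k x, Rabs (Derive_n f k x) <= K * s ^ k * w x).
Proof.
  intros H. split; intros k x.
  - destruct k; simpl; auto. apply (deriv_bound_derive_seq (S (S k)) w s f K (H _) k); lia.
  - apply (deriv_bound_0 0 w s). pose proof (proj1 (deriv_bound_derive_seq k w s f K (H k) k (Nat.le_refl k))) as HH. rewrite Nat.sub_diag in HH. exact HH.
Qed.

Lemma Derive_n_deriv_bound w s f K : (forall k x, ex_derive_n f k x) -> (forall k x, Rabs (Derive_n f k x) <= K * s ^ k * w x) ->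
  forall n, deriv_bound n w s f K.
Proof.
  intros He Hb.
  assert (forall n k, deriv_bound n w s (Derive_n f k) (K * s ^ k)).
  { induction n; intros k.
    - split; auto. 
    - split; auto. exists (Derive_n f (S k)). split.
      + intros x. simpl. apply Derive_correct. apply (He (S k) x).
      + replace (K * s ^ k * s) with (K * s ^ (S k)) by (simpl; ring). apply IHn. }
  intros n. specialize (H n 0%nat). simpl in H. rewrite Rmult_1_r in H. exact H.
Qed.

Lemma lipschitz_derive (f f' : R -> R) M x y : (forall x, is_derive f x (f' x)) -> (forall x, Rabs (f' x) <= M) ->
  Rabs (f y - f x) <= M * Rabs (y - x).
Proof.
  intros Hd Hb. destruct (MVT_gen f x y f') as [c [_ Hc]].
  - intros t _. auto.
  - intros t _. apply continuity_pt_filterlim. apply (ex_derive_continuous f). exists (f' t). auto.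
  - rewrite Hc, Rabs_mult. apply Rmult_le_compat_r; [apply Rabs_pos|auto].
Qed.

Lemma quad_bound (f f' f'' : R -> R) M x y : (forall x, is_derive f x (f' x)) -> (forall x, is_derive f' x (f'' x)) ->
  (forall x, Rabs (f'' x) <= M) -> Rabs (f y - f x - f' x * (y - x)) <= M * Rabs (y - x) * Rabs (y - x).
Proof.
  intros Hd Hd2 Hb. destruct (MVT_gen f x y f') as [c [Hcb Hc]].
  - intros t _. auto.
  - intros t _. apply continuity_pt_filterlim. apply (ex_derive_continuous f). exists (f' t). auto.
  - rewrite Hc. replace (f' c * (y - x) - f' x * (y - x)) with ((f' c - f' x) * (y - x)) by ring. rewrite Rabs_mult.
    apply Rmult_le_compat_r; [apply Rabs_pos|]. eapply Rle_trans; [apply (lipschitz_derive f' f'' M); auto|].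
    assert (0 <= M) by (pose proof (Hb 0); pose proof (Rabs_pos (f'' 0)); lra).
    apply Rmult_le_compat_l; auto. 
    unfold Rmin, Rmax in Hcb. destruct (Rle_dec x y).
    + rewrite !Rabs_right; lra.
    + rewrite !Rabs_left1; lra.
Qed.

Lemma is_lim_seq_eps u (l : R) : is_lim_seq u l <-> forall e, 0 < e -> exists N, forall n, (N <= n)%nat -> Rabs (u n - l) < e.
Proof.
  rewrite <- is_lim_seq_spec. split.
  - intros H e He. exact (H (mkposreal e He)).
  - intros H e. exact (H e (cond_pos e)).
Qed.

Lemma lim_abs_le u (l M : R) : is_lim_seq u l -> (forall n, Rabs (u n) <= M) -> Rabs l <= M.
Proof.
  intros H Hb. apply le_epsilon. intros e He. destruct (proj1 (is_lim_seq_eps u l) H e He) as [N HN].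
  specialize (HN N (Nat.le_refl N)). specialize (Hb N).
  replace l with (u N - (u N - l)) by ring. eapply Rle_trans; [apply Rabs_triang|]. rewrite Rabs_Ropp. lra.
Qed.

Definition unitw (x : R) : R := 1.

(* Two extra derivatives, bounded uniformly in [N], make the derivatives converge pointwise. *)
Lemma deriv_bound_lim n s K : 0 <= K -> 0 <= s -> forall (F : nat -> R -> R) (f : R -> R), (forall x, is_lim_seq (fun N => F N x) (f x)) ->
  (forall N, deriv_bound (S (S n)) unitw s (F N) K) -> deriv_bound n unitw s f K.
Proof.
  intros HK Hs. revert K HK. induction n; intros K HK F f Hl Hb.
  - split; auto. intros x. apply (lim_abs_le (fun N => F N x)); auto. intros N. apply (deriv_bound_0 _ _ _ _ _ (Hb N)).
  - split.
    { intros x. apply (lim_abs_le (fun N => F N x)); auto. intros N. apply (deriv_bound_0 _ _ _ _ _ (Hb N)). }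
    assert (Hc : forall N, exists g, (forall x, is_derive (F N) x (g x)) /\ deriv_bound (S (S n)) unitw s g (K * s)).
    { intros N. destruct (Hb N) as [_ H]. exact H. }
    assert (Hch := fun N => constructive_indefinite_description _ (Hc N)).
    set (g := fun N => proj1_sig (Hch N)).
    assert (Hg1 : forall N x, is_derive (F N) x (g N x)) by (intros N; apply (proj2_sig (Hch N))).
    assert (Hg2 : forall N, deriv_bound (S (S n)) unitw s (g N) (K * s)) by (intros N; apply (proj2_sig (Hch N))).
    set (M := K * s * s). assert (HM : 0 <= M) by (unfold M; apply Rmult_le_pos; auto; apply Rmult_le_pos; auto).
    assert (Hq : forall N x y, Rabs (F N y - F N x - g N x * (y - x)) <= M * Rabs (y - x) * Rabs (y - x)).
    { intros N x y. destruct (Hg2 N) as [_ [g' [Dg Bg]]]. apply (quad_bound (F N) (g N) g'); auto.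
      intros t. pose proof (proj1 Bg t) as H. unfold unitw in H. rewrite Rmult_1_r in H. exact H. }
    assert (Hgl : forall x, ex_finite_lim_seq (fun N => g N x)).
    { intros x. apply ex_lim_seq_cauchy_corr. intros e.
      (* A difference quotient of step [h] misses the derivative by at most [M h <= e/4], uniformly
         in [N]; convergence of [F N] at [x] and [x + h] then makes the derivatives a Cauchy
         sequence. *)
      set (h := e / (4 * (M + 1))). assert (Hh : 0 < h) by (apply Rdiv_lt_0_compat; [apply cond_pos|lra]).
      assert (Hmh : M * h <= e / 4). { unfold h. apply Rmult_le_reg_r with (4 * (M+1)); [lra|].
        replace (M * (e / (4 * (M + 1))) * (4 * (M + 1))) with (M * e) by (field; lra).
        replace (e / 4 * (4 * (M + 1))) with (e * (M+1)) by field. pose proof (cond_pos e). nra. }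
      assert (He8 : 0 < e * h / 8) by (pose proof (cond_pos e); nra).
      destruct (proj1 (is_lim_seq_eps _ _) (Hl x) _ He8) as [N1 H1].
      destruct (proj1 (is_lim_seq_eps _ _) (Hl (x+h)) _ He8) as [N2 H2].
      exists (max N1 N2). intros p q Hp Hqq.
      pose proof (H1 p ltac:(lia)) as P1. pose proof (H1 q ltac:(lia)) as P2. pose proof (H2 p ltac:(lia)) as P3. pose proof (H2 q ltac:(lia)) as P4.
      pose proof (Hq p x (x+h)) as Q1. pose proof (Hq q x (x+h)) as Q2. replace (x + h - x) with h in Q1, Q2 by ring. rewrite (Rabs_right h) in Q1, Q2 by lra.
      apply Rabs_def2 in P1, P2, P3, P4. apply Rabs_le_between in Q1, Q2.
      assert (M * h * h <= e / 4 * h) by (apply Rmult_le_compat_r; lra).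
      apply Rmult_lt_reg_r with h; auto. rewrite <- (Rabs_right h) at 1 by lra. rewrite <- Rabs_mult.
      apply Rabs_def1; nra. }
    assert (Hg3 := fun x => constructive_indefinite_description _ (Hgl x)).
    set (gl := fun x => proj1_sig (Hg3 x)).
    assert (Hgl2 : forall x, is_lim_seq (fun N => g N x) (gl x)) by (intros x; apply (proj2_sig (Hg3 x))).
    exists gl. split.
    + intros x. apply is_derive_Reals.
      assert (Hql : forall y, Rabs (f y - f x - gl x * (y - x)) <= M * Rabs (y - x) * Rabs (y - x)).
      { intros y. apply (lim_abs_le (fun N => F N y - F N x - g N x * (y - x))); [|intros N; apply Hq].
        apply (is_lim_seq_minus' _ _ (f y - f x) (gl x * (y - x))).
        - apply is_lim_seq_minus'; auto.
        - apply (is_lim_seq_scal_r _ (y - x) (gl x)). auto. }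
      intros e He. assert (Hd : 0 < e / (M + 1)) by (apply Rdiv_lt_0_compat; lra).
      exists (mkposreal _ Hd). intros h Hh Hhd. simpl in Hhd.
      specialize (Hql (x + h)). replace (x + h - x) with h in Hql by ring.
      replace ((f (x + h) - f x) / h - gl x) with ((f (x+h) - f x - gl x * h) / h) by (field; auto).
      unfold Rdiv. rewrite Rabs_mult, Rabs_inv. pose proof (Rabs_pos_lt h Hh).
      apply Rle_lt_trans with (M * Rabs h * Rabs h * / Rabs h).
      * apply Rmult_le_compat_r; auto. left. apply Rinv_0_lt_compat; auto.
      * replace (M * Rabs h * Rabs h * / Rabs h) with (M * Rabs h) by (field; lra).
        apply Rle_lt_trans with ((M + 1) * Rabs h); [nra|]. apply Rmult_lt_compat_l with (r := M+1) in Hhd; [|lra].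
        replace ((M+1) * (e / (M+1))) with e in Hhd by (field; lra). auto.
    + apply (IHn (K * s) ltac:(apply Rmult_le_pos; auto) g); auto.
Qed.

(** * A band-limited Schwartz function *)

(* The [n]-th derivative of [sin x / x = int_0^1 cos (x y) dy]. *)
Definition snc_deriv (n : nat) (x : R) : R := RInt (fun y => y ^ n * cos (x * y + INR n * (PI/2))) 0 1.
Definition snc (x : R) : R := snc_deriv 0 x.

Lemma snc_deriv_cont n x y : continuous (fun y => y ^ n * cos (x * y + INR n * (PI/2))) y.
Proof.
  apply (ex_derive_continuous (K := R_AbsRing) (V := R_NormedModule)). auto_derive. auto.
Qed.

Lemma snc_deriv_bound n x : Rabs (snc_deriv n x) <= 1.
Proof.
  unfold snc_deriv. replace 1 with ((1 - 0) * 1) at 2 by ring.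
  apply abs_RInt_le_const; [lra|apply ex_RInt_cont; intros; apply snc_deriv_cont|].
  intros t Ht. rewrite Rabs_mult. replace 1 with (1 * 1) by ring. apply Rmult_le_compat; try apply Rabs_pos.
  - rewrite Rabs_right by (apply Rle_ge, pow_le; lra). rewrite <- (pow1 n). apply pow_incr; lra.
  - apply Rabs_le. apply COS_bound.
Qed.

Lemma cos_shift n t : - sin (t + INR n * (PI/2)) = cos (t + INR (S n) * (PI/2)).
Proof. rewrite S_INR. replace (t + (INR n + 1) * (PI/2)) with (PI/2 + (t + INR n * (PI/2))) by ring. rewrite cos_sin. 
  replace (PI / 2 + (PI / 2 + (t + INR n * (PI / 2)))) with ((t + INR n * (PI/2)) + PI) by field. rewrite neg_sin. ring. Qed.

Lemma snc_deriv_derive n x : is_derive (snc_deriv n) x (snc_deriv (S n) x).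
Proof.
  assert (Hd : forall u v, is_derive (fun z => v ^ n * cos (z * v + INR n * (PI/2))) u (v ^ (S n) * cos (u * v + INR (S n) * (PI/2)))).
  { intros u v. auto_derive; auto. rewrite <- cos_shift. simpl. ring. }
  unfold snc_deriv.
  replace (RInt (fun y => y ^ S n * cos (x * y + INR (S n) * (PI / 2))) 0 1) with
    (RInt (fun t => Derive (fun u => t ^ n * cos (u * t + INR n * (PI/2))) x) 0 1).
  2:{ apply RInt_ext. intros t _. apply is_derive_unique. apply Hd. }
  apply (is_derive_RInt_param (fun u t => t ^ n * cos (u * t + INR n * (PI/2)))).
  - exists (mkposreal 1 Rlt_0_1). intros u _ t _. eexists. apply Hd.
  - intros t _. apply (continuity_2d_pt_ext (fun u v => v ^ (S n) * cos (u * v + INR (S n) * (PI/2)))).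
    + intros u v. symmetry. apply is_derive_unique. apply Hd.
    + apply continuity_2d_pt_mult.
      * apply (continuity_1d_2d_pt_comp (fun v => v ^ (S n)) (fun _ v => v)); [|apply continuity_2d_pt_id2].
        apply derivable_continuous_pt. apply derivable_pt_pow.
      * apply (continuity_1d_2d_pt_comp cos (fun u v => u * v + INR (S n) * (PI/2))); [apply continuity_cos|].
        apply continuity_2d_pt_plus; [|apply continuity_2d_pt_const].
        apply continuity_2d_pt_mult; [apply continuity_2d_pt_id1|apply continuity_2d_pt_id2].
  - exists (mkposreal 1 Rlt_0_1). intros u _. apply ex_RInt_cont. intros; apply snc_deriv_cont.
Qed.

Lemma snc_sin x : x * snc x = sin x.
Proof.
  unfold snc, snc_deriv.
  assert (H : is_RInt (fun y => x * (y ^ 0 * cos (x * y + INR 0 * (PI/2)))) 0 1 (minus (sin (x * 1)) (sin (x * 0)))).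
  { apply (is_RInt_derive (fun y => sin (x * y)) (fun y => x * (y ^ 0 * cos (x * y + INR 0 * (PI/2))))).
    - intros y _. auto_derive; auto. simpl. rewrite Rmult_0_l, Rplus_0_r. ring.
    - intros y _. apply (continuous_scal_r (V := R_NormedModule) x). apply snc_deriv_cont. }
  apply (is_RInt_unique (V := R_CompleteNormedModule)) in H. rewrite <- (RInt_scal (V := R_CompleteNormedModule)) by (apply ex_RInt_cont; intros; apply snc_deriv_cont).
  etransitivity; [apply H|]. unfold minus, plus, opp; simpl. rewrite Rmult_1_r, Rmult_0_r, sin_0. ring.
Qed.

(** The identity [x snc x = sin x] differentiated [n + 1] times. It yields decay [1/|x|] for every
    derivative, which the integral representation does not show. *)
Lemma snc_deriv_rel n x : x * snc_deriv (S n) x = sin (x + INR (S n) * (PI/2)) - INR (S n) * snc_deriv n x.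
Proof.
  revert x. induction n; intros x.
  - assert (D1 : is_derive (fun x => x * snc_deriv 0 x) x (snc_deriv 0 x + x * snc_deriv 1 x)).
    { replace (snc_deriv 0 x + x * snc_deriv 1 x) with (plus (mult 1 (snc_deriv 0 x)) (mult x (snc_deriv 1 x))) by (unfold plus, mult; simpl; ring).
      apply (is_derive_mult (K := R_AbsRing) (fun x => x) (snc_deriv 0)); [apply (is_derive_id (K := R_AbsRing))|apply snc_deriv_derive|intros; apply Rmult_comm]. }
    assert (D2 : is_derive (fun x => x * snc_deriv 0 x) x (cos x)).
    { apply (is_derive_ext sin); [intros; symmetry; apply snc_sin|]. auto_derive; auto. ring. }
    apply is_derive_unique in D1, D2. rewrite D2 in D1. simpl INR. rewrite !Rmult_1_l, sin_plus, cos_PI2, sin_PI2. lra.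
  - assert (D1 : is_derive (fun x => x * snc_deriv (S n) x) x (snc_deriv (S n) x + x * snc_deriv (S (S n)) x)).
    { replace (snc_deriv (S n) x + x * snc_deriv (S (S n)) x) with (plus (mult 1 (snc_deriv (S n) x)) (mult x (snc_deriv (S (S n)) x))) by (unfold plus, mult; simpl; ring).
      apply (is_derive_mult (K := R_AbsRing) (fun x => x) (snc_deriv (S n))); [apply (is_derive_id (K := R_AbsRing))|apply snc_deriv_derive|intros; apply Rmult_comm]. }
    assert (D2 : is_derive (fun x => x * snc_deriv (S n) x) x (sin (x + INR (S (S n)) * (PI/2)) - INR (S n) * snc_deriv (S n) x)).
    { apply (is_derive_ext (fun x => sin (x + INR (S n) * (PI/2)) - INR (S n) * snc_deriv n x)); [intros; symmetry; apply IHn|].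
      apply (is_derive_minus (V := R_NormedModule)).
      - auto_derive; auto. rewrite Rmult_1_l. change (match n with 0%nat => 1 | S _ => INR n + 1 end) with (INR (S n)).
        rewrite (S_INR (S n)). replace (x + (INR (S n) + 1) * (PI/2)) with (PI/2 + (x + INR (S n) * (PI/2))) by ring. rewrite <- cos_sin. reflexivity.
      - apply (is_derive_scal (snc_deriv n)). apply snc_deriv_derive. }
    apply is_derive_unique in D1, D2. rewrite D2 in D1. rewrite (S_INR (S n)) in *. lra.
Qed.

Definition wt (m : nat) (x : R) : R := / (1 + Rabs x) ^ m.

Lemma wt_pos m x : 0 < wt m x.
Proof. unfold wt. apply Rinv_0_lt_compat, pow_lt. pose proof (Rabs_pos x). lra. Qed.

(** The recursion loses a factor [n + 1 <= 2^n]; this is why the rate of [snc] is 1 without weight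
    and 2 with the decaying weight. *)
Lemma snc_deriv_weight n x : Rabs (snc_deriv n x) <= 3 * 2 ^ n * wt 1 x.
Proof.
  unfold wt. rewrite pow_1. pose proof (Rabs_pos x). apply Rmult_le_reg_r with (1 + Rabs x); [lra|].
  rewrite Rmult_assoc, Rinv_l, Rmult_1_r by lra.
  assert (Hn : INR n + 1 <= 2 ^ n).
  { clear. induction n; [simpl; lra|]. rewrite S_INR. simpl. pose proof (pow_R1_Rle 2 n ltac:(lra)). lra. }
  assert (Rabs x * Rabs (snc_deriv n x) <= 1 + INR n).
  { rewrite <- Rabs_mult. destruct n.
    - change (snc_deriv 0 x) with (snc x). rewrite snc_sin. simpl. rewrite Rplus_0_r. apply Rabs_le, SIN_bound.
    - rewrite snc_deriv_rel. eapply Rle_trans; [apply Rabs_triang|]. rewrite Rabs_Ropp, Rabs_mult.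
      pose proof (snc_deriv_bound n x). rewrite (Rabs_right (INR (S n))) by (apply Rle_ge, pos_INR). pose proof (pos_INR (S n)).
      assert (Rabs (sin (x + INR (S n) * (PI/2))) <= 1) by (apply Rabs_le, SIN_bound). nra. }
  pose proof (snc_deriv_bound n x). pose proof (pos_INR n). lra.
Qed.

Lemma snc_deriv_bound_unitw n : deriv_bound n unitw 1 snc 1.
Proof.
  assert (forall n k, deriv_bound n unitw 1 (snc_deriv k) 1).
  { clear n. induction n; intros k; split; auto; try (intros x; unfold unitw; rewrite Rmult_1_r; apply snc_deriv_bound).
    exists (snc_deriv (S k)). split; [intros; apply snc_deriv_derive|]. rewrite Rmult_1_r. apply IHn. }
  apply H.
Qed.

Lemma snc_deriv_bound_wt n : deriv_bound n (wt 1) 2 snc 3.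
Proof.
  assert (forall n k, deriv_bound n (wt 1) 2 (snc_deriv k) (3 * 2 ^ k)).
  { clear n. induction n; intros k; split; auto; try (intros x; apply snc_deriv_weight).
    exists (snc_deriv (S k)). split; [intros; apply snc_deriv_derive|]. replace (3 * 2 ^ k * 2) with (3 * 2 ^ S k) by (simpl; ring). apply IHn. }
  specialize (H n 0%nat). simpl in H. rewrite Rmult_1_r in H. exact H.
Qed.

Lemma snc_0 : snc 0 = 1.
Proof.
  unfold snc, snc_deriv. rewrite (RInt_ext _ (fun _ => 1)).
  - rewrite RInt_const. unfold scal; simpl; unfold mult; simpl. ring.
  - intros y _. simpl. rewrite !Rmult_0_l, Rplus_0_r, cos_0. ring.
Qed.

Lemma snc_even x : snc (- x) = snc x.
Proof.
  unfold snc, snc_deriv. apply RInt_ext. intros y _. simpl. rewrite !Rmult_0_l, !Rplus_0_r, Ropp_mult_distr_l_reverse, cos_neg. auto.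
Qed.

Lemma snc_abs x : Rabs (snc x) <= 1.
Proof. apply snc_deriv_bound. Qed.

Lemma snc_lip x : Rabs (snc x - 1) <= Rabs x.
Proof.
  rewrite <- snc_0. replace (Rabs x) with (1 * Rabs (x - 0)) by (rewrite Rminus_0_r; ring).
  apply (lipschitz_derive snc (snc_deriv 1)); [intros; apply snc_deriv_derive|intros; apply snc_deriv_bound].
Qed.

(* [sinc_prod x] is the product over [k >= 1] of [sinc (x / 2^k)]: each factor contributes decay
   [1/|x|], while the bands [2^-k] are summable. *)
Fixpoint sinc_prod_n (N : nat) (x : R) : R :=
  match N with O => 1 | S m => snc (/2 * x) * sinc_prod_n m (/2 * x) end.

(** Halving the argument gives both factors the rate [1/2], and these add up to 1 again, so the
    bound is uniform in [N]. *)
Lemma sinc_prod_n_deriv_bound n N : deriv_bound n unitw 1 (sinc_prod_n N) 1.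
Proof.
  revert n. induction N; intros n.
  - simpl. assert (forall n c, 0 <= c <= 1 -> deriv_bound n unitw 1 (fun _ => c) 1).
    { clear. induction n; intros c Hc; split; auto; try (intros x; unfold unitw; rewrite Rabs_right; lra).
      exists (fun _ => 0). split; [intros; apply (is_derive_const (V := R_NormedModule))|]. rewrite Rmult_1_r. apply IHn. lra. }
    apply H. lra.
  - simpl.
    pose proof (deriv_bound_scale n unitw 1 snc 1 (/2) ltac:(lra) (snc_deriv_bound_unitw n)) as H1.
    pose proof (deriv_bound_scale n unitw 1 (sinc_prod_n N) 1 (/2) ltac:(lra) (IHN n)) as H2.
    pose proof (deriv_bound_mult _ _ _ _ _ _ _ _ _ H1 H2) as H3.
    apply (deriv_bound_weaken n _ unitw _ 1 _ _ 1) in H3; auto; try lra.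
    intros x. unfold unitw. lra.
Qed.

Lemma sinc_prod_n_diff N x : Rabs (sinc_prod_n (S N) x - sinc_prod_n N x) <= Rabs x / 2 ^ N.
Proof.
  revert x. induction N; intros x.
  - simpl. rewrite Rmult_1_r. eapply Rle_trans; [apply snc_lip|]. rewrite Rabs_mult, (Rabs_right (/2)) by lra. pose proof (Rabs_pos x). lra.
  - change (sinc_prod_n (S (S N)) x) with (snc (/2*x) * sinc_prod_n (S N) (/2*x)). change (sinc_prod_n (S N) x) with (snc (/2*x) * sinc_prod_n N (/2*x)).
    rewrite <- Rmult_minus_distr_l, Rabs_mult.
    apply Rle_trans with (1 * (Rabs (/2 * x) / 2^N)).
    + apply Rmult_le_compat; try apply Rabs_pos; [apply snc_abs|apply IHN].
    + right. rewrite Rabs_mult, (Rabs_right (/2)) by lra. simpl. field. apply pow_nonzero; lra.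
Qed.

Lemma sinc_prod_n_cauchy N k x : Rabs (sinc_prod_n (N + k) x - sinc_prod_n N x) <= Rabs x * (2 / 2 ^ N - 2 / 2 ^ (N + k)).
Proof.
  induction k.
  - rewrite Nat.add_0_r, !Rminus_diag, Rabs_R0, Rmult_0_r. lra.
  - rewrite Nat.add_succ_r. replace (sinc_prod_n (S (N + k)) x - sinc_prod_n N x) with ((sinc_prod_n (S (N + k)) x - sinc_prod_n (N + k) x) + (sinc_prod_n (N + k) x - sinc_prod_n N x)) by ring.
    eapply Rle_trans; [apply Rabs_triang|]. pose proof (sinc_prod_n_diff (N + k) x).
    replace (2 / 2 ^ S (N + k)) with (2 / 2 ^ (N+k) - 1 / 2 ^ (N + k)) by (simpl; field; apply pow_nonzero; lra). unfold Rdiv in *. lra.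
Qed.

Lemma sinc_prod_n_lim x : ex_finite_lim_seq (fun N => sinc_prod_n N x).
Proof.
  apply ex_lim_seq_cauchy_corr. intros e.
  destruct (pow2_small (4 * Rabs x) e (cond_pos e)) as [N HN]. exists N.
  assert (HB : forall n, (N <= n)%nat -> Rabs (sinc_prod_n n x - sinc_prod_n N x) <= Rabs x * (2 / 2 ^ N)).
  { intros n Hn. pose proof (sinc_prod_n_cauchy N (n - N) x) as H. replace (N + (n - N))%nat with n in H by lia.
    eapply Rle_trans; [apply H|]. apply Rmult_le_compat_l; [apply Rabs_pos|].
    assert (0 < 2 / 2^n) by (apply Rdiv_lt_0_compat; [lra|apply pow_lt; lra]). lra. }
  intros n m Hn Hm. pose proof (HB n Hn). pose proof (HB m Hm).
  replace (sinc_prod_n n x - sinc_prod_n m x) with ((sinc_prod_n n x - sinc_prod_n N x) + - (sinc_prod_n m x - sinc_prod_n N x)) by ring.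
  eapply Rle_lt_trans; [apply Rabs_triang|]. rewrite Rabs_Ropp.
  replace (4 * Rabs x / 2 ^ N) with (Rabs x * (2 / 2 ^ N) + Rabs x * (2 / 2^N)) in HN by (field; apply pow_nonzero; lra). lra.
Qed.

Definition sinc_prod (x : R) : R := real (Lim_seq (fun N => sinc_prod_n N x)).

Lemma sinc_prod_lim x : is_lim_seq (fun N => sinc_prod_n N x) (sinc_prod x).
Proof. destruct (sinc_prod_n_lim x) as [l Hl]. unfold sinc_prod. rewrite (is_lim_seq_unique _ _ Hl). exact Hl. Qed.

Lemma sinc_prod_eq x : sinc_prod x = snc (/2 * x) * sinc_prod (/2 * x).
Proof.
  assert (H1 : is_lim_seq (fun N => sinc_prod_n (S N) x) (sinc_prod x)) by (apply (is_lim_seq_incr_1 (fun N => sinc_prod_n N x)), sinc_prod_lim).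
  assert (H2 : is_lim_seq (fun N => sinc_prod_n (S N) x) (snc (/2 * x) * sinc_prod (/2 * x))).
  { simpl. apply (is_lim_seq_scal_l (fun N => sinc_prod_n N (/2 * x)) (snc (/2*x)) (sinc_prod (/2*x))). apply sinc_prod_lim. }
  apply is_lim_seq_unique in H1, H2. rewrite H1 in H2. injection H2. auto.
Qed.

Lemma sinc_prod_deriv_bound_unitw n : deriv_bound n unitw 1 sinc_prod 1.
Proof. apply (deriv_bound_lim n 1 1 ltac:(lra) ltac:(lra) sinc_prod_n); [apply sinc_prod_lim|]. intros N. apply sinc_prod_n_deriv_bound. Qed.

Lemma sinc_prod_0 : sinc_prod 0 = 1.
Proof.
  unfold sinc_prod. rewrite (Lim_seq_ext _ (fun _ => 1)).
  - rewrite Lim_seq_const. auto.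
  - intros N. induction N; simpl; auto. rewrite Rmult_0_r, snc_0, IHN. ring.
Qed.

Lemma sinc_prod_even x : sinc_prod (- x) = sinc_prod x.
Proof.
  unfold sinc_prod. f_equal. apply Lim_seq_ext. intros N. revert x. induction N; intros x; simpl; auto.
  replace (/2 * - x) with (- (/2 * x)) by ring. rewrite snc_even, IHN. auto.
Qed.

Lemma wt_scale m x : wt m (/2 * x) <= 2 ^ m * wt m x.
Proof.
  unfold wt. pose proof (Rabs_pos x). rewrite Rabs_mult, (Rabs_right (/2)) by lra.
  assert (0 < (1 + Rabs x)^m) by (apply pow_lt; lra). assert (0 < (1 + /2 * Rabs x)^m) by (apply pow_lt; lra).
  apply Rmult_le_reg_r with ((1 + Rabs x)^m * (1 + /2 * Rabs x)^m); [apply Rmult_lt_0_compat; auto|].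
  replace (/ (1 + / 2 * Rabs x) ^ m * ((1 + Rabs x) ^ m * (1 + / 2 * Rabs x) ^ m)) with ((1 + Rabs x)^m) by (field; lra).
  replace (2 ^ m * / (1 + Rabs x) ^ m * ((1 + Rabs x) ^ m * (1 + / 2 * Rabs x) ^ m)) with ((2 * (1 + /2 * Rabs x))^m) by (rewrite Rpow_mult_distr; field; lra).
  apply pow_incr. lra.
Qed.

(** Each use of [sinc_prod x = snc (x/2) sinc_prod (x/2)] gains one power of decay from [snc]. The
    rates [2/2 + 2/2] give 2 back, so arbitrary decay costs no further bandwidth. *)
Lemma sinc_prod_deriv_bound_wt m : exists K, 0 <= K /\ forall n, deriv_bound n (wt m) 2 sinc_prod K.
Proof.
  induction m.
  - exists 1. split; [lra|]. intros n. apply (deriv_bound_weaken n unitw _ 1 2 _ 1); try lra; [|apply sinc_prod_deriv_bound_unitw].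
    intros x. unfold unitw, wt. simpl. lra.
  - destruct IHm as [K [HK HB]].
    exists (3 * K * (2 * 2 ^ m)). split. { pose proof (pow_lt 2 m ltac:(lra)). nra. }
    intros n.
    pose proof (deriv_bound_scale n _ _ _ _ (/2) ltac:(lra) (snc_deriv_bound_wt n)) as H1.
    pose proof (deriv_bound_scale n _ _ _ _ (/2) ltac:(lra) (HB n)) as H2.
    pose proof (deriv_bound_mult _ _ _ _ _ _ _ _ _ H1 H2) as H3.
    rewrite (functional_extensionality sinc_prod (fun x => snc (/2 * x) * sinc_prod (/2 * x))) by apply sinc_prod_eq.
    eapply deriv_bound_weaken; [| |  |apply H3]; try lra.
    intros x. rewrite (Rmult_assoc (3 * K)). apply Rmult_le_compat_l; [lra|].
    apply Rle_trans with ((2 ^ 1 * wt 1 x) * (2 ^ m * wt m x)).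
    + apply Rmult_le_compat; try (left; apply wt_pos); apply wt_scale.
    + right. unfold wt. pose proof (Rabs_pos x). simpl. field. split; [apply pow_nonzero; lra|lra].
Qed.

(** * Improper integrals and Fourier support *)

Definition cts (f : R -> R) := forall x, continuous f x.

(* Convergence of the integral over the real line; meaningful for continuous [f] only. *)
Definition cvg (f : R -> R) (l : R) :=
  forall e, 0 < e -> exists M, forall a b, a <= - M -> M <= b -> Rabs (RInt f a b - l) < e.

Lemma filter_R_iff (P : R * R -> Prop) : filter_prod over_R over_R' P <-> exists M, forall a b, a <= - M -> M <= b -> P (a, b).
Proof.
  split.
  - intros [Q1 Q2 [M1 H1] [M2 H2] H]. exists (Rabs M1 + Rabs M2 + 1). intros a b Ha Hb.
    pose proof (Rle_abs (- M1)). pose proof (Rle_abs M2). rewrite Rabs_Ropp in H0. pose proof (Rabs_pos M1). pose proof (Rabs_pos M2).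
    apply H; [apply H1|apply H2]; lra.
  - intros [M HM]. exists (fun a => a <= - M) (fun b => M <= b).
    + exists (- M). intros; lra.
    + exists M. intros; lra.
    + auto.
Qed.

Lemma is_RInt_gen_cvg f (l : R) : cts f -> is_RInt_gen f over_R over_R' l <-> cvg f l.
Proof.
  intros Hf. split.
  - intros H e He.
    assert (HL : locally l (fun y => Rabs (y - l) < e)). { exists (mkposreal e He). intros y Hy. exact Hy. }
    specialize (H _ HL). apply filter_R_iff in H. destruct H as [M HM]. exists M. intros a b Ha Hb.
    destruct (HM a b Ha Hb) as [y [Hy1 Hy2]]. simpl in Hy1. rewrite (is_RInt_unique _ _ _ _ Hy1). auto.
  - intros H P [e He]. apply filter_R_iff. destruct (H e (cond_pos e)) as [M HM]. exists M. intros a b Ha Hb.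
    exists (RInt f a b). split.
    + simpl. apply (RInt_correct (V := R_CompleteNormedModule)). apply ex_RInt_cont; auto.
    + apply He. apply (HM a b Ha Hb).
Qed.

Lemma cts_ext f g : (forall x, f x = g x) -> cts f -> cts g.
Proof. intros H Hf x. apply (continuous_ext f); auto. Qed.
Lemma cts_plus f g : cts f -> cts g -> cts (fun x => f x + g x).
Proof. intros Hf Hg x. apply (continuous_plus (V := R_NormedModule)); auto. Qed.
Lemma cts_minus f g : cts f -> cts g -> cts (fun x => f x - g x).
Proof. intros Hf Hg x. apply (continuous_minus (V := R_NormedModule)); auto. Qed.
Lemma cts_mult f g : cts f -> cts g -> cts (fun x => f x * g x).
Proof. intros Hf Hg x. apply (continuous_mult (K := R_AbsRing)); auto. Qed.
Lemma cts_const c : cts (fun _ => c).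
Proof. intros x. apply continuous_const. Qed.
Lemma cts_id : cts (fun x => x).
Proof. intros x. apply continuous_id. Qed.
Lemma cts_comp f g : cts f -> cts g -> cts (fun x => f (g x)).
Proof. intros Hf Hg x. apply (continuous_comp g f); auto. Qed.
Lemma cts_derive f f' : (forall x, is_derive f x (f' x)) -> cts f.
Proof. intros H x. apply (ex_derive_continuous (K := R_AbsRing) (V := R_NormedModule)). exists (f' x). apply H. Qed.

Lemma RInt_p f g a b : cts f -> cts g -> RInt (fun x => f x + g x) a b = RInt f a b + RInt g a b.
Proof. intros. apply (RInt_plus (V := R_CompleteNormedModule)); apply ex_RInt_cont; auto. Qed.
Lemma RInt_s c f a b : cts f -> RInt (fun x => c * f x) a b = c * RInt f a b.
Proof. intros. apply (RInt_scal (V := R_CompleteNormedModule)); apply ex_RInt_cont; auto. Qed.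
Lemma RInt_ch f a b c : cts f -> RInt f a b + RInt f b c = RInt f a c.
Proof. intros. apply (RInt_Chasles (V := R_CompleteNormedModule)); apply ex_RInt_cont; auto. Qed.

Lemma cvg_unique f l m : cvg f l -> cvg f m -> l = m.
Proof.
  intros H1 H2. apply Rminus_diag_uniq. apply NNPP. intros Hn.
  set (e := Rabs (l - m)). assert (He : 0 < e) by (apply Rabs_pos_lt; auto).
  destruct (H1 (e/2) ltac:(lra)) as [M1 P1]. destruct (H2 (e/2) ltac:(lra)) as [M2 P2].
  set (M := Rmax M1 M2). pose proof (Rmax_l M1 M2). pose proof (Rmax_r M1 M2). fold M in H, H0.
  specialize (P1 (-M) M ltac:(lra) ltac:(lra)). specialize (P2 (-M) M ltac:(lra) ltac:(lra)).
  assert (e <= Rabs (RInt f (-M) M - l) + Rabs (RInt f (-M) M - m)).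
  { unfold e. replace (l - m) with (- (RInt f (-M) M - l) + (RInt f (-M) M - m)) by ring. eapply Rle_trans; [apply Rabs_triang|]. rewrite Rabs_Ropp. lra. }
  lra.
Qed.

Lemma cvg_ext f g l : (forall x, f x = g x) -> cvg f l -> cvg g l.
Proof.
  intros H Hf e He. destruct (Hf e He) as [M HM]. exists M. intros a b Ha Hb. rewrite (RInt_ext g f); [auto|]. intros; symmetry; auto.
Qed.

Lemma cvg_plus f g l m : cts f -> cts g -> cvg f l -> cvg g m -> cvg (fun x => f x + g x) (l + m).
Proof.
  intros Cf Cg Hf Hg e He. destruct (Hf (e/2) ltac:(lra)) as [M1 P1]. destruct (Hg (e/2) ltac:(lra)) as [M2 P2].
  exists (Rmax M1 M2). intros a b Ha Hb. pose proof (Rmax_l M1 M2). pose proof (Rmax_r M1 M2).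
  specialize (P1 a b ltac:(lra) ltac:(lra)). specialize (P2 a b ltac:(lra) ltac:(lra)).
  rewrite RInt_p by auto. replace (RInt f a b + RInt g a b - (l + m)) with ((RInt f a b - l) + (RInt g a b - m)) by ring.
  eapply Rle_lt_trans; [apply Rabs_triang|]. lra.
Qed.

Lemma cvg_scal c f l : cts f -> cvg f l -> cvg (fun x => c * f x) (c * l).
Proof.
  intros Cf Hf e He. pose proof (Rabs_pos c).
  destruct (Hf (e / (Rabs c + 1)) ltac:(apply Rdiv_lt_0_compat; lra)) as [M HM]. exists M. intros a b Ha Hb.
  rewrite RInt_s by auto. rewrite <- Rmult_minus_distr_l, Rabs_mult. specialize (HM a b Ha Hb).
  apply Rmult_lt_compat_l with (r := Rabs c + 1) in HM; [|lra]. replace ((Rabs c + 1) * (e / (Rabs c + 1))) with e in HM by (field; lra).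
  pose proof (Rabs_pos (RInt f a b - l)). nra.
Qed.

Lemma cvg_minus f g l m : cts f -> cts g -> cvg f l -> cvg g m -> cvg (fun x => f x - g x) (l - m).
Proof.
  intros Cf Cg Hf Hg. apply (cvg_ext (fun x => f x + (-1) * g x)); [intros; ring|].
  replace (l - m) with (l + (-1) * m) by ring. apply cvg_plus; auto; [apply cts_mult; auto; apply cts_const|]. apply cvg_scal; auto.
Qed.

Lemma RInt_nonneg f a b : a <= b -> cts f -> (forall x, 0 <= f x) -> 0 <= RInt f a b.
Proof. intros. apply RInt_ge_0; auto. apply ex_RInt_cont; auto. Qed.

Lemma RInt_mono f a b a' b' : cts f -> (forall x, 0 <= f x) -> a' <= a -> a <= b -> b <= b' -> RInt f a b <= RInt f a' b'.
Proof.
  intros Cf Hf H1 H2 H3. rewrite <- (RInt_ch f a' a b'), <- (RInt_ch f a b b') by auto.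
  pose proof (RInt_nonneg f a' a H1 Cf Hf). pose proof (RInt_nonneg f b b' H3 Cf Hf). lra.
Qed.

Lemma cvg_ge_part f l a b : cts f -> (forall x, 0 <= f x) -> cvg f l -> a <= b -> RInt f a b <= l.
Proof.
  intros Cf Hf Hl Hab. apply le_epsilon. intros e He. destruct (Hl e He) as [M HM].
  set (A := Rmin a (- M)). set (B := Rmax b M). pose proof (Rmin_l a (-M)). pose proof (Rmin_r a (-M)). pose proof (Rmax_l b M). pose proof (Rmax_r b M).
  specialize (HM A B H0 H2). apply Rabs_def2 in HM. pose proof (RInt_mono f a b A B Cf Hf H Hab H1). lra.
Qed.

Lemma cvg_ge_0 f l : cts f -> (forall x, 0 <= f x) -> cvg f l -> 0 <= l.
Proof. intros. rewrite <- (RInt_point (V := R_CompleteNormedModule) 0 f : RInt f 0 0 = 0). apply cvg_ge_part; auto. lra. Qed.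

Lemma cvg_bounded f B : cts f -> (forall x, 0 <= f x) -> (forall a b, a <= b -> RInt f a b <= B) -> exists l, cvg f l /\ l <= B.
Proof.
  intros Cf Hf HB.
  destruct (completeness (fun y => exists M, 0 <= M /\ y = RInt f (-M) M)) as [l [Hl1 Hl2]].
  - exists B. intros y [M [HM ->]]. apply HB. lra.
  - exists (RInt f (-0) 0), 0. split; [lra|auto].
  - exists l. split.
    + intros e He.
      assert (Hex : exists M, 0 <= M /\ l - e < RInt f (-M) M).
      { apply NNPP. intros N. assert (l <= l - e); [|lra]. apply Hl2. intros y [M [HM ->]]. apply Rnot_lt_le. intros HH. apply N. exists M. auto. }
      destruct Hex as [M [HM HMl]]. exists M. intros a b Ha Hb.
      pose proof (RInt_mono f (-M) M a b Cf Hf Ha ltac:(lra) Hb).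
      set (T := Rmax (- a) b). pose proof (Rmax_l (-a) b). pose proof (Rmax_r (-a) b). fold T in H0, H1.
      pose proof (RInt_mono f a b (-T) T Cf Hf ltac:(lra) ltac:(lra) ltac:(lra)).
      assert (RInt f (-T) T <= l) by (apply Hl1; exists T; split; [lra|auto]).
      apply Rabs_def1; lra.
    + apply Hl2. intros y [M [HM ->]]. apply HB. lra.
Qed.

Lemma RInt_leq f g a b : a <= b -> cts f -> cts g -> (forall x, a < x < b -> f x <= g x) -> RInt f a b <= RInt g a b.
Proof. intros. apply RInt_le; auto; apply ex_RInt_cont; auto. Qed.

(** Adding [g] makes the integrand nonnegative, where boundedness of the partial integrals is enough
    for convergence. *)
Lemma cvg_dom f g lg : cts f -> cts g -> (forall x, Rabs (f x) <= g x) -> cvg g lg -> exists l, cvg f l /\ Rabs l <= lg.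
Proof.
  intros Cf Cg H Hg.
  assert (Hpos : forall x, 0 <= g x) by (intros x; eapply Rle_trans; [apply Rabs_pos|apply H]).
  assert (Hb : forall x, - g x <= f x <= g x) by (intros x; apply Rabs_le_between; auto).
  destruct (cvg_bounded (fun x => f x + g x) (lg + lg)) as [l1 [H1 H1']].
  - apply cts_plus; auto.
  - intros x. specialize (Hb x). lra.
  - intros a b Hab. apply Rle_trans with (RInt (fun x => g x + g x) a b).
    + apply RInt_leq; auto; try apply cts_plus; auto. intros x _. specialize (Hb x). lra.
    + rewrite RInt_p by auto. pose proof (cvg_ge_part g lg a b Cg Hpos Hg Hab). lra.
  - exists (l1 - lg). split.
    + apply (cvg_ext (fun x => (f x + g x) - g x)); [intros; ring|]. apply cvg_minus; auto. apply cts_plus; auto.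
    + apply Rabs_le. split; [|lra]. pose proof (cvg_ge_0 _ _ (cts_plus f g Cf Cg) ltac:(intros x; specialize (Hb x); lra) H1). lra.
Qed.

Lemma cvg_pos f l x0 : cts f -> (forall x, 0 <= f x) -> 0 < f x0 -> cvg f l -> 0 < l.
Proof.
  intros Cf Hf H0 Hl. destruct (continuous_eps_inv f x0 (Cf x0) (f x0) H0) as [d [Hd Hx]].
  apply Rlt_le_trans with (RInt f (x0 - d/2) (x0 + d/2)); [|apply cvg_ge_part; auto; lra].
  apply RInt_gt_0; [lra| |intros; apply Cf]. intros x Hxx. specialize (Hx x ltac:(apply Rabs_def1; lra)). apply Rabs_def2 in Hx. lra.
Qed.

Lemma RInt_scale c f a b : cts f -> RInt (fun x => c * f (c * x)) a b = RInt f (c * a) (c * b).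
Proof.
  intros Cf. pose proof (RInt_comp_lin (V := R_CompleteNormedModule) f c 0 a b) as H. rewrite !Rplus_0_r in H.
  rewrite <- H by (apply ex_RInt_cont; auto). apply RInt_ext. intros x _. rewrite Rplus_0_r. reflexivity.
Qed.

Lemma cvg_reflect f l : cts f -> cvg f l -> cvg (fun x => f (- x)) l.
Proof.
  intros Cf Hl e He. destruct (Hl e He) as [M HM]. exists M. intros a b Ha Hb.
  rewrite (RInt_ext _ (fun x => - 1 * (-1 * f (-1 * x)))).
  2:{ intros x _. replace (-1 * x) with (- x) by ring. as_R_eq. ring. }
  rewrite RInt_s by (apply cts_mult; [apply cts_const|]; apply (cts_comp f); auto; apply cts_mult; [apply cts_const|apply cts_id]).
  rewrite RInt_scale by auto. replace (-1 * a) with (- a) by ring. replace (-1 * b) with (- b) by ring.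
  pose proof (RInt_ch f (-a) (-b) (-a) Cf) as H. rewrite (RInt_point (V := R_CompleteNormedModule) (-a) f : RInt f (-a) (-a) = 0) in H.
  replace (-1 * RInt f (-a) (-b)) with (RInt f (-b) (-a)) by lra. apply HM; lra.
Qed.

Lemma cvg_atan : cvg (fun x => / (1 + x^2)) PI.
Proof.
  assert (Hi : forall a b, RInt (fun x => / (1 + x^2)) a b = atan b - atan a).
  { intros a b. apply is_RInt_unique. apply (is_RInt_derive atan (fun x => / (1 + x^2))).
    - intros x _. auto_derive; auto. replace (x * (x * 1)) with (x * x) by ring. field. nra.
    - intros x _. apply (ex_derive_continuous (K := R_AbsRing) (V := R_NormedModule)). auto_derive. nra. }
  intros e He. pose proof PI_RGT_0 as Hpi.
  set (d := Rmin (e/3) (PI/4)). assert (Hd : 0 < d) by (apply Rmin_pos; lra). pose proof (Rmin_l (e/3) (PI/4)). pose proof (Rmin_r (e/3) (PI/4)). fold d in H, H0.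
  set (M := tan (PI/2 - d)). exists M. intros a b Ha Hb. rewrite Hi.
  assert (HM : atan M = PI/2 - d) by (apply atan_tan; lra).
  assert (HmM : atan (- M) = - (PI/2 - d)) by (rewrite atan_opp, HM; auto).
  pose proof (atan_bound a). pose proof (atan_bound b).
  assert (atan a <= atan (- M)) by (destruct Ha as [Ha| ->]; [left; apply atan_increasing; auto|lra]).
  assert (atan M <= atan b) by (destruct Hb as [Hb| <-]; [left; apply atan_increasing; auto|lra]).
  apply Rabs_def1; lra.
Qed.

Lemma cts_inv2 : cts (fun x => / (1 + x^2)).
Proof. intros x. apply (ex_derive_continuous (K := R_AbsRing) (V := R_NormedModule)). auto_derive. nra. Qed.

Lemma wt2_le x : wt 2 x <= / (1 + x^2).
Proof.
  unfold wt. apply Rinv_le_contravar; [nra|]. rewrite <- (pow2_abs x). pose proof (Rabs_pos x). nra.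
Qed.

Lemma cvg_wt2 f K : cts f -> 0 <= K -> (forall x, Rabs (f x) <= K * wt 2 x) -> exists l, cvg f l /\ Rabs l <= K * PI.
Proof.
  intros Cf HK H. apply (cvg_dom f (fun x => K * / (1 + x^2)) (K * PI)); auto.
  - apply cts_mult; [apply cts_const|apply cts_inv2].
  - intros x. eapply Rle_trans; [apply H|]. apply Rmult_le_compat_l; auto. apply wt2_le.
  - apply cvg_scal; [apply cts_inv2|apply cvg_atan].
Qed.

Lemma cvg_derive F F' K : (forall x, is_derive F x (F' x)) -> cts F' -> 0 <= K -> (forall x, Rabs (F x) <= K * wt 2 x) -> cvg F' 0.
Proof.
  intros HD HC HK HB e He.
  set (M := 2 * K / e + 1). assert (HMp : 0 < M). { unfold M. assert (0 <= 2 * K / e) by (apply Rdiv_le_0_compat; lra). lra. }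
  assert (Hsm : forall x, M <= Rabs x -> Rabs (F x) < e / 2).
  { intros x Hx. eapply Rle_lt_trans; [apply HB|]. unfold wt.
    apply Rmult_lt_reg_r with ((1 + Rabs x)^2); [apply pow_lt; lra|]. rewrite Rmult_assoc, Rinv_l by (apply pow_nonzero; lra).
    assert (2 * K / e * e = 2 * K) by (field; lra).
    assert (e * M <= e * Rabs x) by (apply Rmult_le_compat_l; lra). unfold M in H0.
    assert (e * Rabs x <= e * (1 + Rabs x) ^ 2) by (apply Rmult_le_compat_l; [lra|]; pose proof (Rabs_pos x); nra). nra. }
  exists M. intros a b Ha Hb.
  assert (E : RInt F' a b = F b - F a) by (apply is_RInt_unique; apply (is_RInt_derive F F'); auto).
  rewrite E. pose proof (Hsm a ltac:(rewrite Rabs_left1; lra)) as H1. pose proof (Hsm b ltac:(rewrite Rabs_right; lra)) as H2.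
  apply Rabs_def2 in H1, H2. apply Rabs_def1; lra.
Qed.

(* Each integration by parts gains a factor [s / |t|]. *)
Lemma fourier_decay t s : 0 <= s -> t <> 0 -> forall k f K, 0 <= K -> (forall n, deriv_bound n (wt 2) s f K) ->
  forall X Y, cvg (fun x => f x * cos (t * x)) X -> cvg (fun x => f x * sin (t * x)) Y ->
  Rabs X + Rabs Y <= 2 * PI * K * (s / Rabs t) ^ k.
Proof.
  intros Hs Ht. assert (Htp : 0 < Rabs t) by (apply Rabs_pos_lt; auto).
  assert (Ccos : cts (fun x => cos (t * x))). { intros x. apply (ex_derive_continuous (K := R_AbsRing) (V := R_NormedModule)). auto_derive. auto. }
  assert (Csin : cts (fun x => sin (t * x))). { intros x. apply (ex_derive_continuous (K := R_AbsRing) (V := R_NormedModule)). auto_derive. auto. }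
  assert (Bc : forall (f : R -> R) x, Rabs (f x * cos (t * x)) <= Rabs (f x)).
  { intros f x. rewrite Rabs_mult. rewrite <- (Rmult_1_r (Rabs (f x))) at 2. apply Rmult_le_compat_l; [apply Rabs_pos|]. apply Rabs_le, COS_bound. }
  assert (Bs : forall (f : R -> R) x, Rabs (f x * sin (t * x)) <= Rabs (f x)).
  { intros f x. rewrite Rabs_mult. rewrite <- (Rmult_1_r (Rabs (f x))) at 2. apply Rmult_le_compat_l; [apply Rabs_pos|]. apply Rabs_le, SIN_bound. }
  assert (Cf : forall f K, deriv_bound 1 (wt 2) s f K -> cts f).
  { intros f K [_ [f' [Df _]]]. apply (cts_derive f f'). auto. }
  induction k; intros f K HK Hf X Y HX HY.
  - simpl. pose proof (Cf f K (Hf 1%nat)) as C1. pose proof (deriv_bound_0 _ _ _ _ _ (Hf 0%nat)) as B0.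
    destruct (cvg_wt2 (fun x => f x * cos (t * x)) K) as [X' [HX' BX]]; auto; [apply cts_mult; auto|intros x; eapply Rle_trans; [apply Bc|auto]|].
    destruct (cvg_wt2 (fun x => f x * sin (t * x)) K) as [Y' [HY' BY]]; auto; [apply cts_mult; auto|intros x; eapply Rle_trans; [apply Bs|auto]|].
    rewrite (cvg_unique _ _ _ HX HX'), (cvg_unique _ _ _ HY HY'). lra.
  - assert (Hd : exists f', (forall x, is_derive f x (f' x)) /\ forall n, deriv_bound n (wt 2) s f' (K * s)).
    { exists (Derive f). split.
      - intros x. apply Derive_correct. destruct (Hf 1%nat) as [_ [f' [Df _]]]. exists (f' x). auto.
      - intros n. destruct (deriv_bound_derive_seq (S n) _ _ _ _ (Hf (S n)) 1 ltac:(lia)) as [H _]. simpl in H. rewrite Rmult_1_r, Nat.sub_0_r in H. exact H. }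
    destruct Hd as [f' [Df Bf]]. pose proof (Cf f K (Hf 1%nat)) as C0. pose proof (Cf f' _ (Bf 1%nat)) as C1.
    pose proof (deriv_bound_0 _ _ _ _ _ (Hf 0%nat)) as B0. pose proof (deriv_bound_0 _ _ _ _ _ (Bf 0%nat)) as B1.
    assert (HKs : 0 <= K * s) by (apply Rmult_le_pos; auto).
    destruct (cvg_wt2 (fun x => f' x * cos (t * x)) (K * s)) as [X' [HX' _]]; auto; [apply cts_mult; auto|intros x; eapply Rle_trans; [apply Bc|auto]|].
    destruct (cvg_wt2 (fun x => f' x * sin (t * x)) (K * s)) as [Y' [HY' _]]; auto; [apply cts_mult; auto|intros x; eapply Rle_trans; [apply Bs|auto]|].
    (* Integration by parts exchanges the cosine and sine transforms, hence both are bounded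
       together. *)
    assert (EX : X' = t * Y).
    { assert (Hz : cvg (fun x => f' x * cos (t * x) + - t * (f x * sin (t * x))) 0).
      { apply (cvg_derive (fun x => f x * cos (t * x)) _ K); auto.
        - intros x. replace (f' x * cos (t * x) + - t * (f x * sin (t * x))) with (plus (mult (f' x) (cos (t * x))) (mult (f x) (- t * sin (t * x)))) by (unfold plus, mult; simpl; ring).
          apply (is_derive_mult (K := R_AbsRing) f (fun x => cos (t * x))); [apply Df| |intros; apply Rmult_comm]. auto_derive; auto. ring.
        - apply cts_plus; [apply cts_mult; auto|]. apply cts_mult; [apply cts_const|apply cts_mult; auto].
        - intros x. eapply Rle_trans; [apply Bc|auto]. }
      assert (Hz2 : cvg (fun x => f' x * cos (t * x) + - t * (f x * sin (t * x))) (X' + - t * Y)).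
      { apply cvg_plus; auto; [apply cts_mult; auto|apply cts_mult; [apply cts_const|apply cts_mult; auto]|]. apply cvg_scal; auto. apply cts_mult; auto. }
      pose proof (cvg_unique _ _ _ Hz Hz2). lra. }
    assert (EY : Y' = - t * X).
    { assert (Hz : cvg (fun x => f' x * sin (t * x) + t * (f x * cos (t * x))) 0).
      { apply (cvg_derive (fun x => f x * sin (t * x)) _ K); auto.
        - intros x. replace (f' x * sin (t * x) + t * (f x * cos (t * x))) with (plus (mult (f' x) (sin (t * x))) (mult (f x) (t * cos (t * x)))) by (unfold plus, mult; simpl; ring).
          apply (is_derive_mult (K := R_AbsRing) f (fun x => sin (t * x))); [apply Df| |intros; apply Rmult_comm]. auto_derive; auto. ring.
        - apply cts_plus; [apply cts_mult; auto|]. apply cts_mult; [apply cts_const|apply cts_mult; auto].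
        - intros x. eapply Rle_trans; [apply Bs|auto]. }
      assert (Hz2 : cvg (fun x => f' x * sin (t * x) + t * (f x * cos (t * x))) (Y' + t * X)).
      { apply cvg_plus; auto; [apply cts_mult; auto|apply cts_mult; [apply cts_const|apply cts_mult; auto]|]. apply cvg_scal; auto. apply cts_mult; auto. }
      pose proof (cvg_unique _ _ _ Hz Hz2). lra. }
    pose proof (IHk f' (K * s) HKs Bf X' Y' HX' HY') as IH.
    rewrite EX, EY, !Rabs_mult, Rabs_Ropp in IH.
    apply Rmult_le_reg_l with (Rabs t); auto.
    replace (Rabs t * (2 * PI * K * (s / Rabs t) ^ S k)) with (2 * PI * (K * s) * (s / Rabs t) ^ k) by (simpl; field; lra). lra.
Qed.

(** A Paley-Wiener statement by real methods: the bound of [fourier_decay] holds after any number of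
    integrations by parts, and [(s/|t|)^k] tends to 0. *)
Lemma fourier_vanish t s f K : 0 <= s < Rabs t -> 0 <= K -> (forall n, deriv_bound n (wt 2) s f K) ->
  cvg (fun x => f x * cos (t * x)) 0 /\ cvg (fun x => f x * sin (t * x)) 0.
Proof.
  intros Hs HK Hf. assert (Ht : t <> 0) by (intros ->; rewrite Rabs_R0 in Hs; lra).
  assert (Cf : cts f) by (destruct (Hf 1%nat) as [_ [f' [Df _]]]; apply (cts_derive f f'); auto).
  pose proof (deriv_bound_0 _ _ _ _ _ (Hf 0%nat)) as B0.
  destruct (cvg_wt2 (fun x => f x * cos (t * x)) K) as [X [HX _]]; auto.
  { apply cts_mult; auto. intros x. apply (ex_derive_continuous (K := R_AbsRing) (V := R_NormedModule)). auto_derive. auto. }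
  { intros x. eapply Rle_trans; [|apply B0]. rewrite Rabs_mult. rewrite <- (Rmult_1_r (Rabs (f x))) at 2. apply Rmult_le_compat_l; [apply Rabs_pos|]. apply Rabs_le, COS_bound. }
  destruct (cvg_wt2 (fun x => f x * sin (t * x)) K) as [Y [HY _]]; auto.
  { apply cts_mult; auto. intros x. apply (ex_derive_continuous (K := R_AbsRing) (V := R_NormedModule)). auto_derive. auto. }
  { intros x. eapply Rle_trans; [|apply B0]. rewrite Rabs_mult. rewrite <- (Rmult_1_r (Rabs (f x))) at 2. apply Rmult_le_compat_l; [apply Rabs_pos|]. apply Rabs_le, SIN_bound. }
  assert (H0 : Rabs X + Rabs Y <= 0).
  { apply le_epsilon. intros e He. rewrite Rplus_0_l.
    assert (Hq : 0 <= s / Rabs t < 1).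
    { split; [apply Rdiv_le_0_compat; lra|]. apply Rmult_lt_reg_r with (Rabs t); [lra|]. unfold Rdiv. rewrite Rmult_assoc, Rinv_l; lra. }
    destruct (pow_lt_1_zero (s / Rabs t) ltac:(rewrite Rabs_right; lra) (e / (2 * PI * K + 1))) as [N HN].
    { apply Rdiv_lt_0_compat; auto. pose proof PI_RGT_0. nra. }
    specialize (HN N (Nat.le_refl N)). rewrite Rabs_right in HN by (apply Rle_ge, pow_le; lra).
    pose proof (fourier_decay t s ltac:(lra) Ht N f K HK Hf X Y HX HY) as HB.
    pose proof PI_RGT_0. assert (0 <= 2 * PI * K) by (apply Rmult_le_pos; lra).
    apply Rmult_lt_compat_l with (r := 2 * PI * K + 1) in HN; [|lra].
    replace ((2 * PI * K + 1) * (e / (2 * PI * K + 1))) with e in HN by (field; lra).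
    pose proof (pow_le (s / Rabs t) N ltac:(lra)). nra. }
  pose proof (Rabs_pos X). pose proof (Rabs_pos Y).
  assert (X = 0) by (apply Rabs_eq_0; lra). assert (Y = 0) by (apply Rabs_eq_0; lra). subst. auto.
Qed.

Lemma is_RInt_gen_pair (f g : R -> R) l m : cts f -> cts g -> cvg f l -> cvg g m ->
  is_RInt_gen (V := C_R_CompleteNormedModule) (fun x => (f x, g x) : C) over_R over_R' ((l, m) : C).
Proof.
  intros Cf Cg Hf Hg P [e He]. apply filter_R_iff.
  destruct (Hf e (cond_pos e)) as [M1 P1]. destruct (Hg e (cond_pos e)) as [M2 P2].
  exists (Rmax M1 M2). intros a b Ha Hb. pose proof (Rmax_l M1 M2). pose proof (Rmax_r M1 M2).
  exists ((RInt f a b, RInt g a b) : C). split.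
  - simpl. apply (is_RInt_fct_extend_pair (U := R_NormedModule) (V := R_NormedModule)); simpl; apply (RInt_correct (V := R_CompleteNormedModule)); apply ex_RInt_cont; auto.
  - apply He. split; [apply (P1 a b); lra|apply (P2 a b); lra].
Qed.

Lemma fourier_supp phi D s K : 0 <= s < 2 * PI * D -> 0 <= K -> (forall n, deriv_bound n (wt 2) s phi K) -> fourier_supp_in phi D.
Proof.
  intros Hs HK Hb y Hy. pose proof PI_RGT_0 as Hpi. apply NNPP. intros N.
  assert (Hyb : D <= Rabs y). { apply Rnot_lt_le. intros HH. apply N. apply Rabs_def2 in HH. lra. }
  (* Within this distance of a [y] with [|y| >= D], every frequency still exceeds [s / (2 PI)], so
     the transform vanishes in a neighbourhood, as a statement about the closed support demands. *)
  set (e := D - s / (2 * PI)).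
  assert (He : 0 < e). { unfold e. apply Rmult_lt_reg_r with (2*PI); [lra|]. replace ((D - s / (2 * PI)) * (2 * PI)) with (2 * PI * D - s) by (field; lra). lra. }
  destruct (Hy e He) as [y' [Hyy Hne]]. apply Hne.
  assert (Hy2 : s < Rabs (2 * PI * y')).
  { rewrite Rabs_mult, (Rabs_right (2*PI)) by lra.
    assert (s / (2*PI) < Rabs y').
    { assert (Rabs y <= Rabs (y' - y) + Rabs y'). { replace y with (- (y' - y) + y') at 1 by ring. eapply Rle_trans; [apply Rabs_triang|]. rewrite Rabs_Ropp. lra. }
      unfold e in Hyy. lra. }
    apply Rmult_lt_compat_l with (r := 2 * PI) in H; [|lra]. replace (2 * PI * (s / (2*PI))) with s in H by (field; lra). auto. }
  destruct (fourier_vanish (2 * PI * y') s phi K ltac:(lra) HK Hb) as [H1 H2].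
  assert (Cf : cts phi) by (destruct (Hb 1%nat) as [_ [f' [Df _]]]; apply (cts_derive phi f'); auto).
  unfold fourier. apply (is_RInt_gen_unique (V := C_R_CompleteNormedModule)).
  assert (Ccos : cts (fun x => cos (2 * PI * y' * x))). { intros x. apply (ex_derive_continuous (K := R_AbsRing) (V := R_NormedModule)). auto_derive. auto. }
  assert (Csin : cts (fun x => sin (2 * PI * y' * x))). { intros x. apply (ex_derive_continuous (K := R_AbsRing) (V := R_NormedModule)). auto_derive. auto. }
  assert (HG : is_RInt_gen (V := C_R_CompleteNormedModule) (fun x => (phi x * cos (2 * PI * y' * x), -1 * (phi x * sin (2 * PI * y' * x))) : C) over_R over_R' ((0, -1 * 0) : C)).
  { apply is_RInt_gen_pair; auto.
    - apply cts_mult; auto.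
    - apply cts_mult; [apply cts_const|apply cts_mult; auto].
    - apply cvg_scal; auto. apply cts_mult; auto. }
  replace (RtoC 0) with ((0, -1 * 0) : C) by (apply C_eq; simpl; ring).
  eapply is_RInt_gen_ext; [|apply HG].
  apply filter_R_iff. exists 0. intros a b _ _ x _. unfold cexp. simpl.
  rewrite exp_0, !Rmult_1_l. replace (-2 * PI * x * y') with (- (2 * PI * y' * x)) by ring. rewrite cos_neg, sin_neg.
  apply C_eq; simpl; ring.
Qed.

(** * The weights and the Hilbert spaces *)

Lemma sinc2pi_snc x : sinc2pi x = snc (2 * PI * x).
Proof.
  pose proof PI_RGT_0. unfold sinc2pi. destruct (Req_EM_T x 0) as [->|Hx].
  - rewrite Rmult_0_r, snc_0. auto.
  - rewrite <- snc_sin. field. lra.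
Qed.

Lemma snc_lt_1 u : u <> 0 -> Rabs (snc u) < 1.
Proof.
  intros Hu.
  assert (Hp : forall v, 0 < v -> Rabs (snc v) < 1).
  { intros v Hv. apply Rmult_lt_reg_l with v; auto. rewrite <- (Rabs_right v) at 1 by lra. rewrite <- Rabs_mult, snc_sin, Rmult_1_r.
    apply Rabs_def1; [apply sin_lt_x; auto|].
    destruct (Rlt_le_dec v 1) as [H1|H1].
    - assert (0 < sin v); [|lra]. apply sin_gt_0; auto. pose proof PI2_1. lra.
    - destruct H1 as [H1| <-]; [pose proof (SIN_bound v); lra|]. assert (0 < sin 1); [|lra]. apply sin_gt_0; pose proof PI2_1; lra. }
  destruct (Rlt_le_dec u 0).
  - rewrite <- snc_even. apply Hp. lra.
  - apply Hp. lra.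
Qed.

Lemma cts_snc : cts snc.
Proof. apply (cts_derive snc (snc_deriv 1)). intros; apply snc_deriv_derive. Qed.

Lemma cts_W G : cts (Wac G).
Proof.
  assert (Cs : cts (fun x => sinc2pi x)).
  { apply (cts_ext (fun x => snc (2 * PI * x))); [intros; symmetry; apply sinc2pi_snc|].
    apply (cts_comp snc); [apply cts_snc|]. apply cts_mult; [apply cts_const|apply cts_id]. }
  destruct G; simpl; [apply cts_const|apply cts_minus; auto; apply cts_const|apply cts_const|apply cts_plus; auto; apply cts_const|apply cts_minus; auto; apply cts_const].
Qed.

Lemma sinc_abs x : -1 <= sinc2pi x <= 1.
Proof. rewrite sinc2pi_snc. apply Rabs_le_between, snc_abs. Qed.

Lemma W_bounds G x : 0 <= Wac G x <= 2.
Proof. pose proof (sinc_abs x). destruct G; simpl; lra. Qed.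

Lemma W_even G x : Wac G (- x) = Wac G x.
Proof.
  assert (sinc2pi (- x) = sinc2pi x). { rewrite !sinc2pi_snc. replace (2 * PI * - x) with (- (2 * PI * x)) by ring. apply snc_even. }
  destruct G; simpl; rewrite ?H; auto.
Qed.

Lemma W_pos G x : x <> 0 -> 0 < Wac G x.
Proof.
  intros Hx. pose proof PI_RGT_0.
  assert (Rabs (sinc2pi x) < 1). { rewrite sinc2pi_snc. apply snc_lt_1. apply Rmult_integral_contrapositive_currified; auto; lra. }
  apply Rabs_def2 in H0. destruct G; simpl; lra.
Qed.

(** For [SSp] and [SSOodd] the density vanishes at 0, so weighted and unweighted integrals are
    compared away from 0. There [|2 pi x| >= 2] bounds the sine quotient by [1/2]. *)
Lemma W_half G x : 1 <= Rabs x -> 1/2 <= Wac G x.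
Proof.
  intros Hx. pose proof PI2_1 as Hpi.
  assert (Rabs (sinc2pi x) <= 1/2).
  { rewrite sinc2pi_snc. set (u := 2 * PI * x).
    assert (Hu : 2 <= Rabs u). { unfold u. rewrite Rabs_mult, (Rabs_right (2*PI)) by lra. nra. }
    assert (Rabs u * Rabs (snc u) <= 1). { rewrite <- Rabs_mult, snc_sin. apply Rabs_le, SIN_bound. }
    pose proof (Rabs_pos (snc u)). nra. }
  apply Rabs_le_between in H. destruct G; simpl; lra.
Qed.

(** On the compact part [f] is bounded, hence below a multiple of the integrable [1 / (1 + x^2)];
    the comparison with [g] has to be checked far out, where zeros of the weight or of a denominator
    do not interfere. *)
Lemma dom_outside (f g : R -> R) R0 lg : cts f -> cts g -> 0 <= R0 -> (forall x, 0 <= f x) -> (forall x, 0 <= g x) ->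
  (forall x, R0 <= Rabs x -> f x <= g x) -> cvg g lg -> exists l, cvg f l.
Proof.
  intros Cf Cg HR Hf Hg Hd Hl.
  destruct (continuity_ab_maj f (-R0) R0 ltac:(lra)) as [m [Hm _]]. { intros c _. apply continuity_pt_filterlim. apply Cf. }
  set (B := f m * (1 + R0^2)). assert (HB : 0 <= B). { unfold B. apply Rmult_le_pos; [auto|nra]. }
  destruct (cvg_dom f (fun x => g x + B * / (1 + x^2)) (lg + B * PI)) as [l [Hc _]]; auto.
  - apply cts_plus; auto. apply cts_mult; [apply cts_const|apply cts_inv2].
  - intros x. rewrite Rabs_right by (apply Rle_ge; auto).
    assert (Hi : 0 < / (1 + x^2)) by (apply Rinv_0_lt_compat; nra).
    destruct (Rle_lt_dec R0 (Rabs x)) as [H|H].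
    + specialize (Hd x H). assert (0 <= B * / (1+x^2)) by (apply Rmult_le_pos; lra). lra.
    + assert (Hfx : f x <= f m). { apply Hm. apply Rabs_def2 in H. lra. }
      assert (f m <= B * / (1+x^2)).
      { apply Rmult_le_reg_r with (1 + x^2); [nra|]. rewrite Rmult_assoc, Rinv_l, Rmult_1_r by nra. unfold B.
        apply Rmult_le_compat_l; auto. assert (x^2 <= R0^2) by (rewrite <- (pow2_abs x); apply pow_incr; split; [apply Rabs_pos|lra]). lra. }
      specialize (Hg x). lra.
  - apply cvg_plus; auto; [apply cts_mult; [apply cts_const|apply cts_inv2]|]. apply cvg_scal; [apply cts_inv2|apply cvg_atan].
  - exists l. auto.
Qed.

Lemma ccont_RtoC F : entire F -> ccont (fun x => F (RtoC x)).
Proof.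
  intros HF. apply (entire_ccont F RtoC HF). intros t. split; simpl; [apply continuous_id|apply continuous_const].
Qed.

Lemma is_RInt_gen_Re (f : R -> C) (l : C) : cts (fun x => Re (f x)) ->
  is_RInt_gen (V := prod_NormedModule R_AbsRing R_NormedModule R_NormedModule) f over_R over_R' l ->
  cvg (fun x => Re (f x)) (Re l).
Proof.
  intros Cf H e He.
  assert (HL : locally (T := prod_UniformSpace R_UniformSpace R_UniformSpace) l (fun y => Rabs (Re y - Re l) < e)).
  { exists (mkposreal e He). intros y [Hy _]. exact Hy. }
  specialize (H _ HL). apply filter_R_iff in H. destruct H as [M HM]. exists M. intros a b Ha Hb.
  destruct (HM a b Ha Hb) as [y [Hy1 Hy2]]. simpl in Hy1.
  apply (is_RInt_fct_extend_fst (U := R_NormedModule) (V := R_NormedModule)) in Hy1.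
  change (is_RInt (fun t => Re (f t)) a b (Re y)) in Hy1. rewrite (is_RInt_unique _ _ _ _ Hy1). auto.
Qed.

Lemma in_space_intro G tau F : entire F -> exp_type_le F tau -> (exists l, cvg (fun x => Cmod (F (RtoC x)) ^ 2 * Wac G x) l) ->
  in_space G tau F.
Proof.
  intros HF HE [l Hl]. split; auto. split; auto. exists l. apply is_RInt_gen_cvg; auto.
  apply cts_mult; [|apply cts_W]. apply (cts_ext (fun x => Re (F (RtoC x)) ^ 2 + Im (F (RtoC x)) ^ 2)).
  { intros x. symmetry. apply Cmod_Re_Im. }
  simpl. apply cts_plus; repeat apply cts_mult; try apply cts_const; intros x; apply (ccont_RtoC F HF).
Qed.

Lemma in_space_cvg G tau F : in_space G tau F -> exists l, cvg (fun x => (Re (F (RtoC x)) ^ 2 + Im (F (RtoC x)) ^ 2) * Wac G x) l.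
Proof.
  intros (HF & _ & [l Hl]). exists l. apply is_RInt_gen_cvg.
  - apply cts_mult; [|apply cts_W]. simpl. apply cts_plus; repeat apply cts_mult; try apply cts_const; intros x; apply (ccont_RtoC F HF).
  - eapply is_RInt_gen_ext; [|apply Hl]. apply filter_R_iff. exists 0. intros a b _ _ x _. rewrite Cmod_Re_Im. auto.
Qed.

(** * The extremal function attached to the kernel *)

Lemma sq_sum_nonneg a b : 0 <= a ^ 2 + b ^ 2.
Proof. pose proof (pow2_ge_0 a). pose proof (pow2_ge_0 b). lra. Qed.

Section Kernel.
Variables (G : symtype) (tau : R) (K : C -> C -> C).
Hypothesis Htau : 0 < tau.
Hypothesis HK : repr_kernel G tau K.

Let Kf := K Ci.
Let u (x : R) : R := Re (Kf (RtoC x)).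
Let v (x : R) : R := Im (Kf (RtoC x)).
Let W := Wac G.

Lemma Kf_space : in_space G tau Kf.
Proof. apply (HK Ci). Qed.

Lemma Kf_entire : entire Kf.
Proof. apply Kf_space. Qed.

Lemma cts_u : cts u.
Proof. intros x. apply (ccont_RtoC Kf Kf_entire). Qed.
Lemma cts_v : cts v.
Proof. intros x. apply (ccont_RtoC Kf Kf_entire). Qed.

Lemma Kf_L2 : exists l, cvg (fun x => (u x ^ 2 + v x ^ 2) * W x) l.
Proof. apply (in_space_cvg G tau Kf Kf_space). Qed.

Lemma reproduce F : in_space G tau F ->
  cvg (fun x => (Re (F (RtoC x)) * u x + Im (F (RtoC x)) * v x) * W x) (Re (F Ci)).
Proof.
  intros HF. destruct (HK Ci) as [_ H]. specialize (H F HF).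
  apply is_RInt_gen_Re in H.
  - eapply cvg_ext; [|apply H]. intros x. cbv beta. rewrite re_scal_r, re_mult, re_conj, im_conj. fold Kf. unfold u, v, W. ring.
  - apply (cts_ext (fun x => (Re (F (RtoC x)) * u x + Im (F (RtoC x)) * v x) * W x)).
    + intros x. rewrite re_scal_r, re_mult, re_conj, im_conj. fold Kf. unfold u, v, W. ring.
    + apply cts_mult; [|apply cts_W]. destruct HF as [HF _].
      apply cts_plus; apply cts_mult; try apply cts_u; try apply cts_v; intros x; apply (ccont_RtoC F HF).
Qed.

Lemma Kf_coef : exists k, (forall z, is_cpseries k z (Kf z)) /\ forall e, 0 < e -> coef_type (tau + e) k.
Proof. destruct Kf_space as (H1 & H2 & _). apply exp_type_coef; auto. Qed.

(* [Kf^#(z) = conj (Kf (- conj z))] is again a reproducing kernel at [i], so the difference has norm 0. *)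
Lemma Kf_symmetric x : x <> 0 -> u (- x) = u x /\ v (- x) = - v x.
Proof.
  intros Hx. destruct Kf_coef as [k [Hk Hkc]].
  (* The Taylor coefficients of [Kf - Kf^#]: conjugation and [z -> - z] turn [k n] into [(-1)^n]
     times its conjugate. *)
  set (d := fun n => (k n - RtoC ((-1)^n) * Cconj (k n))%C).
  assert (Hd : forall e, 0 < e -> coef_type (tau + e) d).
  { intros e He. destruct (Hkc e He) as [M [HM H]]. exists (2 * M). split; [lra|]. intros n. unfold d.
    assert (Cmod (k n - RtoC ((-1) ^ n) * Cconj (k n))%C <= 2 * Cmod (k n)).
    { unfold Cminus. eapply Rle_trans; [apply Cmod_triangle|]. rewrite Cmod_opp, Cmod_mult, Cmod_R, Cmod_conj, pow_1_abs. lra. }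
    specialize (H n). pose proof (fact_pos n). apply Rmult_le_compat_r with (r := INR (fact n)) in H0; lra. }
  destruct (Hd 1 Rlt_0_1) as [M [HM HMb]].
  assert (HRe : forall y, Re (cpseries d (RtoC y)) = u y - u (- y)).
  { intros y. destruct (coef_type_series d _ M (RtoC y) HMb) as [[H1 _] _].
    rewrite <- (is_series_unique _ _ H1). apply is_series_unique.
    destruct (Hk (RtoC y)) as [H2 _]. destruct (Hk (RtoC (- y))) as [H3 _].
    eapply is_series_ext; [|apply is_series_Rminus; [apply H2|apply H3]].
    intros n. unfold d. rewrite !Re_mul_powR. unfold Cminus. rewrite re_plus, re_opp, re_scal_l, re_conj.
    replace (- y) with (-1 * y) by ring. rewrite Rpow_mult_distr. as_R_eq. ring. }
  assert (HIm : forall y, Im (cpseries d (RtoC y)) = v y + v (- y)).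
  { intros y. destruct (coef_type_series d _ M (RtoC y) HMb) as [[_ H1] _].
    rewrite <- (is_series_unique _ _ H1). apply is_series_unique.
    destruct (Hk (RtoC y)) as [_ H2]. destruct (Hk (RtoC (- y))) as [_ H3].
    eapply is_series_ext; [|apply is_series_Rplus; [apply H2|apply H3]].
    intros n. unfold d. rewrite !Im_mul_powR. unfold Cminus. rewrite im_plus, im_opp, im_scal_l, im_conj.
    replace (- y) with (-1 * y) by ring. rewrite Rpow_mult_distr. as_R_eq. ring. }
  (* The point [i] is fixed by [z -> - conj z], so the two functions take conjugate values there and
     the difference is purely imaginary. *)
  assert (HDi : Re (cpseries d Ci) = 0).
  { destruct (coef_type_series d _ M Ci HMb) as [[H1 _] _]. rewrite <- (is_series_unique _ _ H1).
    rewrite (Series_ext _ (fun n => 0 * 0)); [rewrite Series_scal_l; ring|].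
    intros n. rewrite Rmult_0_l. unfold d.
    assert (Hi : (RtoC ((-1)^n) * Ci ^ n)%C = Cconj (Ci ^ n)).
    { rewrite Cpow_conj, RtoC_pow, <- Cpow_mult_l. f_equal. apply C_eq; simpl; ring. }
    replace ((k n - RtoC ((-1) ^ n) * Cconj (k n)) * Ci ^ n)%C with (k n * Ci ^ n - Cconj (k n) * (RtoC ((-1)^n) * Ci ^ n))%C by ring.
    rewrite Hi, <- Cmult_conj. unfold Cminus. rewrite re_plus, re_opp, re_conj. ring. }
  assert (Cr : cts (fun y => u (- y))). { apply (cts_comp u (fun y => - y)); [apply cts_u|]. apply (cts_ext (fun y => -1 * y)); [intros; ring|apply cts_mult; [apply cts_const|apply cts_id]]. }
  assert (Cvr : cts (fun y => v (- y))). { apply (cts_comp v (fun y => - y)); [apply cts_v|]. apply (cts_ext (fun y => -1 * y)); [intros; ring|apply cts_mult; [apply cts_const|apply cts_id]]. }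
  pose proof cts_u as Cu. pose proof cts_v as Cv. pose proof (cts_W G : cts W) as CW.
  assert (Wev : forall y, W (- y) = W y) by (intros; apply W_even).
  assert (W0 : forall y, 0 <= W y) by (intros; apply W_bounds).
  destruct Kf_L2 as [l Hl].
  assert (CK2 : cts (fun x => (u x ^ 2 + v x ^ 2) * W x)).
  { apply cts_mult; auto. simpl. apply cts_plus; repeat apply cts_mult; auto; apply cts_const. }
  pose proof (cvg_reflect _ _ CK2 Hl) as Hlr.
  assert (HDs : in_space G tau (cpseries d)).
  { apply in_space_intro.
    - apply (cpseries_entire d (tau + 1)); [lra|]. apply Hd. lra.
    - apply cpseries_exp_type; auto.
    - destruct (cvg_dom (fun x => Cmod (cpseries d (RtoC x)) ^ 2 * Wac G x)
        (fun x => 2 * ((u x ^ 2 + v x ^ 2) * W x + (u (- x) ^ 2 + v (- x) ^ 2) * W (- x))) (2 * (l + l))) as [m [Hm _]].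
      + apply (cts_ext (fun x => ((u x - u (-x))^2 + (v x + v (-x))^2) * W x)).
        { intros y. rewrite Cmod_Re_Im, HRe, HIm. reflexivity. }
        apply cts_mult; auto. simpl. apply cts_plus; repeat apply cts_mult; try apply cts_const; try apply cts_minus; try apply cts_plus; auto.
      + apply cts_mult; [apply cts_const|]. apply cts_plus; auto. apply cts_mult; [|apply (cts_ext W); auto].
        simpl. apply cts_plus; repeat apply cts_mult; auto; apply cts_const.
      + intros y. rewrite Cmod_Re_Im, HRe, HIm, Wev. fold W. pose proof (W0 y).
        rewrite Rabs_right. 2:{ apply Rle_ge, Rmult_le_pos; auto. apply sq_sum_nonneg. }
        replace (2 * ((u y ^ 2 + v y ^ 2) * W y + (u (- y) ^ 2 + v (- y) ^ 2) * W y)) with ((2 * (u y ^ 2 + v y ^ 2 + u (- y) ^ 2 + v (- y) ^ 2)) * W y) by ring.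
        apply Rmult_le_compat_r; auto. pose proof (pow2_ge_0 (u y + u (-y))). pose proof (pow2_ge_0 (v y - v (-y))). nra.
      + apply cvg_scal; [|apply cvg_plus; auto].
        * apply cts_plus; auto. apply cts_mult; [|apply (cts_ext W); auto]. simpl. apply cts_plus; repeat apply cts_mult; auto; apply cts_const.
        * apply cts_mult; [|apply (cts_ext W); auto]. simpl. apply cts_plus; repeat apply cts_mult; auto; apply cts_const.
      + exists m. auto. }
  pose proof (reproduce (cpseries d) HDs) as HR. rewrite HDi in HR.
  (* The integrand of the reproducing identity for the difference. Adding its reflection completes
     it to the squared modulus of the difference times [W], whose integral is therefore 0. *)
  set (h := fun y => ((u y - u (- y)) * u y + (v y + v (- y)) * v y) * W y).
  assert (Hh : cvg h 0). { eapply cvg_ext; [|apply HR]. intros y. unfold h. rewrite HRe, HIm. auto. }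
  assert (Ch : cts h). { unfold h. apply cts_mult; auto. apply cts_plus; apply cts_mult; auto; [apply cts_minus|apply cts_plus]; auto. }
  pose proof (cvg_reflect h 0 Ch Hh) as Hhr.
  assert (Chr : cts (fun y => h (- y))).
  { apply (cts_comp h (fun y => - y)); auto. apply (cts_ext (fun y => -1 * y)); [intros; ring|apply cts_mult; [apply cts_const|apply cts_id]]. }
  pose proof (cvg_plus _ _ _ _ Ch Chr Hh Hhr) as Hs.
  assert (Es : forall y, h y + h (- y) = ((u y - u (- y))^2 + (v y + v (- y))^2) * W y).
  { intros y. unfold h. rewrite Wev, Ropp_involutive. ring. }
  apply (cvg_ext _ (fun y => ((u y - u (- y))^2 + (v y + v (- y))^2) * W y)) in Hs; auto.
  (* At 0 the density may vanish, and the integral says nothing about that point; this is why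
     [x <> 0] is assumed. *)
  assert (HW : 0 < W x) by (apply W_pos; auto).
  assert (Hz : (u x - u (- x))^2 + (v x + v (- x))^2 = 0).
  { apply NNPP. intros Hn. pose proof (pow2_ge_0 (u x - u (-x))). pose proof (pow2_ge_0 (v x + v (-x))).
    assert (0 < 0 + 0); [|lra]. eapply (cvg_pos (fun y => ((u y - u (- y))^2 + (v y + v (- y))^2) * W y) _ x); [| | |apply Hs].
    - apply (cts_ext (fun y => h y + h (- y))); auto. apply cts_plus; auto.
    - intros y. apply Rmult_le_pos; auto. apply sq_sum_nonneg.
    - apply Rmult_lt_0_compat; lra. }
  pose proof (pow2_ge_0 (u x - u (-x))). pose proof (pow2_ge_0 (v x + v (-x))).
  assert (E1 : (u x - u (-x))^2 = 0) by lra. assert (E2 : (v x + v (-x))^2 = 0) by lra.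
  assert (u x - u (-x) = 0) by nra.
  assert (v x + v (-x) = 0) by nra. split; lra.
Qed.

Let A (x : R) : R := u x + x * v x.

Lemma A_eq x : Re (Cmult (Cminus (RtoC 1) (Cmult Ci (RtoC x))) (K Ci (RtoC x))) = A x.
Proof. unfold A, u, v, Kf. destruct (K Ci (RtoC x)) as [p q]. simpl. ring. Qed.

Lemma A_even x : A (- x) = A x.
Proof.
  destruct (Req_dec x 0) as [->|Hx]; [rewrite Ropp_0; auto|].
  destruct (Kf_symmetric x Hx) as [H1 H2]. unfold A. rewrite H1, H2. ring.
Qed.

Lemma A_series : exists al, (forall e, 0 < e -> rcoef_type (tau + e) al) /\ forall x, A x = PSeries al x.
Proof.
  destruct Kf_coef as [k [Hk Hkc]].
  exists (PS_plus (fun n => Re (k n)) (PS_incr_1 (fun n => Im (k n)))). split.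
  - intros e He. destruct (Hkc (e/2) ltac:(lra)) as [M [HM H]].
    destruct (lin_geom (tau + e/2) (tau + e) ltac:(lra)) as [L [HL HLb]].
    exists ((M + M / (tau + e/2)) * L). assert (Hq : 0 <= M / (tau + e/2)) by (apply Rdiv_le_0_compat; lra).
    split; [apply Rmult_le_pos; lra|]. intros n. set (s := tau + e/2) in *.
    assert (Hs : 0 < s) by (unfold s; lra).
    assert (Hb : Rabs (PS_plus (fun n => Re (k n)) (PS_incr_1 (fun n => Im (k n))) n) * INR (fact n) <= M * s ^ n + M / s * (INR n * s ^ n)).
    { unfold PS_plus, plus; simpl. pose proof (fact_pos n).
      assert (H1 : Rabs (Re (k n)) * INR (fact n) <= M * s ^ n).
      { eapply Rle_trans; [|apply (H n)]. apply Rmult_le_compat_r; [lra|apply re_le_Cmod]. }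
      destruct n; simpl PS_incr_1.
      - unfold zero; simpl. rewrite Rplus_0_r. simpl in H1. lra.
      - assert (H2 : Rabs (Im (k n)) * INR (fact (S n)) <= M / s * (INR (S n) * s ^ S n)).
        { rewrite fact_simpl, mult_INR. pose proof (pos_INR (S n)). specialize (H n).
          assert (Rabs (Im (k n)) * INR (fact n) <= M * s ^ n). { eapply Rle_trans; [|apply H]. apply Rmult_le_compat_r; [left; apply fact_pos|apply im_le_Cmod]. }
          replace (M / s * (INR (S n) * s ^ S n)) with (INR (S n) * (M * s ^ n)) by (simpl pow; field; lra).
          replace (Rabs (Im (k n)) * (INR (S n) * INR (fact n))) with (INR (S n) * (Rabs (Im (k n)) * INR (fact n))) by ring.
          apply Rmult_le_compat_l; auto. }
        pose proof (Rabs_triang (Re (k (S n))) (Im (k n))).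
        apply Rmult_le_compat_r with (r := INR (fact (S n))) in H3; lra. }
    eapply Rle_trans; [apply Hb|]. specialize (HLb n). pose proof (pos_INR n). assert (0 < s ^ n) by (apply pow_lt; auto).
    rewrite Rmult_assoc. apply Rle_trans with ((M + M / s) * ((INR n + 1) * s ^ n)); [|apply Rmult_le_compat_l; lra].
    assert (0 <= M * (INR n * s^n)) by (apply Rmult_le_pos; auto; apply Rmult_le_pos; lra).
    assert (0 <= M / s * s^n) by (apply Rmult_le_pos; lra). lra.
  - intros x. destruct (is_cpseries_real k x _ (Hk (RtoC x))) as [H1 H2].
    rewrite PSeries_plus, PSeries_incr_1.
    + unfold A, u, v. rewrite (is_pseries_unique _ _ _ H1), (is_pseries_unique _ _ _ H2). auto.
    + eexists; apply H1.
    + apply ex_pseries_incr_1. eexists; apply H2.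
Qed.

Variable xi : R.
Hypothesis Hxi : 0 < xi.
Hypothesis HA0 : A xi = 0.
Hypothesis HA1 : A (xi / 2) <> 0.

(** Both zeros are divided out one after the other: [- xi] is a zero of the first quotient because
    [A] is even and [xi <> - xi]. *)
Lemma quotient_exists : exists b, (forall e, 0 < e -> rcoef_type (tau + e) b) /\ forall x, A x = (x^2 - xi^2) * PSeries b x.
Proof.
  destruct A_series as [al [Hal HA]].
  destruct (rcoef_type_divide (tau + 1) al xi) as [be [Hbe HB]]; [lra|apply Hal; lra|rewrite <- HA; auto|].
  destruct (rcoef_type_divide (tau + 1) be (- xi)) as [b [Hb HBb]]; [lra|apply Hbe; [lra|apply Hal; lra]| |].
  { pose proof (A_even xi) as He. rewrite HA0, HA, HB in He. nra. }
  exists b. split.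
  - intros e He. apply Hb; [lra|]. apply Hbe; [lra|]. apply Hal; auto.
  - intros x. rewrite HA, HB, HBb. ring.
Qed.

(** What the test function needs from [F0]: derivative rates just above [tau] and integrable tails
    for the passage to a Schwartz function, the balance identity and a positive mass for the sign of
    the integral. *)
Lemma extremal : exists F0 : R -> R, (forall x, F0 (- x) = F0 x) /\
  (forall sg, tau < sg -> exists M, 0 <= M /\ forall n, deriv_bound n unitw sg F0 M) /\
  (exists l, cvg (fun x => (1 + x^2) * F0 x ^ 2) l) /\
  cvg (fun x => (x^2 - xi^2) * F0 x ^ 2 * W x) 0 /\
  (exists m, 0 < m /\ cvg (fun x => F0 x ^ 2 * W x) m).
Proof.
  destruct quotient_exists as [b [Hb HAb]]. set (F0 := PSeries b) in *.
  assert (Hb1 : rcoef_type (tau + 1) b) by (apply Hb; lra).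
  assert (CF0 : cts F0) by (intros x; apply (rcoef_type_continuous (tau + 1)); auto).
  pose proof cts_u as Cu. pose proof cts_v as Cv. pose proof (cts_W G : cts W) as CW.
  assert (W0 : forall y, 0 <= W y) by (intros; apply W_bounds).
  assert (CA : cts A) by (unfold A; apply cts_plus; auto; apply cts_mult; auto; apply cts_id).
  assert (Csq : cts (fun x => x^2)) by (simpl; repeat apply cts_mult; try apply cts_id; apply cts_const).
  assert (CF2 : cts (fun x => F0 x ^ 2)) by (simpl; repeat apply cts_mult; auto; apply cts_const).
  assert (C1 : cts (fun x => 1 + x^2)) by (apply cts_plus; auto; apply cts_const).
  assert (Hpos2 : forall x, 0 <= (1 + x^2) * F0 x ^ 2). { intros x. apply Rmult_le_pos; [nra|apply pow2_ge_0]. }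
  assert (L2W : exists l, cvg (fun x => (1 + x^2) * F0 x ^ 2 * W x) l).
  { destruct Kf_L2 as [l Hl].
    assert (CK2 : cts (fun x => (u x ^ 2 + v x ^ 2) * W x)).
    { apply cts_mult; auto. simpl. apply cts_plus; repeat apply cts_mult; auto; apply cts_const. }
    (* For [|x| >= 2 xi + 1] one has [1 + x^2 <= 3 (x^2 - xi^2)]; its square gives the 9 once
       Cauchy-Schwarz bounds [A^2] by [(1 + x^2) (u^2 + v^2)]. *)
    apply (dom_outside _ (fun x => 9 * ((u x ^ 2 + v x ^ 2) * W x)) (2 * xi + 1) (9 * l)); try lra.
    - apply cts_mult; auto. apply cts_mult; auto.
    - apply cts_mult; [apply cts_const|auto].
    - intros x. apply Rmult_le_pos; auto.
    - intros x. apply Rmult_le_pos; [lra|]. apply Rmult_le_pos; auto. apply sq_sum_nonneg.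
    - intros x Hx. rewrite <- Rmult_assoc. apply Rmult_le_compat_r; auto.
      set (q := x^2 - xi^2).
      assert (Hq : 1 + x^2 <= 3 * q).
      { unfold q. rewrite <- (pow2_abs x). nra. }
      assert (HA2 : A x ^ 2 <= (1 + x^2) * (u x ^2 + v x ^2)). { unfold A. pose proof (pow2_ge_0 (x * u x - v x)). nra. }
      rewrite HAb in HA2. fold q in HA2.
      assert (Hqp : 0 < q) by nra. assert (Hx1 : 0 < 1 + x^2) by nra.
      apply Rmult_le_reg_l with (q^2); [nra|].
      replace (q ^ 2 * ((1 + x ^ 2) * F0 x ^ 2)) with ((1 + x^2) * (q * F0 x)^2) by ring.
      apply Rle_trans with ((1 + x^2) * ((1 + x^2) * (u x ^2 + v x ^2))); [apply Rmult_le_compat_l; lra|].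
      replace ((1 + x^2) * ((1 + x^2) * (u x ^2 + v x ^2))) with ((1+x^2)^2 * (u x ^2 + v x ^2)) by ring.
      replace (q ^ 2 * (9 * (u x ^ 2 + v x ^ 2))) with ((3 * q)^2 * (u x ^2 + v x ^2)) by ring.
      apply Rmult_le_compat_r; [apply sq_sum_nonneg|]. apply pow_incr. lra.
    - apply cvg_scal; auto. }
  assert (L2 : exists l, cvg (fun x => (1 + x^2) * F0 x ^ 2) l).
  { destruct L2W as [l Hl]. apply (dom_outside _ (fun x => 2 * ((1 + x^2) * F0 x ^ 2 * W x)) 1 (2 * l)); try lra; auto.
    - apply cts_mult; auto.
    - apply cts_mult; [apply cts_const|apply cts_mult; auto]. apply cts_mult; auto.
    - intros x. apply Rmult_le_pos; [lra|]. apply Rmult_le_pos; auto.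
    - intros x Hx. pose proof (W_half G x Hx). fold W in H. specialize (Hpos2 x). nra.
    - apply cvg_scal; auto. apply cts_mult; auto. apply cts_mult; auto. }
  exists F0. split; [|split; [|split; [|split]]].
  - assert (Hne : forall x, x <> xi -> x <> - xi -> F0 (- x) = F0 x).
    { intros x H1 H2. pose proof (A_even x) as He. rewrite !HAb in He.
      assert (Hq : x^2 - xi^2 <> 0). { replace (x^2 - xi^2) with ((x - xi) * (x + xi)) by ring. apply Rmult_integral_contrapositive_currified; lra. }
      replace ((- x)^2) with (x^2) in He by ring. apply Rmult_eq_reg_l in He; auto. }
    (* At [xi] and [- xi] the factor [x^2 - xi^2] cannot be cancelled; continuity fills the gap. *)
    assert (Hxx : F0 (- xi) = F0 xi).
    { apply Rminus_diag_uniq. apply NNPP. intros Hn.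
      set (g := fun x => F0 (- x) - F0 x).
      assert (Cg : cts g). { apply cts_minus; auto. apply (cts_comp F0 (fun y => - y)); auto. apply (cts_ext (fun y => -1 * y)); [intros; ring|apply cts_mult; [apply cts_const|apply cts_id]]. }
      destruct (continuous_eps_inv g xi (Cg xi) (Rabs (g xi)) ltac:(apply Rabs_pos_lt; auto)) as [dd [Hdd Hg]].
      set (y := xi + dd/2). specialize (Hg y ltac:(unfold y; replace (xi + dd/2 - xi) with (dd/2) by ring; rewrite Rabs_right; lra)).
      assert (g y = 0). { unfold g. rewrite Hne; [ring| |]; unfold y; lra. }
      rewrite H in Hg. unfold Rminus in Hg. rewrite Rplus_0_l, Rabs_Ropp in Hg. lra. }
    intros x. destruct (Req_dec x xi) as [->|H1]; auto. destruct (Req_dec x (- xi)) as [->|H2]; [rewrite Ropp_involutive; auto|auto].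
  - destruct L2 as [l Hl].
    (* [F0] is integrable because [|F0|] is at most the mean of [1/(1 + x^2)] and [(1 + x^2) F0^2],
       so its primitive is bounded and satisfies the hypothesis of [bernstein]. The bounds for [F0]
       follow from those for one derivative more. *)
    assert (Hprim : forall x, Rabs (PSeries (PS_Int b) x) <= (PI + l) / 2).
    { assert (HR : forall a c, a <= c -> Rabs (RInt F0 a c) <= (PI + l)/2).
      { intros a c Hac. eapply Rle_trans; [apply abs_RInt_le; auto; apply ex_RInt_cont; auto|].
        assert (Cab : cts (fun t => Rabs (F0 t))). { apply (cts_comp Rabs F0); auto. intros x. apply (continuous_abs x). }
        set (g := fun x => /2 * (/ (1 + x^2) + (1 + x^2) * F0 x ^ 2)).
        assert (Cg0 : cts (fun x => / (1 + x^2) + (1 + x^2) * F0 x ^ 2)) by (apply cts_plus; [apply cts_inv2|apply cts_mult; auto]).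
        assert (Cg : cts g) by (unfold g; apply cts_mult; [apply cts_const|auto]).
        apply Rle_trans with (RInt g a c).
        - apply RInt_leq; auto. intros x _. unfold g.
          assert (Hp : 0 < 1 + x^2) by nra. 
          set (y := Rabs (F0 x)). replace (F0 x ^ 2) with (y^2) by (unfold y; apply pow2_abs).
          apply Rmult_le_reg_r with (2 * (1 + x^2)); [lra|].
          replace (/ 2 * (/ (1 + x ^ 2) + (1 + x ^ 2) * y ^ 2) * (2 * (1 + x ^ 2))) with (1 + (1 + x^2)^2 * y^2) by (field; lra).
          pose proof (pow2_ge_0 ((1 + x^2) * y - 1)). lra.
        - assert (Hgc : cvg g (/2 * (PI + l))).
          { unfold g. apply cvg_scal; auto. apply cvg_plus; auto; [apply cts_inv2|apply cts_mult; auto|apply cvg_atan]. }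
          eapply Rle_trans; [apply (cvg_ge_part g _ a c Cg); eauto|lra].
          intros x. unfold g. assert (0 < / (1 + x^2)) by (apply Rinv_0_lt_compat; nra). specialize (Hpos2 x). lra. }
      intros x. rewrite <- RInt_PSeries by (apply (rcoef_type_radius (tau + 1)); auto). fold F0.
      destruct (Rle_lt_dec 0 x); [apply HR; auto|].
      rewrite <- (opp_RInt_swap (V := R_CompleteNormedModule)) by (apply ex_RInt_cont; auto).
      unfold opp; simpl. rewrite Rabs_Ropp. apply HR. lra. }
    assert (Hpc : forall e, 0 < e -> rcoef_type (tau + e) (PS_Int b)).
    { intros e He. destruct (Hb e He) as [M [HM H]]. exists (M / (tau + e)).
      assert (Hq : 0 <= M / (tau + e)) by (apply Rdiv_le_0_compat; lra). split; auto.
      intros n. destruct n.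
      - simpl. rewrite Rabs_R0. lra.
      - simpl PS_Int. change (match n with 0%nat => 1 | S _ => INR n + 1 end) with (INR (S n)).
        assert (Hn : 0 < INR (S n)) by (apply lt_0_INR; lia).
        unfold Rdiv at 1. rewrite Rabs_mult, Rabs_inv, (Rabs_right (INR (S n))), fact_simpl, mult_INR by lra.
        replace (Rabs (b n) * / INR (S n) * (INR (S n) * INR (fact n))) with (Rabs (b n) * INR (fact n)) by (field; lra).
        eapply Rle_trans; [apply H|]. right. simpl. field. lra. }
    intros sg Hsg.
    assert (Hl0 : 0 <= l). { eapply cvg_ge_0; [| |apply Hl]; auto. apply cts_mult; auto. }
    destruct (bernstein (PS_Int b) tau ((PI + l)/2) Htau Hpc ltac:(pose proof PI_RGT_0; lra) Hprim sg Hsg) as [M [HM HD]].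
    assert (Hder : forall x, is_derive (PSeries (PS_Int b)) x (F0 x)).
    { intros x. unfold F0. rewrite (PSeries_ext b (PS_derive (PS_Int b))).
      - apply (rcoef_type_is_derive (tau + 1)). apply Hpc. lra.
      - intros n. unfold PS_derive. simpl PS_Int. change (match n with 0%nat => 1 | S _ => INR n + 1 end) with (INR (S n)). field.
        apply not_0_INR. lia. }
    exists (M * sg). split; [apply Rmult_le_pos; lra|].
    assert (HbP : forall n, deriv_bound n unitw sg (PSeries (PS_Int b)) M).
    { apply Derive_n_deriv_bound.
      - intros k x. apply ex_derive_n_PSeries. apply (rcoef_type_radius (tau + 1)). apply Hpc. lra.
      - intros k x. unfold unitw. rewrite Rmult_1_r. auto. }
    intros n. destruct (HbP (S n)) as [_ [f' [Df Bf]]].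
    assert (E : f' = F0). { apply functional_extensionality. intros x. pose proof (is_derive_unique _ _ _ (Df x)) as E1. rewrite <- E1. apply is_derive_unique. auto. }
    rewrite <- E. exact Bf.
  - exact L2.
  - set (cb := fun n => RtoC (b n)).
    set (Gf := fun z => ((RtoC 1 + Ci * z) * cpseries cb z)%C).
    assert (Ecb : forall e, 0 < e -> coef_type (tau + e) cb) by (intros e He; apply rcoef_type_coef_type, Hb; auto).
    assert (Gx : forall x, Gf (RtoC x) = (F0 x, x * F0 x)).
    { intros x. unfold Gf, cb. rewrite (cpseries_real (tau + 1)) by auto. apply C_eq; unfold F0; simpl; ring. }
    assert (HG : in_space G tau Gf).
    { apply in_space_intro.
      - apply entire_mult; [apply entire_plus; [apply entire_const|apply entire_mult; [apply entire_const|apply entire_id]]|].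
        apply (cpseries_entire cb (tau + 1)); [lra|]. apply Ecb. lra.
      (* Half of [e] pays for the linear factor: [1 + |z| <= (1 + 2/e) exp (e |z| / 2)]. *)
      - intros e He. destruct (cpseries_exp_type cb tau Htau Ecb (e/2) ltac:(lra)) as [M HM]. exists ((1 + 2 / e) * M). intros z.
        unfold Gf. rewrite Cmod_mult. pose proof (Cmod_ge_0 z) as Hz.
        assert (H1 : Cmod (RtoC 1 + Ci * z)%C <= (1 + 2/e) * exp (e/2 * Cmod z)).
        { eapply Rle_trans; [apply Cmod_triangle|]. rewrite Cmod_mult, Cmod_Ci, Cmod_1.
          pose proof (exp_ineq1_le (e/2 * Cmod z)) as He1.
          assert (0 < 2/e) by (apply Rdiv_lt_0_compat; lra).
          apply Rle_trans with ((1 + 2/e) * (1 + e/2 * Cmod z)); [|apply Rmult_le_compat_l; lra].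
          replace ((1 + 2 / e) * (1 + e / 2 * Cmod z)) with (1 + Cmod z + 2/e + e/2 * Cmod z) by (field; lra). nra. }
        replace (exp ((tau + e) * Cmod z)) with (exp (e/2 * Cmod z) * exp ((tau + e/2) * Cmod z)) by (rewrite <- exp_plus; f_equal; field).
        replace ((1 + 2 / e) * M * (exp (e / 2 * Cmod z) * exp ((tau + e / 2) * Cmod z))) with
          (((1 + 2 / e) * exp (e / 2 * Cmod z)) * (M * exp ((tau + e / 2) * Cmod z))) by ring.
        apply Rmult_le_compat; try apply Cmod_ge_0; auto.
      - destruct L2W as [l Hl]. exists l. eapply cvg_ext; [|apply Hl]. intros x. rewrite Cmod_Re_Im, Gx. simpl. unfold W. ring. }
    pose proof (reproduce Gf HG) as HR.
    assert (E0 : Re (Gf Ci) = 0).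
    { unfold Gf. replace (RtoC 1 + Ci * Ci)%C with (RtoC 0) by (apply C_eq; simpl; ring). rewrite Cmult_0_l. reflexivity. }
    rewrite E0 in HR. eapply cvg_ext; [|apply HR]. intros x. cbv beta. rewrite Gx. simpl Re. simpl Im.
    replace (F0 x * u x + x * F0 x * v x) with (F0 x * A x) by (unfold A; ring). rewrite HAb. fold F0. ring.
  - destruct L2W as [l Hl].
    destruct (cvg_dom (fun x => F0 x ^ 2 * W x) (fun x => (1 + x^2) * F0 x ^ 2 * W x) l) as [m [Hm _]]; auto.
    + apply cts_mult; auto.
    + apply cts_mult; auto. apply cts_mult; auto.
    + intros x. rewrite Rabs_right by (apply Rle_ge, Rmult_le_pos; [apply pow2_ge_0|auto]). apply Rmult_le_compat_r; auto.
      pose proof (pow2_ge_0 (F0 x)). nra.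
    (* The mass is positive because [F0 (xi/2) <> 0], at a point where the density does not
       vanish. *)
    + exists m. split; auto. apply (cvg_pos (fun x => F0 x ^ 2 * W x) m (xi/2)); auto.
      * apply cts_mult; auto.
      * intros x. apply Rmult_le_pos; [apply pow2_ge_0|auto].
      * apply Rmult_lt_0_compat; [|apply W_pos; lra].
        assert (F0 (xi/2) <> 0). { intros E. apply HA1. rewrite HAb. fold F0. rewrite E. ring. }
        rewrite <- Rsqr_pow2. apply Rsqr_pos_lt. auto.
Qed.

End Kernel.

(** * The test function *)

Lemma deriv_bound_zero n w s K : 0 <= K -> 0 <= s -> (forall x, 0 <= w x) -> deriv_bound n w s (fun _ => 0) K.
Proof.
  intros HK Hs Hw. revert K HK. induction n; intros K HK; split; auto; try (intros x; rewrite Rabs_R0; apply Rmult_le_pos; auto).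
  exists (fun _ => 0). split; [intros; apply (is_derive_const (V := R_NormedModule))|]. apply IHn. apply Rmult_le_pos; auto.
Qed.

(** A polynomial factor has any prescribed positive rate, at the price of its constant: [2/e] and
    [2/e^2] pay for the first and second derivatives, and the third is 0. *)
Lemma deriv_bound_quadratic a e : 0 < e -> exists K, 0 <= K /\ forall n, deriv_bound n (fun x => (1 + Rabs x)^2) e (fun x => x^2 - a^2) K.
Proof.
  intros He. set (K := 1 + a^2 + 2 / e + 2 / e^2).
  assert (H1 : 0 < 2/e) by (apply Rdiv_lt_0_compat; lra).
  assert (H2 : 0 < 2/e^2) by (apply Rdiv_lt_0_compat; [lra|nra]).
  pose proof (pow2_ge_0 a).
  assert (HK : 0 <= K) by (unfold K; lra).
  assert (HK1 : 2 <= K * e). { unfold K. replace 2 with (2/e * e) at 1 by (field; lra). apply Rmult_le_compat_r; lra. }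
  assert (HK2 : 2 <= K * e * e). { unfold K. replace 2 with (2/e^2 * e * e) at 1 by (field; lra). repeat apply Rmult_le_compat_r; lra. }
  assert (Hw : forall x, 1 <= (1 + Rabs x)^2 /\ Rabs x <= (1 + Rabs x)^2 /\ x^2 <= (1+Rabs x)^2).
  { intros x. rewrite <- (pow2_abs x). pose proof (Rabs_pos x). nra. }
  exists K. split; auto. intros n.
  assert (B0 : forall x, Rabs (x^2 - a^2) <= K * (1 + Rabs x)^2).
  { intros x. destruct (Hw x) as (A1 & _ & A3). apply Rle_trans with ((1 + a^2) * (1 + Rabs x)^2).
    - pose proof (pow2_ge_0 x). apply Rabs_le. nra.
    - apply Rmult_le_compat_r; [lra|unfold K; lra]. }
  destruct n as [|n]; [split; auto|]. split; auto. exists (fun x => 2 * x). split.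
  { intros x. auto_derive; auto. ring. }
  assert (B1 : forall x, Rabs (2 * x) <= K * e * (1 + Rabs x)^2).
  { intros x. destruct (Hw x) as (A1 & A2 & _). rewrite Rabs_mult, (Rabs_right 2) by lra.
    apply Rmult_le_compat; try lra. apply Rabs_pos. }
  destruct n as [|n]; [split; auto|]. split; auto. exists (fun x => 2). split.
  { intros x. auto_derive; auto. ring. }
  assert (B2 : forall x, Rabs 2 <= K * e * e * (1 + Rabs x)^2).
  { intros x. destruct (Hw x) as (A1 & A2 & _). rewrite (Rabs_right 2) by lra.
    rewrite <- (Rmult_1_r 2) at 1. apply Rmult_le_compat; lra. }
  destruct n as [|n]; [split; auto|]. split; auto. exists (fun x => 0). split.
  { intros x. apply (is_derive_const (V := R_NormedModule)). }
  apply deriv_bound_zero; [|lra|intros x; apply pow2_ge_0]. repeat apply Rmult_le_pos; lra.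
Qed.

Lemma wt_scale_gen c m x : 0 < c -> wt m (c * x) <= (1 + 1/c) ^ m * wt m x.
Proof.
  intros Hc. unfold wt. pose proof (Rabs_pos x). rewrite Rabs_mult, (Rabs_right c) by lra.
  assert (0 < 1/c) by (apply Rdiv_lt_0_compat; lra).
  assert (Hcx : 0 <= c * Rabs x) by (apply Rmult_le_pos; lra).
  assert (0 < (1 + Rabs x)^m) by (apply pow_lt; lra). assert (0 < (1 + c * Rabs x)^m) by (apply pow_lt; lra).
  apply Rmult_le_reg_r with ((1 + Rabs x)^m * (1 + c * Rabs x)^m); [apply Rmult_lt_0_compat; auto|].
  replace (/ (1 + c * Rabs x) ^ m * ((1 + Rabs x) ^ m * (1 + c * Rabs x) ^ m)) with ((1 + Rabs x)^m) by (field; lra).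
  replace ((1 + 1 / c) ^ m * / (1 + Rabs x) ^ m * ((1 + Rabs x) ^ m * (1 + c * Rabs x) ^ m)) with (((1 + 1/c) * (1 + c * Rabs x))^m) by (rewrite Rpow_mult_distr; field; lra).
  apply pow_incr. split; [lra|]. replace ((1 + 1 / c) * (1 + c * Rabs x)) with (1 + Rabs x + 1/c + c * Rabs x) by (field; lra). lra.
Qed.

Lemma cvg_tail_ge f l r : 0 <= r -> cts f -> cvg f l -> (forall x, r <= Rabs x -> 0 <= f x) -> RInt f (-r) r <= l.
Proof.
  intros Hr Cf Hl Ht. apply le_epsilon. intros e He. destruct (Hl e He) as [M HM].
  set (T := Rmax M r). pose proof (Rmax_l M r). pose proof (Rmax_r M r). fold T in H, H0.
  specialize (HM (-T) T ltac:(lra) ltac:(lra)). apply Rabs_def2 in HM.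
  rewrite <- (RInt_ch f (-T) (-r) T), <- (RInt_ch f (-r) r T) in HM by auto.
  assert (0 <= RInt f (-T) (-r)). { apply RInt_ge_0; [lra|apply ex_RInt_cont; auto|]. intros x Hx. apply Ht. rewrite Rabs_left; lra. }
  assert (0 <= RInt f r T). { apply RInt_ge_0; [lra|apply ex_RInt_cont; auto|]. intros x Hx. apply Ht. rewrite Rabs_right; lra. }
  lra.
Qed.

Lemma cvg_tail_le f g l r T : 0 <= r -> cts f -> cts g -> cvg f l -> (forall x, r <= Rabs x -> f x <= g x) ->
  (forall b, r <= b -> RInt g (-b) (-r) + RInt g r b <= T) -> l <= RInt f (-r) r + T.
Proof.
  intros Hr Cf Cg Hl Ht HT. apply le_epsilon. intros e He. destruct (Hl e He) as [M HM].
  set (b := Rmax M r). pose proof (Rmax_l M r). pose proof (Rmax_r M r). fold b in H, H0.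
  specialize (HM (-b) b ltac:(lra) ltac:(lra)). apply Rabs_def2 in HM.
  rewrite <- (RInt_ch f (-b) (-r) b), <- (RInt_ch f (-r) r b) in HM by auto.
  assert (RInt f (-b) (-r) <= RInt g (-b) (-r)). { apply RInt_leq; [lra|exact Cf|exact Cg|]. intros x Hx. apply Ht. rewrite Rabs_left; lra. }
  assert (RInt f r b <= RInt g r b). { apply RInt_leq; [lra|exact Cf|exact Cg|]. intros x Hx. apply Ht. rewrite Rabs_right; lra. }
  specialize (HT b H0). lra.
Qed.

Section TestFunction.
Variables (G : symtype) (tau xi a : R) (F0 : R -> R).
Hypothesis Htau : 0 < tau.
Hypothesis Hxi : 0 < xi < a.
Hypothesis Hev : forall x, F0 (- x) = F0 x.
Hypothesis Hbern : forall sg, tau < sg -> exists M, 0 <= M /\ forall n, deriv_bound n unitw sg F0 M.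
Variable l : R.
Hypothesis HL2 : cvg (fun x => (1 + x^2) * F0 x ^ 2) l.
Hypothesis Hbal : cvg (fun x => (x^2 - xi^2) * F0 x ^ 2 * Wac G x) 0.
Variable m0 : R.
Hypothesis Hm0 : 0 < m0.
Hypothesis Hmass : cvg (fun x => F0 x ^ 2 * Wac G x) m0.

(* The dilation by [1 - de] makes room for the band of the factor that forces rapid decay. *)
Let ff (de x : R) : R := F0 ((1 - de) * x) * sinc_prod (tau / 4 * de * x).
Let ph (de x : R) : R := (x^2 - a^2) * (ff de x * ff de x).

Lemma cts_F0 : cts F0.
Proof. destruct (Hbern (tau + 1) ltac:(lra)) as [M [_ H]]. destruct (H 1%nat) as [_ [f' [Df _]]]. apply (cts_derive F0 f'). auto. Qed.

Lemma cts_P : cts sinc_prod.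
Proof. destruct (sinc_prod_deriv_bound_unitw 1) as [_ [f' [Df _]]]. apply (cts_derive _ f'). auto. Qed.

Lemma cts_lin c : cts (fun x => c * x).
Proof. apply cts_mult; [apply cts_const|apply cts_id]. Qed.

Lemma cts_sq : cts (fun x => x^2).
Proof. simpl. apply cts_mult; [apply cts_id|apply cts_mult; [apply cts_id|apply cts_const]]. Qed.

Lemma cts_ff de : cts (ff de).
Proof. unfold ff. apply cts_mult; [apply (cts_comp F0 (fun x => (1 - de) * x)); [apply cts_F0|apply cts_lin]|apply (cts_comp sinc_prod (fun x => tau/4*de*x)); [apply cts_P|apply cts_lin]]. Qed.

Lemma cts_ph de : cts (ph de).
Proof. unfold ph. apply cts_mult; [apply cts_minus; [apply cts_sq|apply cts_const]|apply cts_mult; apply cts_ff]. Qed.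

Lemma ph_deriv_bound de : 0 < de <= 1/2 -> exists s, 0 <= s < 2 * tau /\ forall m, exists K, 0 <= K /\
  forall n, deriv_bound n (fun x => (1 + Rabs x)^2 * (wt m x * wt m x)) s (ph de) K.
Proof.
  (* The bandwidth budget: each copy of [ff] uses [(1 - de) sg] from [F0] and [2 c = de tau / 2]
     from [sinc_prod], and the quadratic factor uses [de tau / 4]. The total is
     [2 tau - de tau / 4 - de^2 tau / 2], strictly below [2 tau]. *)
  intros Hde. set (sg := tau * (1 + de/4)).
  assert (Hsg : tau < sg) by (unfold sg; nra).
  destruct (Hbern sg Hsg) as [M [HM HMb]].
  set (c := tau / 4 * de). assert (Hc : 0 < c) by (unfold c; nra).
  destruct (deriv_bound_quadratic a (de * tau / 4)) as [Kq [HKq Hq]]; [nra|].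
  set (s := de * tau / 4 + (((1 - de) * sg + c * 2) + ((1 - de) * sg + c * 2))).
  exists s. split.
  { assert (X1 : 0 < de * tau <= tau / 2) by nra. assert (X2 : 0 < de * (de * tau) <= tau / 2) by nra.
    replace s with (2 * tau - de * tau / 4 - de * (de * tau) / 2) by (unfold s, sg, c; field). lra. }
  intros m. destruct (sinc_prod_deriv_bound_wt m) as [Kp [HKp Hp]].
  assert (Hff : forall n, deriv_bound n (wt m) ((1 - de) * sg + c * 2) (ff de) (M * Kp * (1 + 1/c)^m)).
  { intros n. pose proof (deriv_bound_scale n _ _ _ _ (1 - de) ltac:(lra) (HMb n)) as H1.
    pose proof (deriv_bound_scale n _ _ _ _ c ltac:(lra) (Hp n)) as H2.
    pose proof (deriv_bound_mult _ _ _ _ _ _ _ _ _ H1 H2) as H3.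
    eapply deriv_bound_weaken; [| | |apply H3].
    - apply Rmult_le_pos; auto.
    - split; [|lra]. assert (0 <= (1 - de) * sg) by (apply Rmult_le_pos; lra). lra.
    - intros x. rewrite Rmult_assoc. rewrite (Rmult_assoc (M * Kp)). rewrite <- (Rmult_assoc M Kp). apply Rmult_le_compat_l; [apply Rmult_le_pos; auto|].
      unfold unitw. rewrite Rmult_1_l. apply wt_scale_gen. auto. }
  set (L := M * Kp * (1 + 1/c)^m) in *.
  exists (Kq * (L * L)). split; [apply Rmult_le_pos; auto; nra|].
  intros n. pose proof (deriv_bound_mult _ _ _ _ _ _ _ _ _ (Hff n) (Hff n)) as H1.
  exact (deriv_bound_mult _ _ _ _ _ _ _ _ _ (Hq n) H1).
Qed.

Lemma wt_square_le m x : (1 + Rabs x)^2 * (wt (S m) x * wt (S m) x) <= wt m x * wt m x.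
Proof.
  unfold wt. pose proof (Rabs_pos x). right. simpl. field. split; [|lra]. apply pow_nonzero; lra.
Qed.

Lemma wt_le_1 m x : wt m x <= 1.
Proof.
  unfold wt. rewrite <- Rinv_1. apply Rinv_le_contravar; [lra|]. apply pow_R1_Rle. pose proof (Rabs_pos x). lra.
Qed.

Lemma ph_schwartz de : 0 < de <= 1/2 -> schwartz (ph de).
Proof.
  intros Hde. destruct (ph_deriv_bound de Hde) as [s [Hs Hb]]. split.
  - destruct (Hb 0%nat) as [K [HK H]]. apply (deriv_bound_Derive_n _ _ _ _ H).
  - intros k m. destruct (Hb (S m)) as [K [HK H]]. destruct (deriv_bound_Derive_n _ _ _ _ H) as [_ HD].
    exists (K * s ^ k). intros x. specialize (HD k x).
    assert (Hks : 0 <= K * s ^ k) by (apply Rmult_le_pos; auto; apply pow_le; lra).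
    rewrite Rabs_mult. pose proof (Rabs_pos x). pose proof (wt_pos m x). pose proof (wt_le_1 m x). pose proof (wt_square_le m x).
    assert (Hx : Rabs (x ^ m) * wt m x <= 1).
    { rewrite <- RPow_abs. unfold wt. apply Rmult_le_reg_r with ((1 + Rabs x)^m); [apply pow_lt; lra|].
      rewrite Rmult_assoc, Rinv_l by (apply pow_nonzero; lra). rewrite Rmult_1_r, Rmult_1_l. apply pow_incr. lra. }
    pose proof (Rabs_pos (x ^ m)).
    apply Rle_trans with (Rabs (x^m) * (K * s ^ k * (wt m x * 1))).
    + apply Rmult_le_compat_l; auto. eapply Rle_trans; [apply HD|]. apply Rmult_le_compat_l; auto.
      eapply Rle_trans; [apply H3|]. apply Rmult_le_compat_l; lra.
    + replace (Rabs (x ^ m) * (K * s ^ k * (wt m x * 1))) with ((Rabs (x ^ m) * wt m x) * (K * s ^ k)) by ring.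
      rewrite <- (Rmult_1_l (K * s ^ k)) at 2. apply Rmult_le_compat_r; auto.
Qed.

Lemma ph_wt2 de : 0 < de <= 1/2 -> exists s K, 0 <= s < 2 * tau /\ 0 <= K /\ forall n, deriv_bound n (wt 2) s (ph de) K.
Proof.
  intros Hde. destruct (ph_deriv_bound de Hde) as [s [Hs Hb]]. destruct (Hb 2%nat) as [K [HK H]].
  exists s, K. split; auto. split; auto. intros n. eapply deriv_bound_weaken; [| | |apply (H n)]; auto; [lra|].
  intros x. apply Rmult_le_compat_l; auto. right. unfold wt. pose proof (Rabs_pos x). field. lra.
Qed.

Lemma ph_even de x : ph de (- x) = ph de x.
Proof.
  unfold ph, ff. replace ((1 - de) * - x) with (- ((1 - de) * x)) by ring. replace (tau/4*de*-x) with (- (tau/4*de*x)) by ring.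
  rewrite Hev, sinc_prod_even. ring.
Qed.

Lemma ph_sign de x : a <= Rabs x -> 0 <= ph de x.
Proof.
  intros Hx. unfold ph. apply Rmult_le_pos; [|nra]. assert (a^2 <= (Rabs x)^2) by (apply pow_incr; lra). rewrite pow2_abs in H. lra.
Qed.

Lemma ph_cvg de : 0 < de <= 1/2 -> exists J, cvg (fun x => ph de x * Wac G x) J.
Proof.
  intros Hde. destruct (ph_wt2 de Hde) as (s & K & Hs & HK & H).
  destruct (cvg_wt2 (fun x => ph de x * Wac G x) (2 * K)) as [J [HJ _]]; [|lra| |exists J; auto].
  - apply cts_mult; [apply cts_ph|apply cts_W].
  - intros x. rewrite Rabs_mult. pose proof (deriv_bound_0 _ _ _ _ _ (H 0%nat) x). pose proof (W_bounds G x). rewrite (Rabs_right (Wac G x)) by lra.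
    pose proof (Rabs_pos (ph de x)). nra.
Qed.

(** [J0] is the integral for [de = 0], negative by the balance identity. For small [de] the
    integrand is uniformly close to the limit on a fixed interval, and the tails are small uniformly
    in [de]; upper bounds are all that is needed. *)
Lemma ph_negative : exists de J, 0 < de <= 1/2 /\ cvg (fun x => ph de x * Wac G x) J /\ J < 0.
Proof.
  set (W := Wac G). pose proof (cts_W G : cts W) as CW. pose proof cts_F0 as cpseries. pose proof cts_sq as Csq.
  assert (CF2 : cts (fun x => F0 x ^ 2)) by (simpl; apply cts_mult; auto; apply cts_mult; auto; apply cts_const).
  assert (W02 : forall x, 0 <= W x <= 2) by (intros; apply W_bounds).
  set (J0 := (xi^2 - a^2) * m0). assert (HJ0 : J0 < 0). { unfold J0. assert (xi^2 < a^2) by nra. nra. }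
  set (g0 := fun x => (x^2 - a^2) * F0 x ^ 2 * W x).
  assert (Cg0 : cts g0). { unfold g0. apply cts_mult; auto. apply cts_mult; auto. apply cts_minus; auto. apply cts_const. }
  assert (Hg0 : cvg g0 J0).
  { apply (cvg_ext (fun x => (x^2 - xi^2) * F0 x ^ 2 * W x + (xi^2 - a^2) * (F0 x ^ 2 * W x))); [intros; unfold g0; ring|].
    unfold J0. rewrite <- (Rplus_0_l ((xi^2 - a^2) * m0)). apply cvg_plus; auto.
    - apply cts_mult; auto. apply cts_mult; auto. apply cts_minus; auto. apply cts_const.
    - apply cts_mult; [apply cts_const|apply cts_mult; auto].
    - apply cvg_scal; auto. apply cts_mult; auto. }
  set (q := fun x => (1 + x^2) * F0 x ^ 2).
  assert (Cq : cts q). { unfold q. apply cts_mult; auto. apply cts_plus; auto. apply cts_const. }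
  assert (Hq0 : forall x, 0 <= q x). { intros x. unfold q. apply Rmult_le_pos; [nra|apply pow2_ge_0]. }
  (* The tails will cost [16 eta = - J0 / 4]; with as much again for the middle part, the integral
     stays below [J0 / 2]. *)
  set (eta := - J0 / 64). assert (Heta : 0 < eta) by (unfold eta; lra).
  destruct (HL2 eta Heta) as [M1 HM1].
  set (M := Rmax (Rmax M1 a) 1). assert (HM : M1 <= M /\ a <= M /\ 1 <= M).
  { unfold M. pose proof (Rmax_l (Rmax M1 a) 1). pose proof (Rmax_r (Rmax M1 a) 1). pose proof (Rmax_l M1 a). pose proof (Rmax_r M1 a). lra. }
  (* The dilation factor is at least [1/2], so [|x| >= 2 M] still lands where the tail of [q] is
     below [eta]. *)
  set (r := 2 * M). assert (Hr : 0 < r) by (unfold r; lra).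
  assert (HqM : l - RInt q (-M) M < eta). { specialize (HM1 (-M) M ltac:(lra) ltac:(lra)). apply Rabs_def2 in HM1. fold q in HM1. lra. }
  destruct (Hbern (tau + 1) ltac:(lra)) as [Mb [HMb Hbb]].
  assert (BF : forall x, Rabs (F0 x) <= Mb). { intros x. pose proof (deriv_bound_0 _ _ _ _ _ (Hbb 0%nat) x) as H. unfold unitw in H. lra. }
  destruct (Hbb 1%nat) as [_ [F0' [DF [BF' _]]]].
  assert (LF : forall x y, Rabs (F0 y - F0 x) <= Mb * (tau + 1) * Rabs (y - x)).
  { intros x y. apply (lipschitz_derive F0 F0'); auto. intros t. specialize (BF' t). unfold unitw in BF'. lra. }
  assert (BP : forall x, Rabs (sinc_prod x) <= 1). { intros x. pose proof (deriv_bound_0 _ _ _ _ _ (sinc_prod_deriv_bound_unitw 0) x) as H. unfold unitw in H. lra. }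
  assert (LP : forall x, Rabs (sinc_prod x - 1) <= Rabs x).
  { intros x. destruct (sinc_prod_deriv_bound_unitw 1) as [_ [P' [DP [BP' _]]]].
    pose proof (lipschitz_derive sinc_prod P' 1 0 x DP ltac:(intros t; specialize (BP' t); unfold unitw in BP'; lra)) as H.
    rewrite sinc_prod_0, Rminus_0_r in H. lra. }
  set (C1 := Mb * (tau / 4) * r + Mb * (tau + 1) * r).
  assert (HC1 : 0 <= C1). { unfold C1. assert (0 <= Mb * (tau/4) * r) by (apply Rmult_le_pos; [apply Rmult_le_pos|]; lra). assert (0 <= Mb * (tau+1) * r) by (apply Rmult_le_pos; [apply Rmult_le_pos|]; lra). lra. }
  assert (Hclose : forall de x, 0 < de <= 1/2 -> Rabs x <= r -> Rabs (ff de x - F0 x) <= C1 * de).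
  { intros de x Hde Hx. unfold ff.
    replace (F0 ((1 - de) * x) * sinc_prod (tau / 4 * de * x) - F0 x) with (F0 ((1 - de) * x) * (sinc_prod (tau / 4 * de * x) - 1) + (F0 ((1 - de) * x) - F0 x)) by ring.
    eapply Rle_trans; [apply Rabs_triang|]. rewrite Rabs_mult.
    assert (T1 : Rabs (F0 ((1 - de) * x)) * Rabs (sinc_prod (tau / 4 * de * x) - 1) <= Mb * (tau/4 * de * r)).
    { apply Rmult_le_compat; try apply Rabs_pos; auto. eapply Rle_trans; [apply LP|]. rewrite Rabs_mult, (Rabs_right (tau/4*de)) by nra.
      apply Rmult_le_compat_l; [nra|auto]. }
    assert (T2 : Rabs (F0 ((1 - de) * x) - F0 x) <= Mb * (tau + 1) * (de * r)).
    { eapply Rle_trans; [apply LF|]. apply Rmult_le_compat_l; [apply Rmult_le_pos; lra|].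
      replace ((1 - de) * x - x) with (- (de * x)) by ring. rewrite Rabs_Ropp, Rabs_mult, (Rabs_right de) by lra. apply Rmult_le_compat_l; lra. }
    unfold C1. lra. }
  assert (Bff : forall de x, Rabs (ff de x) <= Mb).
  { intros de x. unfold ff. rewrite Rabs_mult, <- (Rmult_1_r Mb). apply Rmult_le_compat; try apply Rabs_pos; auto. }
  set (C2 := 2 * (r^2 + a^2) * (2 * Mb * C1)).
  assert (HC2 : 0 <= C2). { unfold C2. apply Rmult_le_pos; [pose proof (pow2_ge_0 r); pose proof (pow2_ge_0 a); lra|]. apply Rmult_le_pos; lra. }
  assert (Hphi : forall de x, 0 < de <= 1/2 -> Rabs x <= r -> ph de x * W x <= g0 x + C2 * de).
  { intros de x Hde Hx. unfold ph, g0. set (f := ff de x).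
    assert (Hd : Rabs (f * f - F0 x ^ 2) <= 2 * Mb * (C1 * de)).
    { replace (f * f - F0 x ^2) with ((f + F0 x) * (f - F0 x)) by ring. rewrite Rabs_mult. apply Rmult_le_compat; try apply Rabs_pos.
      - eapply Rle_trans; [apply Rabs_triang|]. pose proof (BF x). pose proof (Bff de x). fold f in H0. lra.
      - apply Hclose; auto. }
    assert (Hx2 : Rabs (x^2 - a^2) <= r^2 + a^2).
    { assert (x^2 <= r^2) by (rewrite <- (pow2_abs x); apply pow_incr; split; [apply Rabs_pos|auto]). pose proof (pow2_ge_0 x). pose proof (pow2_ge_0 a). apply Rabs_le. lra. }
    assert (H1 : Rabs ((x^2 - a^2) * (f * f - F0 x ^ 2) * W x) <= (r^2 + a^2) * (2 * Mb * (C1 * de)) * 2).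
    { rewrite !Rabs_mult. apply Rmult_le_compat; try apply Rabs_pos.
      - apply Rmult_le_pos; apply Rabs_pos.
      - apply Rmult_le_compat; try apply Rabs_pos; auto.
      - rewrite Rabs_right by (apply Rle_ge, W02). apply W02. }
    apply Rabs_le_between in H1. unfold C2. lra. }
  (* Small enough for the error [C2 de] over an interval of length [2 r] to cost at most
     [- J0 / 4]. *)
  set (de := Rmin (1/2) (- J0 / (4 * (2 * r * C2 + 1)))).
  assert (HrC : 0 <= 2 * r * C2) by (apply Rmult_le_pos; lra).
  assert (Hde : 0 < de <= 1/2). { unfold de. split; [apply Rmin_pos; [lra|apply Rdiv_lt_0_compat; lra]|apply Rmin_l]. }
  assert (Hde2 : 2 * r * C2 * de <= - J0 / 4).
  { apply Rle_trans with ((2 * r * C2 + 1) * (- J0 / (4 * (2 * r * C2 + 1)))).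
    - apply Rmult_le_compat; try lra. apply Rmin_r.
    - right. field. lra. }
  destruct (ph_cvg de Hde) as [J HJ]. exists de, J. split; auto. split; auto.
  set (la := 1 - de). assert (Hla : 1/2 <= la < 1) by (unfold la; lra).
  (* The 8 is 4 from [x^2 <= 4 (la x)^2] times 2 from [W <= 2]. The change of variables adds
     [1/la <= 2], which makes the tail bound [16 eta]. *)
  set (g := fun x => 8 * q (la * x)).
  assert (Cql : cts (fun x => q (la * x))) by (apply (cts_comp q (fun x => la * x)); auto; apply cts_lin).
  assert (Cg : cts g) by (unfold g; apply cts_mult; auto; apply cts_const).
  assert (Htail : J <= RInt (fun x => ph de x * W x) (- r) r + 16 * eta).
  { apply (cvg_tail_le _ g); auto; [lra|apply cts_mult; auto; apply cts_ph| |].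
    - intros x Hx. unfold g, q, ph, ff. fold la.
      set (y := F0 (la * x)). set (p := sinc_prod (tau / 4 * de * x)).
      assert (Hp : p * p <= 1). { pose proof (BP (tau/4*de*x)) as H. fold p in H. apply Rabs_le_between in H. nra. }
      pose proof (W02 x). pose proof (pow2_ge_0 y). pose proof (pow2_ge_0 x). pose proof (pow2_ge_0 a).
      assert (Hpp : 0 <= p * p) by nra.
      assert (Hla2 : x^2 <= 4 * (la * x)^2). { replace ((la*x)^2) with (la^2 * x^2) by ring. assert (1/4 <= la^2) by nra. nra. }
      assert (Hya : a^2 <= x^2). { rewrite <- (pow2_abs x). apply pow_incr. unfold r in Hx. lra. }
      apply Rle_trans with (x^2 * (y^2 * 1) * 2).
      + apply Rmult_le_compat; try lra; [apply Rmult_le_pos; [lra|nra]|].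
        apply Rmult_le_compat; try lra; [nra|]. replace (y * p * (y * p)) with (y^2 * (p * p)) by ring. apply Rmult_le_compat_l; lra.
      + assert (x^2 * y^2 <= 4 * (1 + (la*x)^2) * y^2) by (apply Rmult_le_compat_r; lra). lra.
    - intros b Hb. unfold g. rewrite !RInt_s by auto.
      assert (HRs : forall u v, RInt (fun x => q (la * x)) u v = / la * RInt q (la * u) (la * v)).
      { intros u v. rewrite <- (RInt_scale la q u v) by auto. rewrite RInt_s by auto. rewrite <- Rmult_assoc, Rinv_l by lra. symmetry. apply Rmult_1_l. }
      rewrite !HRs.
      pose proof (RInt_ch q (la * - b) (la * - r) (la * b) Cq) as E1. pose proof (RInt_ch q (la * - r) (la * r) (la * b) Cq) as E2.
      assert (H1 : RInt q (la * - b) (la * b) <= l). { apply cvg_ge_part; auto. nra. }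
      assert (H2 : RInt q (-M) M <= RInt q (la * - r) (la * r)). { apply RInt_mono; auto; unfold r; try nra. }
      assert (Hil : 0 < / la <= 2). { split; [apply Rinv_0_lt_compat; lra|]. replace 2 with (/ (1/2)) by field. apply Rinv_le_contravar; lra. }
      set (A1 := RInt q (la * - b) (la * - r)) in *. set (A2 := RInt q (la * r) (la * b)) in *.
      assert (A1 + A2 < eta) by lra.
      assert (0 <= A1 + A2). { assert (0 <= A1) by (apply RInt_nonneg; auto; nra). assert (0 <= A2) by (apply RInt_nonneg; auto; nra). lra. }
      replace (8 * (/ la * A1) + 8 * (/ la * A2)) with (8 * (/ la * (A1 + A2))) by ring.
      assert (/ la * (A1 + A2) <= 2 * eta) by (apply Rmult_le_compat; lra). lra. }
  assert (Hmid : RInt (fun x => ph de x * W x) (- r) r <= RInt g0 (-r) r + 2 * r * (C2 * de)).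
  { apply Rle_trans with (RInt (fun x => g0 x + C2 * de) (-r) r).
    - apply RInt_leq; [lra|apply cts_mult; auto; apply cts_ph|apply cts_plus; auto; apply cts_const|].
      intros x Hx. apply Hphi; auto. apply Rabs_le. lra.
    - rewrite RInt_p by (auto; apply cts_const). rewrite RInt_const. unfold scal; simpl; unfold mult; simpl. right; ring. }
  (* Since [r >= a], the discarded part of the limiting integrand is nonnegative. *)
  assert (H0 : RInt g0 (-r) r <= J0).
  { apply cvg_tail_ge; auto; [lra|]. intros x Hx. unfold g0. apply Rmult_le_pos; [|apply W02]. apply Rmult_le_pos; [|apply pow2_ge_0].
    assert (a^2 <= (Rabs x)^2) by (apply pow_incr; unfold r in Hx; lra). rewrite pow2_abs in H. lra. }
  unfold eta in *. lra.
Qed.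

Lemma test_function : exists phi J, even_fun phi /\ schwartz phi /\ fourier_supp_in phi (tau / PI) /\
  (forall x, a <= Rabs x -> 0 <= phi x) /\ cts phi /\ cvg (fun x => phi x * Wac G x) J /\ J < 0.
Proof.
  destruct ph_negative as (de & J & Hde & HJ & Hneg). exists (ph de), J.
  split; [intros x; apply ph_even|]. split; [apply ph_schwartz; auto|]. split.
  - destruct (ph_wt2 de Hde) as (s & K & Hs & HK & H). apply (fourier_supp _ _ s K); auto.
    (* Squaring [ff] doubled the type to [2 tau], which the [2 pi] in the Fourier transform turns
       into the radius [tau / PI]. *)
    pose proof PI_RGT_0. replace (2 * PI * (tau / PI)) with (2 * tau) by (field; lra). auto.
  - split; [apply ph_sign|]. split; [apply cts_ph|]. auto.
Qed.

End TestFunction.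

(** * Low-lying zeros *)

(** Nonnegative terms away from 0 may be dropped, but the test function can be negative at 0, so the
    term of the central point is kept exactly; [NoDup] ensures that it occurs once. *)
Lemma fold_sum_ge (h : R -> R) lst c : NoDup lst -> (forall g, In g lst -> g <> 0 -> 0 <= h g) ->
  (In 0 lst -> c = h 0) -> (~ In 0 lst -> c = 0) -> c <= fold_right Rplus 0 (map h lst).
Proof.
  intros ND. revert c. induction ND as [|g lst Hg ND IH]; intros c Hpos H0 H1.
  - simpl. rewrite H1; [lra|auto].
  - simpl. destruct (Req_dec g 0) as [->|Hn].
    + rewrite H0 by (left; auto). assert (0 <= fold_right Rplus 0 (map h lst)); [|lra].
      apply IH; auto.
      * intros g Hin. apply Hpos. right; auto.
      * intros HH. contradiction.
    + assert (0 <= h g) by (apply Hpos; [left|]; auto).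
      assert (c <= fold_right Rplus 0 (map h lst)); [|lra].
      apply IH.
      * intros g' Hin. apply Hpos. right; auto.
      * intros Hin. apply H0. right; auto.
      * intros Hin. apply H1. intros [HH|HH]; auto.
Qed.

(** The hypotheses quantify over every [m] with [Lam_mult], because the multiplicity function [mu]
    is hidden inside [zero_sum]. *)
Lemma zero_sum_ge f h l c : zero_sum f h l -> 
  (forall g m, Lam_mult f (crit g) m -> (0 < m)%nat -> g <> 0 -> 0 <= h g) ->
  (forall m, Lam_mult f (crit 0) m -> c = INR m * h 0) -> c <= l.
Proof.
  intros (mu & Hmu & Hfin & Hlim) Hpos Hc. apply le_epsilon. intros e He.
  (* The cutoff is made nonnegative so that a central zero belongs to the list. *)
  destruct (Hlim e He) as [T0 HT]. set (T := Rmax T0 0). specialize (HT T (Rmax_l _ _)).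
  destruct (Hfin T) as [lst [ND HI]]. specialize (HT lst ND HI). apply Rabs_def2 in HT.
  assert (c <= fold_right Rplus 0 (map (fun g => INR (mu g) * h g) lst)); [|lra].
  apply fold_sum_ge; [exact ND| | |].
  - intros g Hin Hg. apply HI in Hin. destruct Hin as [Hm _]. apply Rmult_le_pos; [apply pos_INR|]. apply (Hpos g (mu g)); auto.
  - intros _. apply Hc. auto.
  - intros Hn. rewrite (Hc (mu 0) (Hmu 0)). destruct (mu 0) eqn:E; [simpl; ring|].
    exfalso. apply Hn. apply HI. split; [rewrite E; lia|]. rewrite Rabs_R0. apply Rmax_r.
Qed.

Lemma avg_scal N c a : avg N (fun i => c * a i) = c * avg N a.
Proof.
  unfold avg. assert (E : forall s, fold_right Rplus 0 (map (fun i => c * a i) s) = c * fold_right Rplus 0 (map a s)).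
  { induction s; simpl; [ring|rewrite IHs; ring]. }
  rewrite E. ring.
Qed.

Lemma avg_le N a b : (forall i, (i < N)%nat -> a i <= b i) -> avg N a <= avg N b.
Proof.
  intros H. unfold avg. destruct N as [|n]; [simpl; lra|].
  apply Rmult_le_compat_l. { left. apply Rinv_0_lt_compat, lt_0_INR. lia. }
  assert (forall s, (forall i, In i s -> a i <= b i) -> fold_right Rplus 0 (map a s) <= fold_right Rplus 0 (map b s)).
  { induction s; intros Hs; simpl; [lra|]. apply Rplus_le_compat; [apply Hs; left; auto|apply IHs; intros; apply Hs; right; auto]. }
  apply H0. intros i Hi. apply H. apply in_seq in Hi. lia.
Qed.

(** Denying the conclusion of the theorem gives its inequality for infinitely many [n] rather than
    for all large [n]; between convergent sequences this is enough. *)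
Lemma is_lim_seq_frequently_le u v (l m : R) : is_lim_seq u l -> is_lim_seq v m ->
  (forall n0, exists n, (n0 <= n)%nat /\ u n <= v n) -> l <= m.
Proof.
  intros Hu Hv H. apply le_epsilon. intros e He.
  destruct (proj1 (is_lim_seq_eps u l) Hu (e/2) ltac:(lra)) as [N1 H1].
  destruct (proj1 (is_lim_seq_eps v m) Hv (e/2) ltac:(lra)) as [N2 H2].
  destruct (H (max N1 N2)) as [n [Hn Hle]]. specialize (H1 n ltac:(lia)). specialize (H2 n ltac:(lia)).
  apply Rabs_def2 in H1, H2. lra.
Qed.

Lemma Wac_sharp G x : Wac (sharp G) x = Wac G x.
Proof. destruct G; reflexivity. Qed.

Theorem theorem9
  (G : symtype) (Delta : R) (HDelta : 0 < Delta)
  (* the sequence of families F_n = {fam n i : i < N n}, with #F_n -> oo *)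
  (N : nat -> nat) (fam : nat -> nat -> Lobj)
  (HN : forall M : nat, exists n0 : nat, forall n, (n0 <= n)%nat -> (M <= N n)%nat)
  (Hok : forall n i, (i < N n)%nat -> Lobj_ok (fam n i))
  (Hdual : forall n i, (i < N n)%nat ->
     exists j, (j < N n)%nat /\ is_dual (fam n i) (fam n j))
  (* one-level density for test functions with supp \hat phi in (-Delta, Delta) *)
  (Hdens : forall phi : R -> R, even_fun phi -> schwartz phi -> fourier_supp_in phi Delta ->
     exists s : nat -> nat -> R,
       (forall n i, (i < N n)%nat ->
          zero_sum (fam n i) (fun gamma => phi (gamma * ln (cond (fam n i)) / (2 * PI))) (s n i)) /\
       is_lim_seq (fun n => avg (N n) (s n)) (int_W G phi))
  (* Z(f): sub-multiset of z n i central zeros of f = fam n i *)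
  (z : nat -> nat -> nat)
  (Hz_sub : forall n i m, (i < N n)%nat -> Lam_mult (fam n i) (crit 0) m -> (z n i <= m)%nat)
  (Hz_lim : is_lim_seq (fun n => avg (N n) (fun i => INR (z n i))) (central_count G))
  (Hz_empty : G = SU \/ G = SSp \/ G = SSOeven -> forall n i, z n i = 0%nat)
  (* K = K_{G^sharp, pi Delta} and xi0 the first positive zero of Re((1 - i x) K(i, x)) *)
  (K : C -> C -> C) (HK : repr_kernel (sharp G) (PI * Delta) K)
  (xi0 : R) (Hxi0pos : 0 < xi0)
  (Hxi0 : Re (Cmult (Cminus (RtoC 1) (Cmult Ci (RtoC xi0))) (K Ci (RtoC xi0))) = 0)
  (Hxi0min : forall x, 0 < x < xi0 ->
     Re (Cmult (Cminus (RtoC 1) (Cmult Ci (RtoC x))) (K Ci (RtoC x))) <> 0) :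
  (* limsup_n min { |gamma_f log c_f / 2pi| : f in F_n, gamma_f not in Z(f) } <= xi0 *)
  forall e : R, 0 < e -> exists n0 : nat, forall n : nat, (n0 <= n)%nat ->
    exists i gamma m, (i < N n)%nat /\ Lam_mult (fam n i) (crit gamma) m /\
      (if Req_EM_T gamma 0 then (z n i < m)%nat else (0 < m)%nat) /\
      Rabs (gamma * ln (cond (fam n i)) / (2 * PI)) < xi0 + e.
Proof.
  intros e He. pose proof PI_RGT_0 as Hpi.
  assert (Htau : 0 < PI * Delta) by (apply Rmult_lt_0_compat; lra).
  assert (HA1 := Hxi0min (xi0/2) ltac:(lra)).
  rewrite A_eq in Hxi0, HA1.
  destruct (extremal (sharp G) (PI * Delta) K Htau HK xi0 Hxi0pos Hxi0 HA1)
    as (F0 & Hev & Hbern & [l Hl] & Hbal & [m0 [Hm0 Hmass]]).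
  destruct (test_function (sharp G) (PI * Delta) xi0 (xi0 + e) F0 Htau ltac:(lra) Hev Hbern l Hl Hbal m0 Hm0 Hmass)
    as (phi & J & Pe & Ps & Pf & Pp & Pc & HJ & HJneg).
  replace (PI * Delta / PI) with Delta in Pf by (field; lra).
  destruct (Hdens phi Pe Ps Pf) as [s [Hs Hslim]].
  apply NNPP. intros Hneg.
  (* For such [n] every zero outside [Z(f)] has normalised height at least [xi0 + e], where [phi] is
     nonnegative; what remains of the density sum is the central contribution. *)
  assert (Hbad : forall n0, exists n, (n0 <= n)%nat /\ phi 0 * avg (N n) (fun i => INR (z n i)) <= avg (N n) (s n)).
  { intros n0. apply NNPP. intros Hn. apply Hneg. exists n0. intros n Hn0. apply NNPP. intros Hno. apply Hn. exists n. split; auto.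
    rewrite <- avg_scal. apply avg_le. intros i Hi.
    apply (zero_sum_ge _ _ _ _ (Hs n i Hi)).
    - intros g m Hm Hmp Hg. apply Pp. apply Rnot_lt_le. intros Hlt. apply Hno. exists i, g, m. repeat split; auto.
      destruct (Req_EM_T g 0); [contradiction|auto].
    - intros m Hm. replace (0 * ln (cond (fam n i)) / (2 * PI)) with 0 by (field; lra).
      (* [Z(f)] must exhaust the central zeros: one left over would have height 0, below
         [xi0 + e]. *)
      replace m with (z n i); [ring|]. apply Nat.le_antisymm; [eauto|].
      apply Nat.nlt_ge. intros Hlt. apply Hno. exists i, 0, m. repeat split; auto.
      + destruct (Req_EM_T 0 0); [auto|contradiction].
      + replace (0 * ln (cond (fam n i)) / (2 * PI)) with 0 by (field; lra). rewrite Rabs_R0. lra. }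
  assert (Hlim2 : is_lim_seq (fun n => phi 0 * avg (N n) (fun i => INR (z n i))) (phi 0 * central_count G)).
  { apply (is_lim_seq_scal_l (fun n => avg (N n) (fun i => INR (z n i))) (phi 0) (central_count G)). auto. }
  pose proof (is_lim_seq_frequently_le _ _ _ _ Hlim2 Hslim Hbad) as Hfin.
  unfold int_W in Hfin.
  assert (HI : RInt_gen (fun x => phi x * Wac G x) over_R over_R' = J).
  { apply (is_RInt_gen_unique (V := R_CompleteNormedModule)). apply is_RInt_gen_cvg.
    - apply cts_mult; auto. apply cts_W.
    - eapply cvg_ext; [|apply HJ]. intros x. cbv beta. rewrite Wac_sharp. auto. }
  (* The delta mass equals the limiting average of [#Z(f)], so the [phi 0] terms cancel on both
     sides and [0 <= J] remains. *)
  rewrite HI in Hfin. replace (central_count G) with (Wdelta G) in Hfin by (destruct G; reflexivity). lra.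
Qed.
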